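(* Let $Q=\mathbb{R}^+\times\mathbb{R}^+$, where $\mathbb{R}^+=(0,\infty)$, and let $u_0\in\mathcal{S}([0,\infty))$, $g_0\in C^\infty([0,\infty))$ and $f\in\mathcal{S}(\overline{Q})$. Consider the problem $$(\ast)\qquad \begin{cases} \dfrac{\partial U}{\partial t}-\dfrac{\partial^2 U}{\partial x^2}=f, & (x,t)\in Q,\\ \lim_{t\to0^+}U(x,t)=u_0(x), & x\in\mathbb{R}^+,\\ \lim_{x\to0^+}U(x,t)=g_0(t), & t\in\mathbb{R}^+.\end{cases}$$ For $x>0$, $t>0$ define $$2\pi U(x,t)=\int_{-\infty}^{\infty}e^{i\lambda x-\lambda^2t}\hat u_0(\lambda)\,d\lambda-\int_{\gamma}e^{i\lambda x-\lambda^2t}\hat u_0(-\lambda)\,d\lambda-2i\int_{\gamma}e^{i\lambda x-\lambda^2t}\lambda\,\tilde g_0(\omega(\lambda),t)\,d\lambda$$ $$\qquad+\int_{-\infty}^{\infty}e^{i\lambda x-\lambda^2t}\tilde{\hat f}(\lambda,\omega(\lambda),t)\,d\lambda-\int_{\gamma}e^{i\lambda x-\lambda^2t}\tilde{\hat f}(-\lambda,\omega(\lambda),t)\,d\lambda,$$ with the notation of the context. Then $U$ is the unique solution of $(\ast)$ in the following sense. Suppose in addition that $u_0(0)=g_0(0)$ and $u_0''(0)+f(0,0)=g_0'(0)$, and let $V(x,t)$ be a $C^2$ function in $\overline{Q}\setminus\{(0,0)\}$ which solves $(\ast)$ and satisfies: (i) $\lim_{x\to\infty}V(x,t)=0$ and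 $\sup_{x\ge1}|V_x(x,t)|<\infty$ for every $t>0$; (ii) for every $T>0$ there exists a positive function $B_T(x)$ with $\int_0^\infty B_T(x)\,dx<+\infty$ such that, for $0<t\le T$, $$|V(x,t)|^2\le B_T(x)\quad\text{and}\quad|V_t(x,t)|^2\le B_T(x)\qquad(x>0).$$ Then $V\equiv U$.
   Context: $\mathcal{S}([0,\infty))$ and $\mathcal{S}(\overline{Q})$, with $\overline{Q}=[0,\infty)\times[0,\infty)$, denote the Schwartz spaces of functions that are smooth up to the boundary and rapidly decreasing together with all their derivatives. Notation: $\omega(\lambda)=\lambda^2$ for $\lambda\in\mathbb{C}$. For $\lambda\in\mathbb{C}$ with $\operatorname{Im}\lambda\le0$, $$\hat u_0(\lambda)=\int_0^\infty e^{-i\lambda y}u_0(y)\,dy,\qquad \hat f(\lambda,t)=\int_0^\infty e^{-i\lambda y}f(y,t)\,dy.$$ Furthermore $$\tilde g_0(\omega(\lambda),t)=\int_0^t e^{\omega(\lambda)\tau}g_0(\tau)\,d\tau\quad(\lambda\in\mathbb{C}),\qquad \tilde{\hat f}(\mu,\omega(\lambda),t)=\int_0^t e^{\omega(\lambda)\tau}\hat f(\mu,\tau)\,d\tau\quad(\operatorname{Im}\mu\le0),$$ the latter being used with $\mu=\lambda$ and $\mu=-\lambda$. The contour $\gamma$ is the oriented boundary of $\{\lambda\in\mathbb{C}:\operatorname{Im}\lambda\ge0\text{ and }\operatorname{Re}(\lambda^2)\le0\}=\{\lambda:\pi/4\le\arg\lambda\le3\pi/4\}\cup\{0\}$. It is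 traversed with this domain on the left, i.e. from $\infty e^{3\pi i/4}$ along a ray to $0$ and then from $0$ along a ray to $\infty e^{\pi i/4}$. Integrals over unbounded contours are understood as improper integrals. *)

(* Defs.v *)
From HB Require Import structures.
From mathcomp Require Import all_boot all_order all_algebra.
From mathcomp Require Import all_classical all_reals all_analysis.
From mathcomp Require Export complex.

Set Implicit Arguments.
Unset Strict Implicit.
Unset Printing Implicit Defensive.

Import Order.TTheory GRing.Theory Num.Theory.
Import numFieldNormedType.Exports.

Local Open Scope classical_set_scope.
Local Open Scope ring_scope.
Local Open Scope complex_scope.

Local Notation re := (@complex.Re _).
Local Notation im := (@complex.Im _).
Notation normc := ComplexField.Normc.normc.

(* Analysis for functions with values in R[i].  R[i] carries no normed-space
   structure over R, so limits, continuity, derivatives and integrals of such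
   functions are taken on real and imaginary parts. *)

Definition cexp (R : realType) (z : R[i]) : R[i] :=
  (expR (re z))%:C * (cos (im z) +i* sin (im z)).

Definition ccvg (R : realType) (T : Type) (F : set_system T)
    (h : T -> R[i]) (l : R[i]) : Prop :=
  (re (h x) @[x --> F] --> re l) /\ (im (h x) @[x --> F] --> im l).

Definition clim (R : realType) (T : Type) (F : set_system T)
    (h : T -> R[i]) : R[i] :=
  lim (re (h x) @[x --> F]) +i* lim (im (h x) @[x --> F]).

Definition ccontinuous_on (R : realType) (T : topologicalType) (A : set T)
    (h : T -> R[i]) : Prop :=
  {within A, continuous (fun p => re (h p))} /\
  {within A, continuous (fun p => im (h p))}.

Definition cderivable (R : realType) (h : R -> R[i]) (x : R) : Prop :=
  derivable (fun y => re (h y)) x 1 /\ derivable (fun y => im (h y)) x 1.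

Definition cderive (R : realType) (h : R -> R[i]) (x : R) : R[i] :=
  derive1 (fun y => re (h y)) x +i* derive1 (fun y => im (h y)) x.

Definition cderiven (R : realType) (n : nat) (h : R -> R[i]) : R -> R[i] :=
  iter n (@cderive R) h.

Definition cintegral (R : realType) (A : set R) (h : R -> R[i]) : R[i] :=
  (\int[lebesgue_measure]_(x in A) re (h x)) +i*
  (\int[lebesgue_measure]_(x in A) im (h x)).

(* C^oo([0,oo)): the derivatives on (0,oo) extend continuously to [0,oo).
   Values of h at negative arguments are irrelevant. *)
Definition smooth_halfline (R : realType) (h : R -> R[i]) : Prop :=
  ccontinuous_on (`[0, +oo[ : set R) h /\
  forall n : nat,
    (forall x, 0 < x -> cderivable (cderiven n h) x) /\
    (exists l : R[i], ccvg 0^'+ (cderiven n h) l).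

(* h^(n)(0) for h in C^oo([0,oo)): the value at 0 of the continuous extension
   of h^(n), equivalently the iterated one-sided derivative. *)
Definition boundary_deriven (R : realType) (n : nat) (h : R -> R[i]) : R[i] :=
  clim 0^'+ (cderiven n h).

Definition schwartz_halfline (R : realType) (h : R -> R[i]) : Prop :=
  smooth_halfline h /\
  forall m n : nat, exists M : R, forall x, 0 < x ->
    x ^+ m * normc (cderiven n h x) <= M.

Definition derive_x (R : realType) (h : R -> R -> R[i]) : R -> R -> R[i] :=
  fun x t => cderive (fun y => h y t) x.

Definition derive_t (R : realType) (h : R -> R -> R[i]) : R -> R -> R[i] :=
  fun x t => cderive (h x) t.

(* A word over bool encodes an iterated partial derivative, true standing for
   d/dx and false for d/dt; the head of the word is applied last. *)
Definition partial (R : realType) (w : seq bool) (h : R -> R -> R[i]) :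
    R -> R -> R[i] :=
  foldr (fun b g => if b then derive_x g else derive_t g) h w.

Definition closed_quadrant (R : realType) : set (R * R) :=
  [set p | 0 <= p.1 /\ 0 <= p.2].

(* C^k up to the boundary, for a set A between (0,oo)^2 and its closure:
   all iterated partial derivatives of order at most k exist on (0,oo)^2 and
   extend continuously to A. *)
Definition Ck_upto (R : realType) (k : nat) (A : set (R * R))
    (h : R -> R -> R[i]) : Prop :=
  [/\ ccontinuous_on A (fun p => h p.1 p.2),
      forall w : seq bool, (size w < k)%N -> forall x t, 0 < x -> 0 < t ->
        cderivable (fun y => partial w h y t) x /\
        cderivable (partial w h x) t
    & forall w : seq bool, (size w <= k)%N ->
        exists G : R * R -> R[i], ccontinuous_on A G /\
          forall x t, 0 < x -> 0 < t -> G (x, t) = partial w h x t].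

Definition schwartz_quadrant (R : realType) (h : R -> R -> R[i]) : Prop :=
  (forall k : nat, Ck_upto k (@closed_quadrant R) h) /\
  forall (a b : nat) (w : seq bool), exists M : R,
    forall x t, 0 < x -> 0 < t ->
      x ^+ a * t ^+ b * normc (partial w h x t) <= M.

(* \hat u(lambda); used for Im lambda <= 0 only.  Here and below 'i%C is the
   pair 0 +i* 1, not the unspecified square root of -1 of numClosedFieldType. *)
Definition half_fourier (R : realType) (u : R -> R[i]) (lambda : R[i]) : R[i] :=
  cintegral `[0, +oo[ (fun y => cexp (- ('i%C * lambda * y%:C)) * u y).

Definition time_transform (R : realType) (g : R -> R[i]) (mu : R[i]) (t : R) :
    R[i] :=
  cintegral `[0, t] (fun tau => cexp (mu * tau%:C) * g tau).

Definition omega (R : realType) (lambda : R[i]) : R[i] := lambda ^+ 2.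

(* Improper integral of F(lambda) dlambda along the ray from 0 to oo*d, for a
   unit complex number d. *)
Definition ray_integral (R : realType) (d : R[i]) (F : R[i] -> R[i]) : R[i] :=
  d * clim +oo (fun A : R => cintegral `[0, A] (fun r => F (r%:C * d))).

Definition line_integral (R : realType) (F : R[i] -> R[i]) : R[i] :=
  ray_integral 1 F - ray_integral (-1) F.

(* In along the ray of argument 3pi/4, out along the ray of argument pi/4. *)
Definition gamma_integral (R : realType) (F : R[i] -> R[i]) : R[i] :=
  ray_integral (cexp ('i%C * (pi / 4)%:C)) F -
  ray_integral (cexp ('i%C * (3 * pi / 4)%:C)) F.

Definition fokas_solution (R : realType) (u0 g0 : R -> R[i])
    (f : R -> R -> R[i]) (x t : R) : R[i] :=
  let E (lambda : R[i]) :=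
    cexp ('i%C * lambda * x%:C - lambda ^+ 2 * t%:C) in
  let u0hat := half_fourier u0 in
  let fhat (lambda : R[i]) (tau : R) :=
    half_fourier (fun y => f y tau) lambda in
  let g0tilde (mu : R[i]) := time_transform g0 mu t in
  let fhattilde (lambda mu : R[i]) := time_transform (fhat lambda) mu t in
  ((2 * pi)%:C)^-1 *
  (line_integral (fun lambda => E lambda * u0hat lambda)
   - gamma_integral (fun lambda => E lambda * u0hat (- lambda))
   - 2 * 'i%C *
     gamma_integral (fun lambda => E lambda * lambda * g0tilde (omega lambda))
   + line_integral (fun lambda => E lambda * fhattilde lambda (omega lambda))
   - gamma_integral
       (fun lambda => E lambda * fhattilde (- lambda) (omega lambda))).

Definition solves_heat (R : realType) (u0 g0 : R -> R[i])
    (f : R -> R -> R[i]) (U : R -> R -> R[i]) : Prop :=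
  [/\ forall x t, 0 < x -> 0 < t ->
        [/\ cderivable (U x) t,
            cderivable (fun y => U y t) x,
            cderivable (fun y => derive_x U y t) x
          & derive_t U x t - derive_x (derive_x U) x t = f x t],
      forall x, 0 < x -> ccvg 0^'+ (U x) (u0 x)
    & forall t, 0 < t -> ccvg 0^'+ (fun x => U x t) (g0 t)].

(* Main.v *)
(** For x, t > 0 everything converges absolutely, so the contour integrals can be
    interchanged with the transforms of the data and reduce to integrals along
    rays: the real line produces the heat kernel K(x - y, t), rotating the rays of
    gamma produces K(x + y, t), and an integration by parts along gamma turns the
    moment of lambda into H = -2 K_x.  Thus U is the classical kernel solution:
    u0 against G(x, y, t) = K(x - y, t) - K(x + y, t), g0 against H(x, t - tau)
    and f against G(x, y, t - tau).  It solves the problem by differentiation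
    under the integral signs.  For uniqueness, Green's formula shows that
    tau |-> int G(x, y, t - tau) V(y, tau) dy has derivative
    H(x, t - tau) g0(tau) + int G(x, y, t - tau) f(y, tau) dy, condition (i)
    removing the boundary term at infinity; integrating over (0, t), with (ii)
    dominating both limits, gives the kernel formula for V.  Real and imaginary
    parts are treated separately. *)

Require Import Defs.
From mathcomp Require Import all_boot all_order all_algebra.
From mathcomp Require Import all_classical all_reals all_analysis.
From mathcomp Require Import measurable_realfun ring lra.

Set Implicit Arguments.
Unset Strict Implicit.
Unset Printing Implicit Defensive.

Import Order.TTheory GRing.Theory Num.Theory.
Import numFieldNormedType.Exports.

Local Open Scope classical_set_scope.
Local Open Scope ring_scope.

(** * Lebesgue integrals over subsets of the line *)

(** The obstacle to existence is the singularity of the kernels at elapsed time s = 0: the integral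
    of the second derivative of G in absolute value grows like 1/s, which is not integrable in tau
    near t. Green's formula is therefore needed for existence as well. It moves two derivatives from
    G onto the source and leaves terms bounded for x away from 0; the boundary kernel causes no
    trouble there, since exp(-x^2/(4s)) beats every power of 1/s. One abstract form of Duhamel's
    principle then serves both time convolutions. The rotation of rays is done with real integrals:
    a parameter sigma tilts the ray, and the sigma-derivative of the integrand has an explicit
    primitive in r. On gamma the modulus of exp(i lambda x - lambda^2 s) is independent of s and
    decays only like exp(-r q x), q = sin(pi/4), so convergence rests on x > 0; on the real line the
    source term gains its decay in lambda from the integration in time. In the uniqueness part the
    bound on squares is used in the form |V| <= 1 + B: the constant is integrable against kernels
    decaying like exp(-y), and B is integrable by itself. *)

Notation intble D f := (lebesgue_measure.-integrable D (EFin \o f)).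

Section integration.
Context {R : realType}.
Notation mu := (@lebesgue_measure R).
Implicit Types (D : set R) (f g : R -> R).

Lemma intble_meas D f : intble D f -> measurable_fun D f.
Proof. by move=> /(measurable_int mu)/measurable_EFinP. Qed.

Lemma intble_norm D f : intble D f -> intble D (fun x => `|f x|).
Proof. exact: (@integrable_norm _ _ _ mu). Qed.

Lemma intbleD D f g : measurable D -> intble D f -> intble D g ->
  intble D (fun x => f x + g x).
Proof. move=> mD fi gi; exact: (@integrableD _ _ _ mu D mD _ _ fi gi). Qed.

Lemma intbleB D f g : measurable D -> intble D f -> intble D g ->
  intble D (fun x => f x - g x).
Proof. move=> mD fi gi; exact: (@integrableB _ _ _ mu D mD _ _ fi gi). Qed.

Lemma intbleZ D f (c : R) : measurable D -> intble D f -> intble D (fun x => c * f x).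
Proof. move=> mD fi; exact: (@integrableZl _ _ _ mu D mD c _ fi). Qed.

Lemma intbleS D E f : measurable D -> measurable E -> E `<=` D ->
  intble D f -> intble E f.
Proof. by move=> mD mE sED; exact: (@integrableS _ _ _ mu). Qed.

Lemma eq_intble D f g : measurable D -> (forall x, D x -> f x = g x) ->
  intble D f -> intble D g.
Proof.
move=> mD fg; apply: (@eq_integrable _ _ _ mu D mD) => x /set_mem Dx /=.
by rewrite fg.
Qed.

Lemma eq_Rint D f g : (forall x, D x -> f x = g x) ->
  \int[mu]_(x in D) f x = \int[mu]_(x in D) g x.
Proof. by move=> fg; apply: eq_Rintegral => x /set_mem; exact: fg. Qed.

Lemma RintD D f g : measurable D -> intble D f -> intble D g ->
  \int[mu]_(x in D) (f x + g x) = \int[mu]_(x in D) f x + \int[mu]_(x in D) g x.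
Proof. move=> mD fi gi; exact: (@RintegralD _ _ _ mu D _ _ mD fi gi). Qed.

Lemma RintB D f g : measurable D -> intble D f -> intble D g ->
  \int[mu]_(x in D) (f x - g x) = \int[mu]_(x in D) f x - \int[mu]_(x in D) g x.
Proof. move=> mD fi gi; exact: (@RintegralB _ _ _ mu D _ _ mD fi gi). Qed.

Lemma RintZ D f (c : R) : measurable D -> intble D f ->
  \int[mu]_(x in D) (c * f x) = c * \int[mu]_(x in D) f x.
Proof. move=> mD fi; exact: (@RintegralZl _ _ _ mu D _ c mD fi). Qed.

Lemma RintN D f : measurable D -> intble D f ->
  \int[mu]_(x in D) (- f x) = - \int[mu]_(x in D) f x.
Proof. by move=> mD fi; rewrite -mulN1r -RintZ//; apply: eq_Rint => x; rewrite mulN1r. Qed.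

Lemma le_Rint D f g : measurable D -> intble D f -> intble D g ->
  (forall x, D x -> f x <= g x) ->
  \int[mu]_(x in D) f x <= \int[mu]_(x in D) g x.
Proof. move=> mD fi gi; exact: (@le_Rintegral _ _ _ mu D _ _ mD fi gi). Qed.

Lemma intble_dom D f g : measurable D -> measurable_fun D f -> intble D g ->
  (forall x, D x -> `|f x| <= g x) -> intble D f.
Proof.
move=> mD mf ig fg.
apply: (@le_integrable _ _ _ mu D mD (EFin \o f) (EFin \o g)) => // [|x Dx /=].
  exact/measurable_EFinP.
by rewrite lee_fin (le_trans (fg _ Dx))// ler_norm.
Qed.

Lemma Rint_dom D f g : measurable D -> measurable_fun D f -> intble D g ->
  (forall x, D x -> `|f x| <= g x) ->
  `|\int[mu]_(x in D) f x| <= \int[mu]_(x in D) g x.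
Proof.
move=> mD mf ig fg; have if_ := intble_dom mD mf ig fg.
apply: (le_trans (@le_normr_Rintegral _ _ _ mu D f mD if_)).
by apply: le_Rint => //; exact: intble_norm.
Qed.

Lemma Rint_dct_seq D (f_ : nat -> R -> R) f g : measurable D ->
  (forall n, measurable_fun D (f_ n)) -> intble D g ->
  (forall n x, D x -> `|f_ n x| <= g x) ->
  (forall x, D x -> f_ n x @[n --> \oo] --> f x) ->
  intble D f /\ \int[mu]_(x in D) f_ n x @[n --> \oo] --> \int[mu]_(x in D) f x.
Proof.
move=> mD mf ig fg cf.
have mlim : measurable_fun D f by apply: (measurable_fun_cvg mf).
have [||||iF _ cI] := @dominated_convergence _ _ _ mu D mD
    (fun n => EFin \o f_ n) (EFin \o f) (EFin \o g) _ _ _ ig _.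
- by move=> n; apply/measurable_EFinP; exact: mf.
- exact/measurable_EFinP.
- by apply: aeW => x Dx; apply: cvg_EFin; [exact: nearW|exact: cf].
- by apply: aeW => x n Dx; rewrite /= lee_fin; exact: fg.
split => //; apply: fine_cvg; rewrite fineK; last exact: integrable_fin_num.
exact: cI.
Qed.

Lemma eq_imp_le (a b : R) : a = b -> a <= b. Proof. by move=> ->. Qed.

Lemma cvg_dom (T : Type) (F : set_system T) (FF : Filter F) (f g : T -> R) (l : R) :
  (\forall x \near F, `|f x - l| <= g x) -> g x @[x --> F] --> 0 -> f x @[x --> F] --> l.
Proof.
move=> fg /cvgrPdist_le g0; apply/cvgrPdist_le => e e0.
have := g0 e e0; apply: filterS2 fg => x fgx; rewrite sub0r normrN distrC => gx.
exact: le_trans fgx (le_trans (ler_norm _) gx).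
Qed.

(** Dominated convergence is a statement on sequences; filters with this property inherit it. It
    holds for every filter with a countable base, in particular for those at a point, at one side of
    a point and at infinity. *)
Definition seqfilter (F : set_system R) := forall f l,
  (forall u : nat -> R, u n @[n --> \oo] --> F ->
     f (u n) @[n --> \oo] --> l) -> f x @[x --> F] --> (l : R).

(** If the limit fails for some [e], every base set contains a point violating it, and these points
    form a sequence tending to [F]. *)
Lemma seqfilter_base (F : set_system R) (FF : Filter F) (B : nat -> set R) :
  (forall n, F (B n)) ->
  (forall A, F A -> \forall n \near \oo, B n `<=` A) -> seqfilter F.
Proof.
move=> FB BA f l H; apply/cvgrPdist_lt => e e0; apply: contrapT => nF.
have : forall n, exists x, B n x /\ ~ (`|l - f x| < e).
  move=> n; apply: contrapT => nex; apply: nF.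
  apply: filterS (FB n) => x Bx; apply: contrapT => nx; apply: nex.
  by exists x.
move/choice => [u Hu].
have uF : u n @[n --> \oo] --> F.
  move=> A /BA; apply: filterS => n BnA; apply: BnA; exact: (Hu n).1.
have /cvgrPdist_lt/(_ e e0)[N _ HN] := H _ uF.
by have := HN N (leqnn N); have [_] := Hu N.
Qed.

Lemma near_invS (e : R) : 0 < e -> \forall n \near \oo, n.+1%:R^-1 < e.
Proof. by move=> e0; apply: (near_infty_natSinv_lt (PosNum e0)). Qed.

Lemma seqfilter_right (a : R) : seqfilter a^'+.
Proof.
apply: (@seqfilter_base _ _ (fun n => [set x | a < x < a + n.+1%:R^-1])).
  move=> n; near=> x; apply/andP; split.
    by near: x; exact: nbhs_right_gt.
  by rewrite -ltrBlDl; near: x; apply: nbhs_right_ltDr.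
move=> A [e /= e0 He]; have := near_invS e0; apply: filterS => n ne x /= /andP[ax xa].
by apply: He => //; rewrite /= distrC gtr0_norm ?subr_gt0// (lt_trans _ ne)// ltrBlDl.
Unshelve. all: by end_near. Qed.

Lemma seqfilter_nbhs (a : R) : seqfilter (nbhs a).
Proof.
apply: (@seqfilter_base _ _ (fun n => [set x | `|x - a| < n.+1%:R^-1])).
  by move=> n; exists (n.+1%:R^-1) => //= x /=; rewrite distrC.
move=> A [e /= e0 He]; have := near_invS e0; apply: filterS => n ne x /= ax.
by apply: He; rewrite /= distrC (lt_trans ax).
Qed.

Lemma seqfilter_dnbhs (a : R) : seqfilter a^'.
Proof.
apply: (@seqfilter_base _ _ (fun n => [set x | `|x - a| < n.+1%:R^-1 /\ x != a])).
  by move=> n; exists (n.+1%:R^-1) => //= x /=; rewrite distrC.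
move=> A [e /= e0 He]; have := near_invS e0; apply: filterS => n ne x /= [ax xa].
by apply: He => //; rewrite /= distrC (lt_trans ax).
Qed.

Lemma seqfilter_pinfty : seqfilter (+oo : set_system R).
Proof.
apply: (@seqfilter_base _ _ (fun n => [set x | n%:R < x])).
  by move=> n; exists n%:R; split => //; exact: num_real.
move=> A [M [_ HM]]; near=> n => x /= nx; apply: HM; apply: lt_trans nx.
by near: n; exact: nbhs_infty_gtr.
Unshelve. all: by end_near. Qed.

Lemma Rint_dct (F : set_system R) (FF : Filter F) D (k : R -> R -> R) f g :
  seqfilter F -> measurable D -> intble D g ->
  (\forall t \near F, measurable_fun D (k t)) ->
  (\forall t \near F, forall x, D x -> `|k t x| <= g x) ->
  (forall x, D x -> k t x @[t --> F] --> f x) ->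
  \int[mu]_(x in D) k t x @[t --> F] --> \int[mu]_(x in D) f x.
Proof.
move=> sF mD ig mk kg kf; apply: sF => u uF.
(* The hypotheses hold only eventually along [F]; shifting the sequence by [N] makes them hold for
   every term. *)
have [N _ HN] : \forall n \near \oo, measurable_fun D (k (u n)) /\
    forall x, D x -> `|k (u n) x| <= g x.
  have H : \forall t \near F, measurable_fun D (k t) /\
    forall x, D x -> `|k t x| <= g x by near=> t; split; near: t.
  exact: uF H.
rewrite -(cvg_shiftn N).
have {}HN n : measurable_fun D (k (u (n + N)%N)) /\
    forall x, D x -> `|k (u (n + N)%N) x| <= g x by apply: HN => /=; exact: leq_addl.
apply: (Rint_dct_seq (D := D) (f_ := fun n => k (u (n + N)%N)) (g := g) _ _ _ _ _).2 => //.
- by move=> n; exact: (HN n).1.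
- by move=> n; exact: (HN n).2.
move=> x Dx; rewrite (cvg_shiftn N (fun n => k (u n) x)).
by apply: (cvg_comp u (fun t => k t x) uF); exact: kf.
Unshelve. all: by end_near. Qed.

Lemma lip_of_derive (f df : R -> R) (a b M : R) : 
  (forall x, a <= x <= b -> is_derive x 1 f (df x)) ->
  (forall x, a <= x <= b -> `|df x| <= M) -> 
  a <= b -> `|f b - f a| <= M * (b - a).
Proof.
move=> fd dM ab.
have [||c] := @MVT_segment R f df a b ab.
- by move=> x; rewrite in_itv/= => /andP[ax xb]; apply: fd; rewrite !ltW.
- apply: derivable_within_continuous => x; rewrite in_itv/= => xab.
  by have [] := fd _ xab.
rewrite in_itv/= => cab ->; rewrite normrM (ger0_norm (x := b - a)) ?subr_ge0//.
by rewrite ler_wpM2r ?subr_ge0// dM.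
Qed.

(* Only Lipschitz continuity in the parameter is assumed, so that the integrand
   may have a kink. *)
Lemma derive_Rint_lip D (k : R -> R -> R) (k' : R -> R) (L : R -> R) (t0 : R) :
  measurable D ->
  (\forall t \near t0, intble D (k t)) -> intble D L ->
  (\forall t \near t0, forall x, D x -> `|k t x - k t0 x| <= L x * `|t - t0|) ->
  (forall x, D x -> is_derive t0 1 (k ^~ x) (k' x)) ->
  is_derive t0 1 (fun t => \int[mu]_(x in D) k t x) (\int[mu]_(x in D) k' x).
Proof.
move=> mD ik iL kL kd.
have ik0 : intble D (k t0) by exact: nbhs_singleton ik.
suff H : h^-1 *: (\int[mu]_(x in D) k (h + t0) x - \int[mu]_(x in D) k t0 x)
    @[h --> 0^'] --> \int[mu]_(x in D) k' x.
  have H' : h^-1 *: ((fun t => \int[mu]_(x in D) k t x) (h *: 1 + t0) -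
     \int[mu]_(x in D) k t0 x) @[h --> 0^'] --> \int[mu]_(x in D) k' x.
    by under eq_fun do rewrite scaler1.
  by apply: DeriveDef; [apply/cvg_ex; eexists; exact: H'|exact: cvg_lim H'].
have shift (P : R -> Prop) : (\forall t \near t0, P t) -> \forall h \near 0^', P (h + t0).
  move=> [e /= e0 He]; exists e => //= h /= he _; apply: He => /=.
  by move: he; rewrite sub0r normrN opprD addrCA subrr addr0 normrN.
apply: (@cvg_trans _ (\int[mu]_(x in D) (h^-1 * (k (h + t0) x - k t0 x)) @[h --> 0^'])).
  apply: near_eq_cvg; near=> h.
  have ikh : intble D (k (h + t0)) by near: h; exact: shift ik.
  by rewrite RintZ// ?RintB//; exact: intbleB.
apply: (@Rint_dct _ _ D (fun h x => h^-1 * (k (h + t0) x - k t0 x)) k' L) => //.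
- exact: seqfilter_dnbhs.
- near=> h; have ikh : intble D (k (h + t0)) by near: h; exact: shift ik.
  by apply: measurable_funM => //; apply: measurable_funB; exact: intble_meas.
- near=> h => x Dx; have h0 : h != 0 by near: h; exact: nbhs_dnbhs_neq.
  rewrite normrM normfV mulrC ler_pdivrMr ?normr_gt0//.
  have H : forall x, D x -> `|k (h + t0) x - k t0 x| <= L x * `|h + t0 - t0|.
    by near: h; exact: (shift (fun t => forall x, D x -> `|k t x - k t0 x| <= L x * `|t - t0|)).
  by have := H x Dx; rewrite addrK.
- move=> x Dx; have [+ <-] := kd x Dx.
  rewrite /derivable /derive => /cvg_ex[l Hl].
  rewrite (cvg_lim _ Hl)//.
  by move: Hl; under eq_fun do rewrite scaler1.
Unshelve. all: by end_near. Qed.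

(** The mean value inequality turns the bound [L] on the derivative into the Lipschitz hypothesis.
    Integrability at [t0] alone then spreads to nearby parameters, because [k t x] differs from
    [k t0 x] by at most [L x * e]. *)
Lemma derive_Rint D (k k' : R -> R -> R) (L : R -> R) (t0 e : R) :
  measurable D -> 0 < e -> intble D (k t0) ->
  (forall t, `|t - t0| < e -> measurable_fun D (k t)) -> intble D L ->
  (forall t x, `|t - t0| < e -> D x -> is_derive t 1 (k ^~ x) (k' t x)) ->
  (forall t x, `|t - t0| < e -> D x -> `|k' t x| <= L x) ->
  is_derive t0 1 (fun t => \int[mu]_(x in D) k t x) (\int[mu]_(x in D) k' t0 x).
Proof.
move=> mD e0 ik0 mk iL kd kL.
have lip t x : `|t - t0| < e -> D x -> `|k t x - k t0 x| <= L x * `|t - t0|.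
  move=> te Dx; have [t0t|tt0] := leP t0 t.
    rewrite (ger0_norm (x := t - t0)) ?subr_ge0//.
    have := te; rewrite ltr_norml => /andP[t1 t2].
    apply: (@lip_of_derive (k ^~ x) (k' ^~ x)) => // s /andP[s1 s2].
      by apply: kd => //; rewrite ltr_norml; lra.
    by apply: kL => //; rewrite ltr_norml; lra.
  rewrite distrC (ltr0_norm (x := t - t0)) ?subr_lt0// opprB.
  have := te; rewrite ltr_norml => /andP[t1 t2].
  apply: (@lip_of_derive (k ^~ x) (k' ^~ x)) => //; last exact: ltW.
    by move=> s /andP[s1 s2]; apply: kd => //; rewrite ltr_norml; lra.
  by move=> s /andP[s1 s2]; apply: kL => //; rewrite ltr_norml; lra.
have nt0 : \forall t \near t0, `|t - t0| < e.
  by exists e => //= t /=; rewrite distrC.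
apply: (derive_Rint_lip mD _ iL).
- near=> t; have te : `|t - t0| < e by near: t.
  apply: (@intble_dom _ _ (fun x => `|k t0 x| + L x * e)) => //.
  - exact: mk.
  - apply: intbleD => //; first exact: intble_norm.
    by under eq_fun do rewrite mulrC; exact: intbleZ.
  move=> x Dx; rewrite -(subrK (k t0 x) (k t x)) addrC.
  apply: (le_trans (ler_normD _ _)); rewrite lerD2l (le_trans (lip _ _ te Dx))//.
  apply: ler_wpM2l; last exact: ltW.
  exact: le_trans (normr_ge0 _) (kL _ _ te Dx).
- near=> t => x Dx; apply: lip => //; by near: t.
- by move=> x Dx; apply: kd => //; rewrite subrr normr0.
Unshelve. all: by end_near. Qed.

Lemma FTC2_segment (F f : R -> R) (a b : R) : a < b ->
  (forall x, a <= x <= b -> is_derive x 1 F (f x)) ->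
  (forall x, a <= x <= b -> {for x, continuous f}) ->
  intble `[a, b] f /\ \int[mu]_(x in `[a, b]) f x = F b - F a.
Proof.
move=> ab Fd fc.
have wc (h : R -> R) : (forall x, a <= x <= b -> {for x, continuous h}) ->
    {within `[a, b], continuous h}.
  move=> hc; apply: continuous_in_subspaceT => x; rewrite inE/= in_itv/=; exact: hc.
split.
  by apply: continuous_compact_integrable; [exact: segment_compact|exact: wc].
rewrite /Rintegral (@continuous_FTC2 _ f F a b)//.
- exact: wc.
- have cF x : a <= x <= b -> {for x, continuous F}.
    move=> xab; apply: differentiable_continuous; apply/derivable1_diffP.
    by have [] := Fd _ xab.
  split.
  + by move=> x; rewrite in_itv/= => /andP[ax xb]; have [] := Fd x ltac:(by rewrite !ltW).
  + by apply: cvg_at_right_filter; apply: cF; rewrite lexx ltW.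
  + by apply: cvg_at_left_filter; apply: cF; rewrite lexx ltW.
- move=> x; rewrite in_itv/= => /andP[ax xb]; rewrite derive1E.
  by have [] := Fd x ltac:(by rewrite !ltW).
Qed.

(** On each segment this is the usual fundamental theorem. The integrals over the segments converge
    to the integral over [D] by dominated convergence of the truncations of [f], with majorant the
    absolute value of [f]. *)
Lemma FTC2_exhaust D (F f : R -> R) (u v : nat -> R) (a b : R) :
  measurable D -> intble D f ->
  (forall n, u n < v n /\ `[u n, v n] `<=` D) ->
  (forall x, D x -> \forall n \near \oo, u n <= x <= v n) ->
  (forall x, D x -> is_derive x 1 F (f x)) ->
  (forall x, D x -> {for x, continuous f}) ->
  F (u n) @[n --> \oo] --> a -> F (v n) @[n --> \oo] --> b ->
  \int[mu]_(x in D) f x = b - a.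
Proof.
move=> mD if_ uv exh Fd fc Fa Fb.
have H : \int[mu]_(x in `[u n, v n]) f x @[n --> \oo] --> b - a.
  apply: cvg_trans (cvgB Fb Fa); apply: near_eq_cvg; near=> n.
  have [uvn sD] := uv n.
  have [||_ ->//] := @FTC2_segment F f _ _ uvn.
  - by move=> x xab; apply: Fd; apply: sD; rewrite /= in_itv.
  - by move=> x xab; apply: fc; apply: sD; rewrite /= in_itv.
have H' : \int[mu]_(x in `[u n, v n]) f x @[n --> \oo] --> \int[mu]_(x in D) f x.
  have E n : \int[mu]_(x in `[u n, v n]) f x = \int[mu]_(x in D) (f \_ `[u n, v n]) x.
    by rewrite -Rintegral_mkcondr (setIidr (uv n).2).
  under eq_fun do rewrite E.
  apply: (Rint_dct_seq (D := D) (f_ := fun n => f \_ `[u n, v n]) (g := fun x => `|f x|) _ _ _ _ _).2 => //.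
  - move=> n; apply/(measurable_restrict f) => //.
    by apply: measurable_funS (intble_meas if_) => //; exact: subIsetl.
  - exact: intble_norm.
  - by move=> n x Dx; rewrite patchE; case: ifP => //; rewrite normr0.
  - move=> x Dx; apply: (@cvg_trans _ (cst (f x) @ \oo)); last exact: cvg_cst.
    apply: near_eq_cvg; near=> n; rewrite patchE/= ifT// inE/= in_itv/=.
    by near: n; exact: exh.
exact: cvg_unique H' H.
Unshelve. all: by end_near. Qed.
End integration.

(** * The heat kernel *)

Section kernel.
Context {R : realType}.
Notation mu := (@lebesgue_measure R).

(** The Gaussian (4 pi s)^(-1/2) exp(-z^2/(4s)). For [s <= 0] it is 0, since both the square root
    and the inverse of 0 are 0; this is why some bounds need no sign condition on [s]. *)
Definition heatK (z s : R) : R :=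
  (Num.sqrt (4 * pi))^-1 * (Num.sqrt s)^-1 * expR (- (z ^+ 2 / 4 * s^-1)).
Definition heatK1 (z s : R) : R := - (z / 2 * s^-1) * heatK z s.
(** The second z-derivative and, for [0 < s], by the heat equation also the s-derivative. *)
Definition heatK2 (z s : R) : R := (z ^+ 2 / 4 * s^-2 - s^-1 / 2) * heatK z s.

Lemma heatKN z s : heatK (- z) s = heatK z s.
Proof. by rewrite /heatK sqrrN. Qed.

Lemma heatK_ge0 z s : 0 <= heatK z s.
Proof. by rewrite /heatK !mulr_ge0 ?invr_ge0 ?sqrtr_ge0 ?expR_ge0. Qed.

Lemma exprn_le (n : nat) (a b : R) : 0 <= a -> a <= b -> a ^+ n <= b ^+ n.
Proof. by move=> a0 ab; apply: lerXn2r => //; rewrite nnegrE// (le_trans a0). Qed.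

Lemma is_derive_inv (s : R) : 0 < s -> is_derive s 1 (fun s : R => s^-1) (- s^-2).
Proof.
move=> s0; have sn0 : s != 0 by rewrite gt_eqF.
have H := @is_deriveV R id s 1 1 sn0 (is_derive_id _ _).
by apply: (is_derive_eq H); rewrite /GRing.scale /=; field.
Qed.

(** Identifying the kernel with a normal density of variance 2s provides its integrability and its
    total mass 1. *)
Lemma heatK_pdf x y s : 0 < s -> heatK (x - y) s = normal_pdf x (Num.sqrt (2 * s)) y.
Proof.
move=> s0; have s2 : Num.sqrt (2 * s) != 0 by rewrite gt_eqF// sqrtr_gt0 mulr_gt0.
rewrite normal_pdfE// /normal_peak /normal_fun sqr_sqrtr ?mulr_ge0// ?ltW//.
rewrite /heatK -invfM -sqrtrM ?mulr_ge0 ?pi_ge0//; congr (_ * expR _).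
  by congr (Num.sqrt _)^-1; ring.
by field; rewrite gt_eqF.
Qed.

Lemma intble_heatK x s : 0 < s -> intble setT (fun y => heatK (x - y) s).
Proof.
move=> s0; apply: (@eq_intble _ _ (normal_pdf x (Num.sqrt (2 * s)))) => //.
  by move=> y _; rewrite heatK_pdf.
exact: integrable_normal_pdf.
Qed.

Lemma Rint_heatK x s : 0 < s -> \int[mu]_(y in setT) heatK (x - y) s = 1.
Proof.
move=> s0; rewrite (eq_Rint (g := normal_pdf x (Num.sqrt (2 * s)))); last first.
  by move=> y _; rewrite heatK_pdf.
by rewrite /Rintegral integral_normal_pdf.
Qed.

Lemma is_derive_heatK_z (s z : R) : is_derive z 1 (heatK ^~ s) (heatK1 z s).
Proof.
rewrite /heatK1 /heatK; apply: is_derive_eq; rewrite /GRing.scale /=.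
by move: (Num.sqrt (4 * pi))^-1 (Num.sqrt s)^-1 s^-1 => c d p; field.
Qed.

Lemma is_derive_heatK1_z (s z : R) : is_derive z 1 (heatK1 ^~ s) (heatK2 z s).
Proof.
have H := is_derive_heatK_z s z.
rewrite /heatK2 {1}/heatK1; apply: is_derive_eq; rewrite /GRing.scale /=.
by rewrite /heatK1 -(exprVn s); move: s^-1 (heatK z s) => p k; field.
Qed.

Lemma is_derive_heatK_s (z s : R) : 0 < s -> is_derive s 1 (heatK z) (heatK2 z s).
Proof.
move=> s0; have H := is_derive_inv s0; have Hs := is_derive1_sqrt s0.
have q0 : 0 < Num.sqrt s by rewrite sqrtr_gt0.
have H2 := @is_deriveV R Num.sqrt s _ 1 (lt0r_neq0 q0) Hs.
rewrite /heatK2 /heatK; apply: is_derive_eq; rewrite /GRing.scale /=.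
move: (expR _) (Num.sqrt (4 * pi))^-1 => e c.
have E : s = (Num.sqrt s) ^+ 2 by rewrite sqr_sqrtr ?ltW.
move: (Num.sqrt s) q0 E {H Hs H2} => q q0 ->.
by field; rewrite gt_eqF.
Qed.

Lemma ler_expR_id (u : R) : u <= expR u.
Proof. by apply: le_trans (expR_ge1Dx u); rewrite lerDr. Qed.

Lemma sqr_le_expR (u : R) : u ^+ 2 <= 4 * expR `|u|.
Proof.
have -> : u ^+ 2 = 4 * (`|u| / 2) ^+ 2 by rewrite exprMn real_normK ?num_real//; field.
rewrite ler_pM2l// -[X in expR X](_ : `|u| / 2 * 2 = `|u|); last by field.
by rewrite expRM_natr lerXn2r ?nnegrE ?divr_ge0 ?expR_ge0// ler_expR_id.
Qed.

(** For [s] in a compact subset of (0, oo) the Gaussian is at most a multiple of exp(-2|z|). One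
    factor exp(-|z|) absorbs the polynomial prefactors of the derivatives, the other one remains. *)
Lemma heatK_env (a b : R) : 0 < a -> exists2 C, 0 <= C & forall z s, a <= s <= b ->
  [/\ `|heatK z s| <= C * expR (- `|z|), `|heatK1 z s| <= C * expR (- `|z|) &
      `|heatK2 z s| <= C * expR (- `|z|)].
Proof.
move=> a0; pose c := (Num.sqrt (4 * pi))^-1 * (Num.sqrt a)^-1 : R.
(* [N] dominates the coefficients of all three prefactors, using that the inverse of [s] is at most
   that of [a]. *)
pose N : R := 1 + a^-1 + a^-2.
have c0 : 0 <= c by rewrite mulr_ge0 ?invr_ge0 ?sqrtr_ge0.
have ai : 0 < a^-1 by rewrite invr_gt0.
have N0 : 0 <= N by rewrite /N -exprVn; nra.
exists (c * expR (4 * b) * N) => [|z s /andP[as_ sb]].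
  by rewrite !mulr_ge0 ?expR_ge0.
have s0 : 0 < s by apply: lt_le_trans as_.
have si : s^-1 <= a^-1 by rewrite lef_pV2.
have si0 : 0 < s^-1 by rewrite invr_gt0.
have KE : `|heatK z s| <= c * expR (4 * b) * expR (- (2 * `|z|)).
  rewrite ger0_norm ?heatK_ge0// /heatK -[leRHS]mulrA -expRD /c.
  apply: ler_pM; rewrite ?mulr_ge0 ?invr_ge0 ?sqrtr_ge0 ?expR_ge0//.
    by rewrite ler_wpM2l ?invr_ge0 ?sqrtr_ge0// lef_pV2 ?posrE ?sqrtr_gt0// ler_wsqrtr.
  rewrite ler_expR -(real_normK (num_real z)).
  (* Completing the square gives z^2/(4s) >= 2|z| - 4s, whence the factor [expR (4 * b)]. *)
  have : 0 <= (`|z| / 2 - 2 * s) ^+ 2 * s^-1 by rewrite mulr_ge0 ?sqr_ge0 ?ltW.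
  have -> : (`|z| / 2 - 2 * s) ^+ 2 * s^-1 = `|z| ^+ 2 / 4 * s^-1 - 2 * `|z| + 4 * s.
    by field; rewrite gt_eqF.
  lra.
have E1 : expR (- `|z|) <= 1 by rewrite expR_le1 oppr_le0.
have e0 : 0 < expR (- `|z|) := expR_gt0 _.
have E2 : `|z| * expR (- (2 * `|z|)) <= expR (- `|z|).
  have -> : expR (- (2 * `|z|)) = expR (- `|z|) * expR (- `|z|).
    by rewrite -expRD; congr expR; ring.
  rewrite mulrA ler_piMl ?expR_ge0// expRN ler_pdivrMr ?expR_gt0// mul1r.
  exact: ler_expR_id.
have E3 : z ^+ 2 * expR (- (2 * `|z|)) <= 4 * expR (- `|z|).
  have -> : expR (- (2 * `|z|)) = expR (- `|z|) * expR (- `|z|).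
    by rewrite -expRD; congr expR; ring.
  rewrite mulrA ler_wpM2r ?expR_ge0// expRN ler_pdivrMr ?expR_gt0//.
  exact: sqr_le_expR.
have E0 : expR (- (2 * `|z|)) <= expR (- `|z|) by rewrite ler_expR; have := normr_ge0 z; lra.
set A := c * expR (4 * b) in KE *.
have A0 : 0 <= A by rewrite mulr_ge0 ?expR_ge0.
have B (w M : R) : 0 <= M -> M <= N -> `|w| * expR (- (2 * `|z|)) <= M * expR (- `|z|) ->
    `|w * heatK z s| <= A * N * expR (- `|z|).
  move=> M0 MN H; rewrite normrM.
  apply: (@le_trans _ _ (`|w| * (A * expR (- (2 * `|z|))))); first by rewrite ler_wpM2l.
  rewrite mulrCA -mulrA ler_wpM2l// (le_trans H)// ler_wpM2r// ltW//.
have a2 : 0 < a^-2 by rewrite -exprVn exprn_gt0.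
split.
- have := B 1 1 ler01; rewrite normr1 !mul1r; apply => //.
  by rewrite /N; lra.
- apply: (B _ a^-1); [exact: ltW|by rewrite /N; lra|].
  rewrite normrN normrM (ger0_norm (ltW si0)) normrM (@ger0_norm _ 2^-1)//.
  rewrite mulrAC -[X in _ <= X]mulrC; apply: ler_pM => //.
  - exact: ltW.
  - rewrite mulrAC; have := normr_ge0 z; have := expR_ge0 (- (2 * `|z|)); nra.
- apply: (B _ N) => //.
  have s2 : s^-2 <= a^-2 by rewrite -!exprVn exprn_le// ltW.
  have s20 : 0 < s^-2 by rewrite -exprVn exprn_gt0.
  apply: (@le_trans _ _ ((z ^+ 2 / 4 * a^-2 + a^-1 / 2) * expR (- (2 * `|z|)))).
    have u0 : 0 <= z ^+ 2 / 4 * s^-2 by rewrite mulr_ge0 ?(ltW s20)// mulr_ge0// sqr_ge0.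
    have v0 : 0 <= s^-1 / 2 by rewrite mulr_ge0// ltW.
    rewrite ler_wpM2r ?expR_ge0// (le_trans (ler_normB _ _))//.
    rewrite (ger0_norm u0) (ger0_norm v0) lerD//; last by rewrite ler_wpM2r.
    by rewrite ler_wpM2l// mulr_ge0// sqr_ge0.
  have -> : (z ^+ 2 / 4 * a^-2 + a^-1 / 2) * expR (- (2 * `|z|)) =
    (z ^+ 2 * expR (- (2 * `|z|))) / 4 * a^-2 + a^-1 / 2 * expR (- (2 * `|z|)) by ring.
  by rewrite /N; nra.
Qed.

Lemma heatK_le z s : heatK z s <= (Num.sqrt (4 * pi))^-1 * (Num.sqrt s)^-1.
Proof.
rewrite /heatK; case: (leP 0 s) => s0; last first.
  by rewrite (ler0_sqrtr (ltW s0)) invr0 !(mulr0, mul0r).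
rewrite ler_piMr ?mulr_ge0 ?invr_ge0 ?sqrtr_ge0// expR_le1 oppr_le0.
by rewrite mulr_ge0 ?invr_ge0// mulr_ge0 ?sqr_ge0.
Qed.

(** Half of the exponent z^2/(4s) is spent on the small factor exp(-d^2/(8s)), and the other half is
    the exponent of the kernel at time 2s. The change of prefactor costs the square root of 2,
    rounded up to 2. *)
Lemma heatK_far (d z s : R) : 0 < s -> 0 <= d -> d <= `|z| ->
  heatK z s <= 2 * expR (- (d ^+ 2 / 8 * s^-1)) * heatK z (2 * s).
Proof.
move=> s0 d0 dz; have si0 : 0 < s^-1 by rewrite invr_gt0.
have d2 : d ^+ 2 <= z ^+ 2 by rewrite -(real_normK (num_real z)) lerXn2r ?nnegrE.
have E : expR (- (z ^+ 2 / 4 * s^-1)) <=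
    expR (- (d ^+ 2 / 8 * s^-1)) * expR (- (z ^+ 2 / 4 * (2 * s)^-1)).
  rewrite -expRD ler_expR invfM; nra.
have q2 : 0 < Num.sqrt s by rewrite sqrtr_gt0.
have S : (Num.sqrt s)^-1 <= 2 * (Num.sqrt (2 * s))^-1.
  rewrite ler_pdivlMr ?sqrtr_gt0 ?mulr_gt0// mulrC ler_pdivrMr// sqrtrM//.
  rewrite ler_wpM2r ?sqrtr_ge0// -[leRHS]ger0_norm// -sqrtr_sqr ler_wsqrtr//; lra.
rewrite /heatK.
have -> : 2 * expR (- (d ^+ 2 / 8 * s^-1)) * ((Num.sqrt (4 * pi))^-1 * (Num.sqrt (2 * s))^-1 *
   expR (- (z ^+ 2 / 4 * (2 * s)^-1))) = (Num.sqrt (4 * pi))^-1 * (2 * (Num.sqrt (2 * s))^-1) *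
   (expR (- (d ^+ 2 / 8 * s^-1)) * expR (- (z ^+ 2 / 4 * (2 * s)^-1))) by ring.
apply: ler_pM => //; rewrite ?mulr_ge0 ?invr_ge0 ?sqrtr_ge0 ?expR_ge0//.
by rewrite ler_wpM2l ?invr_ge0 ?sqrtr_ge0.
Qed.

Lemma continuous_heatK s : continuous (heatK ^~ s).
Proof.
move=> z; apply: differentiable_continuous; apply/derivable1_diffP.
by have [] := is_derive_heatK_z s z.
Qed.

Lemma continuous_heatK1 s : continuous (heatK1 ^~ s).
Proof.
move=> z; apply: differentiable_continuous; apply/derivable1_diffP.
by have [] := is_derive_heatK1_z s z.
Qed.

Lemma continuous_heatK2 s : continuous (heatK2 ^~ s).
Proof.
move=> z; rewrite /heatK2; apply: cvgM; last exact: continuous_heatK.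
apply: cvgB; last exact: cvg_cst.
by apply: cvgMr_tmp; apply: cvgMr_tmp; apply: exprn_continuous.
Qed.

(* Dirichlet heat kernel of the half-line *)
Definition heatG (x y s : R) : R := heatK (x - y) s - heatK (x + y) s.
Definition heatGx (x y s : R) : R := heatK1 (x - y) s - heatK1 (x + y) s.
Definition heatGy (x y s : R) : R := - heatK1 (x - y) s - heatK1 (x + y) s.
(** One formula for three derivatives of [heatG]: twice in x, twice in y, and once in s. *)
Definition heatG2 (x y s : R) : R := heatK2 (x - y) s - heatK2 (x + y) s.

Lemma is_derive_shift_comp (f : R -> R) (c x df : R) : is_derive (x + c) 1 f df ->
  is_derive x 1 (fun x => f (x + c)) df.
Proof.
move=> H.
by have := @is_derive1_comp R f (fun x => x + c) x df 1 H _; rewrite mulr1; apply; apply: is_derive_eq; rewrite addr0.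
Qed.

Lemma is_derive_refl_comp (f : R -> R) (c x df : R) : is_derive (c - x) 1 f df ->
  is_derive x 1 (fun x => f (c - x)) (- df).
Proof.
move=> H.
have := @is_derive1_comp R f (fun x => c - x) x df (-1) H _; rewrite mulrN1; apply.
by apply: is_derive_eq; rewrite /GRing.scale /=; ring.
Qed.

Lemma is_derive_heatG_x (y s x : R) : is_derive x 1 (fun x => heatG x y s) (heatGx x y s).
Proof.
by apply: is_deriveB; apply: (is_derive_shift_comp (f := heatK ^~ s)); exact: is_derive_heatK_z.
Qed.

Lemma is_derive_heatGx_x (y s x : R) : is_derive x 1 (fun x => heatGx x y s) (heatG2 x y s).
Proof.
by apply: is_deriveB; apply: (is_derive_shift_comp (f := heatK1 ^~ s)); exact: is_derive_heatK1_z.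
Qed.

Lemma is_derive_heatG_s (x y s : R) : 0 < s -> is_derive s 1 (heatG x y) (heatG2 x y s).
Proof. by move=> s0; apply: is_deriveB; exact: is_derive_heatK_s. Qed.

Lemma is_derive_heatG_y (x s y : R) : is_derive y 1 (fun y => heatG x y s) (heatGy x y s).
Proof.
apply: is_deriveB.
  by apply: (is_derive_refl_comp (f := heatK ^~ s)); exact: is_derive_heatK_z.
under eq_fun do rewrite addrC; rewrite addrC.
by apply: (is_derive_shift_comp (f := heatK ^~ s)); exact: is_derive_heatK_z.
Qed.

Lemma is_derive_heatGy_y (x s y : R) : is_derive y 1 (fun y => heatGy x y s) (heatG2 x y s).
Proof.
apply: is_deriveB.
  rewrite -[X in is_derive _ _ _ X]opprK; apply: is_deriveN.
  by apply: (is_derive_refl_comp (f := heatK1 ^~ s)); exact: is_derive_heatK1_z.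
under eq_fun do rewrite addrC; rewrite addrC.
by apply: (is_derive_shift_comp (f := heatK1 ^~ s)); exact: is_derive_heatK1_z.
Qed.

(** The envelope in |x - y| becomes one in y because |x - y| >= y - x, at the cost of the factor
    [expR] of |X|. *)
Lemma heatG_env (a b X : R) : 0 < a -> exists2 C, 0 <= C & forall x y s, 0 < x <= X -> 0 < y ->
  a <= s <= b ->
  [/\ `|heatG x y s| <= C * expR (- y), `|heatGx x y s| <= C * expR (- y),
      `|heatGy x y s| <= C * expR (- y) & `|heatG2 x y s| <= C * expR (- y)].
Proof.
move=> a0; have [C C0 HC] := heatK_env b a0.
exists (2 * C * expR `|X|) => [|x y s /andP[x0 xX] y0 sab]; first by rewrite !mulr_ge0 ?expR_ge0.
have [m0 m1 m2] := HC (x - y) s sab; have [p0 p1 p2] := HC (x + y) s sab.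
have E1 : C * expR (- `|x - y|) <= C * expR `|X| * expR (- y).
  rewrite -mulrA ler_wpM2l// -expRD ler_expR.
  have := ler_norm (y - x); have := ler_norm X; rewrite distrC; lra.
have E2 : C * expR (- `|x + y|) <= C * expR `|X| * expR (- y).
  rewrite -mulrA ler_wpM2l// -expRD ler_expR.
  have := ler_norm (x + y); have := normr_ge0 X; lra.
have B (u v : R) : `|u| <= C * expR (- `|x - y|) -> `|v| <= C * expR (- `|x + y|) ->
    `|u - v| <= 2 * C * expR `|X| * expR (- y).
  by move=> Hu Hv; apply: (le_trans (ler_normB _ _)); clear - Hu Hv E1 E2; lra.
by split; apply: B => //; rewrite normrN.
Qed.

Lemma continuous_heatG_y (x s : R) : continuous (fun y => heatG x y s).
Proof.
move=> y; apply: differentiable_continuous; apply/derivable1_diffP.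
by have [] := is_derive_heatG_y x s y.
Qed.

Lemma continuous_pm (f : R -> R) (x : R) : continuous f ->
  continuous (fun y => f (x - y)) /\ continuous (fun y => f (x + y)).
Proof.
move=> cf; split=> y.
  apply: (continuous_comp (f := fun y => x - y) (g := f)); last exact: cf.
  by apply: cvgB; [exact: cvg_cst|exact: cvg_id].
apply: (continuous_comp (f := fun y => x + y) (g := f)); last exact: cf.
by apply: cvgD; [exact: cvg_cst|exact: cvg_id].
Qed.

Lemma continuous_heatG2_y (x s : R) : continuous (fun y => heatG2 x y s).
Proof.
by have [h1 h2] := continuous_pm x (@continuous_heatK2 s) => y; apply: cvgB; [exact: h1|exact: h2].
Qed.

Lemma continuous_heatGx_y (x s : R) : continuous (fun y => heatGx x y s).
Proof.
by have [h1 h2] := continuous_pm x (@continuous_heatK1 s) => y; apply: cvgB; [exact: h1|exact: h2].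
Qed.

(** The reference majorant on the half-line: exponentials and Gaussians, also when multiplied by 1 +
    r, are compared with it. *)
Lemma intble_oneDsqr : intble `]0, +oo[ (fun y : R => (1 + y ^+ 2)^-1).
Proof.
apply: (@intbleS _ `[0, +oo[) => //.
  by move=> y /=; rewrite !in_itv/= !andbT; exact: ltW.
apply/integrableP; split.
  apply/measurable_EFinP; apply: measurable_funTS; exact: (continuous_measurable_fun (@continuous_oneDsqrV R)).
under eq_integral.
  move=> y _; rewrite gee0_abs; last by rewrite lee_fin invr_ge0 addr_ge0// sqr_ge0.
  over.
by have := @integral0y_oneDsqr R; rewrite /oneDsqr => ->; rewrite ltry.
Qed.

Lemma expRN_le_oneDsqr (y : R) : 0 <= y -> expR (- y) <= 5 * (1 + y ^+ 2)^-1.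
Proof.
move=> y0; rewrite ler_pdivlMr ?ltr_wpDr ?sqr_ge0// expRN mulrC ler_pdivrMr ?expR_gt0//.
have := sqr_le_expR y; rewrite ger0_norm//; have : 1 <= expR y by have := expR_ge1Dx y; lra.
lra.
Qed.

Lemma intble_expRN : intble `]0, +oo[ (fun y : R => expR (- y)).
Proof.
apply: (@intble_dom _ _ _ (fun y => 5 * (1 + y ^+ 2)^-1)) => //.
- apply: measurable_funTS; apply: continuous_measurable_fun => y.
  by apply: (@cvg_comp _ _ _ -%R expR); [exact: (cvgN cvg_id)|exact: continuous_expR].
- by apply: intbleZ => //; exact: intble_oneDsqr.
- move=> y /=; rewrite in_itv/= andbT => y0; rewrite ger0_norm ?expR_ge0//.
  by rewrite expRN_le_oneDsqr// ltW.
Qed.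
End kernel.

(** * The boundary kernel and Green's formula *)

Section kernel2.
Context {R : realType}.
Notation mu := (@lebesgue_measure R).

Definition heatH (x s : R) : R := - 2 * heatK1 x s.
(** The second x-derivative of [heatH] and, for [0 < s], also its s-derivative: [heatH] solves the
    heat equation. *)
Definition heatH2 (x s : R) : R :=
  (x ^+ 3 / 4 * s^-1 ^+ 3 - 3 / 2 * x * s^-1 ^+ 2) * heatK x s.

Lemma heatHE x s : heatH x s = x * s^-1 * heatK x s.
Proof. by rewrite /heatH /heatK1; move: s^-1 (heatK x s) => p k; field. Qed.

Lemma heatH_ge0 x s : 0 <= x -> 0 <= s -> 0 <= heatH x s.
Proof. by move=> x0 s0; rewrite heatHE !mulr_ge0 ?invr_ge0 ?heatK_ge0. Qed.

Lemma is_derive_heatH_x (s x : R) : is_derive x 1 (heatH ^~ s) (- 2 * heatK2 x s).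
Proof.
have H := is_derive_heatK1_z s x.
by rewrite /heatH; apply: is_derive_eq; rewrite /GRing.scale /=; ring.
Qed.

Lemma is_derive_heatHx_x (s x : R) :
  is_derive x 1 (fun x => - 2 * heatK2 x s) (heatH2 x s).
Proof.
have H := is_derive_heatK_z s x.
rewrite /heatK2; apply: is_derive_eq; rewrite /GRing.scale /= /heatH2 /heatK1 -(exprVn s).
by move: s^-1 (heatK x s) => p k; field.
Qed.

Lemma is_derive_heatH_s (x s : R) : 0 < s -> is_derive s 1 (heatH x) (heatH2 x s).
Proof.
move=> s0; have H := is_derive_heatK_s x s0; have Hi := is_derive_inv s0.
rewrite /heatH /heatK1; apply: is_derive_eq; rewrite /GRing.scale /= /heatH2 /heatK2 -(exprVn s).
by move: s^-1 (heatK x s) => p k; field.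
Qed.

(** The bounds are uniform in all [s > 0]: for [x >= d] the factor exp(-x^2/(4s)) beats every power
    of 1/s. The middle bound gives the vanishing initial value of the boundary potential. *)
Lemma heatH_bound (d X : R) : 0 < d -> exists2 C, 0 <= C & forall x s, d <= x <= X ->
  0 < s -> [/\ `|heatH x s| <= C, `|heatH x s| <= C * s & `|heatH2 x s| <= C].
Proof.
(* With p = 1/s, raising m (1 + p) <= exp(m (1 + p)) to the fifth power yields exp(-c p) <= A (1 +
   p)^(-5), where 5 m = c. One of the five powers pays for the inverse square root of s, the other
   four absorb the powers of p, of which p^3 is the highest. *)
move=> d0; pose c := d ^+ 2 / 4; pose m := c / 5; pose A := m^-1 ^+ 5 * expR c.
have c0 : 0 < c by rewrite divr_gt0 ?exprn_gt0.
have m0 : 0 < m by rewrite divr_gt0.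
have A0 : 0 <= A by rewrite mulr_ge0 ?expR_ge0 ?exprn_ge0// invr_ge0 ltW.
pose k := (Num.sqrt (4 * pi))^-1 : R.
have k0 : 0 <= k by rewrite invr_ge0 sqrtr_ge0.
(* [Y] bounds both coefficients in [heatH2]; adding |X| covers [heatH] as well. *)
pose Y := 3 / 2 * `|X| + `|X| ^+ 3 / 4.
have Y0 : 0 <= Y by rewrite addr_ge0 ?mulr_ge0// exprn_ge0.
have kA : 0 <= k * A by rewrite mulr_ge0.
have C0 : 0 <= (`|X| + Y) * (k * A) by rewrite mulr_ge0// addr_ge0.
exists ((`|X| + Y) * (k * A)) => [|x s /andP[dx xX] s0].
  exact: C0.
have x0 : 0 < x by apply: lt_le_trans dx.
pose p := s^-1; have p0 : 0 < p by rewrite invr_gt0.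
have p1 : 0 < 1 + p by rewrite addr_gt0.
have E : expR (- (x ^+ 2 / 4 * p)) <= A * (1 + p)^-1 ^+ 5.
  rewrite exprVn ler_pdivlMr ?exprn_gt0//.
  have H1 : (1 + p) ^+ 5 <= A * expR (c * p).
    have := ler_expR_id (m * (1 + p)) => H.
    have : (m * (1 + p)) ^+ 5 <= expR (m * (1 + p)) ^+ 5.
      by apply: exprn_le => //; rewrite mulr_ge0 ?ltW.
    rewrite -expRM_natr exprMn (_ : m * (1 + p) * 5 = c + c * p); last by rewrite /m; field.
    rewrite expRD => H2; rewrite /A exprVn -mulrA ler_pdivlMl ?exprn_gt0//.
  have H3 : expR (- (x ^+ 2 / 4 * p)) <= expR (- (c * p)).
    rewrite ler_expR lerN2 ler_wpM2r ?(ltW p0)// /c ler_wpM2r// exprn_le// ltW//.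
  apply: (@le_trans _ _ (expR (- (c * p)) * (A * expR (c * p)))).
    by apply: ler_pM; rewrite ?expR_ge0// exprn_ge0// ltW.
  by rewrite mulrCA -expRD addNr expR0 mulr1.
have Sq : (Num.sqrt s)^-1 <= 1 + p.
  have q0 : 0 < Num.sqrt s by rewrite sqrtr_gt0.
  rewrite /p -{2}(sqr_sqrtr (ltW s0)) -exprVn.
  have := sqr_ge0 ((Num.sqrt s)^-1 - 1); have : 0 < (Num.sqrt s)^-1 by rewrite invr_gt0.
  nra.
have KE : heatK x s <= k * A * (1 + p)^-1 ^+ 4.
  rewrite /heatK -/k -/p.
  apply: (@le_trans _ _ (k * (1 + p) * (A * (1 + p)^-1 ^+ 5))).
    apply: ler_pM; rewrite ?expR_ge0// ?mulr_ge0 ?invr_ge0 ?sqrtr_ge0//.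
    by rewrite ler_wpM2l.
  by apply: eq_imp_le; field; rewrite gt_eqF.
have K0 := heatK_ge0 x s.
have XX : x <= `|X| by rewrite (le_trans xX)// ler_norm.
pose r := (1 + p)^-1.
have r0 : 0 < r by rewrite invr_gt0.
have r1 : r <= 1 by rewrite invf_le1// lerDl ltW.
have pr : p * r <= 1 by rewrite ler_pdivrMr// mul1r lerDr.
have rs : r <= s by rewrite -[leRHS]invrK lef_pV2 ?posrE// -/p lerDr.
have B1 (w i : R) : 0 <= w -> w <= (`|X| + Y) * i ->
   w * heatK x s <= (`|X| + Y) * (k * A) * (i * r ^+ 4).
  move=> w0 wi.
  apply: (@le_trans _ _ ((`|X| + Y) * i * (k * A * r ^+ 4))); first exact: ler_pM.
  by apply: eq_imp_le; ring.
have rr (i : nat) : 0 <= r ^+ i <= 1 by rewrite exprn_ge0 ?exprn_ile1// ltW.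
have pr0 : 0 <= p * r by rewrite mulr_ge0 ?ltW.
have pri (i : nat) : 0 <= (p * r) ^+ i <= 1 by rewrite exprn_ge0 ?exprn_ile1.
have HH : `|heatH x s| <= (`|X| + Y) * (k * A) * (p * r ^+ 4).
  rewrite heatHE normrM (ger0_norm K0) ger0_norm ?mulr_ge0 ?(ltW x0) ?(ltW p0)//.
  apply: (B1 (x * p) p); first by rewrite mulr_ge0 ?ltW.
  by rewrite ler_wpM2r ?(ltW p0)// (le_trans XX)// lerDl.
split.
- apply: (le_trans HH); rewrite ler_piMr//.
  have -> : p * r ^+ 4 = (p * r) * r ^+ 3 by ring.
  by have /andP[? ?] := rr 3%N; rewrite mulr_ile1.
- apply: (le_trans HH); rewrite ler_wpM2l//.
  have -> : p * r ^+ 4 = (p * r) * (r ^+ 2 * r) by ring.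
  apply: (@le_trans _ _ (1 * (1 * r))); last by rewrite !mul1r.
  have /andP[? ?] := rr 2%N.
  by apply: ler_pM => //; [rewrite mulr_ge0// ltW|rewrite ler_wpM2r// ltW].
- rewrite /heatH2 -/p normrM (ger0_norm K0).
  apply: (@le_trans _ _ ((`|X| + Y) * (k * A) * ((p ^+ 2 + p ^+ 3) * r ^+ 4))).
    apply: (B1 _ (p ^+ 2 + p ^+ 3)) => //; rewrite (le_trans (ler_normB _ _))//.
    have u0 : 0 <= x ^+ 3 / 4 * p ^+ 3 by rewrite !mulr_ge0// ?exprn_ge0 ?ltW.
    have v0 : 0 <= 3 / 2 * x * p ^+ 2 by rewrite !mulr_ge0// ?exprn_ge0 ?ltW.
    rewrite (ger0_norm u0) (ger0_norm v0).
    have P2 : 0 <= p ^+ 2 by rewrite exprn_ge0 ?ltW.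
    have P3 : 0 <= p ^+ 3 by rewrite exprn_ge0 ?ltW.
    have X3 : x ^+ 3 <= `|X| ^+ 3 by rewrite exprn_le// ltW.
    have X4 : 0 <= `|X| ^+ 3 by rewrite exprn_ge0.
    have X0 := normr_ge0 X.
    apply: (@le_trans _ _ (Y * p ^+ 3 + Y * p ^+ 2)).
      by apply: lerD; rewrite ler_wpM2r// /Y; clear - X0 X3 X4 XX; lra.
    rewrite -mulrDr (addrC (p ^+ 3)); apply: ler_wpM2r; first exact: addr_ge0.
    by rewrite -[leLHS]add0r lerD2r.
  rewrite ler_piMr//.
  have -> : (p ^+ 2 + p ^+ 3) * r ^+ 4 = (p * r) ^+ 2 * r * ((1 + p) * r) by ring.
  rewrite [X in _ * X]mulfV ?gt_eqF// mulr1.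
  by have /andP[? ?] := pri 2%N; rewrite mulr_ile1// ltW.
Qed.

(** Serves to discard, as x tends to 0, the part of the boundary convolution with elapsed time at
    least [d]. *)
Lemma heatH_small (d x s : R) : 0 < d -> 0 <= x -> d <= s ->
  heatH x s <= x * (d^-1 * ((Num.sqrt (4 * pi))^-1 * (Num.sqrt d)^-1)).
Proof.
move=> d0 x0 ds; have s0 : 0 < s by apply: lt_le_trans ds.
rewrite heatHE -mulrA ler_wpM2l//.
apply: ler_pM; rewrite ?invr_ge0 ?heatK_ge0 ?(ltW s0)//; first by rewrite lef_pV2.
apply: (le_trans (heatK_le _ _)); rewrite ler_wpM2l ?invr_ge0 ?sqrtr_ge0//.
by rewrite lef_pV2 ?posrE ?sqrtr_gt0// ler_wsqrtr.
Qed.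

Lemma derive_continuous (f : R -> R) (x df : R) : is_derive x 1 f df -> {for x, continuous f}.
Proof.
by move=> [fd _]; apply: differentiable_continuous; apply/derivable1_diffP.
Qed.

Lemma derive_nbhs_right (f : R -> R) (x df : R) : is_derive x 1 f df ->
  f y @[y --> x^'+] --> f x.
Proof. by move/derive_continuous => H; exact: cvg_at_right_filter. Qed.

(** The integrand is the y-derivative of G v' - G_y v. At y = 0 the kernel G vanishes and G_y equals
    [heatH x s], so only the trace [a] of v survives; at infinity v and v' are bounded while G and
    G_y decay like exp(-y). *)
Lemma heat_green (x s a b M : R) (v v1 v2 : R -> R) : 0 < x -> 0 < s ->
  (forall y : R, 0 < y -> is_derive y 1 v (v1 y)) ->
  (forall y : R, 0 < y -> is_derive y 1 v1 (v2 y)) ->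
  (forall y : R, 0 < y -> {for y, continuous v2}) ->
  v y @[y --> 0^'+] --> a -> v1 y @[y --> 0^'+] --> b ->
  (\forall y \near +oo, `|v y| <= M /\ `|v1 y| <= M) ->
  intble `]0, +oo[ (fun y => heatG x y s * v2 y - heatG2 x y s * v y) ->
  \int[mu]_(y in `]0, +oo[) (heatG x y s * v2 y - heatG2 x y s * v y) = heatH x s * a.
Proof.
move=> x0 s0 vd v1d v2c va v1b vM vi.
pose Phi y := heatG x y s * v1 y - heatGy x y s * v y.
have H0 : Phi y @[y --> 0^'+] --> - (heatH x s * a).
  have -> : - (heatH x s * a) = heatG x 0 s * b - heatGy x 0 s * a.
    by rewrite /heatG /heatGy /heatH subr0 addr0; ring.
  apply: cvgB; apply: cvgM => //.
    exact: (derive_nbhs_right (is_derive_heatG_y x s 0)).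
  exact: (derive_nbhs_right (is_derive_heatGy_y x s 0)).
have [C C0 HC] := heatG_env s x s0.
have Hoo : Phi y @[y --> +oo] --> 0.
  apply: (@cvg_dom _ _ _ _ _ (fun y => 2 * C * M * expR (- y))).
    near=> y; rewrite subr0.
    have y0 : 0 < y by near: y; apply: nbhs_pinfty_gt; exact: num_real.
    have [vM1 vM2] : `|v y| <= M /\ `|v1 y| <= M by near: y.
    have [g0 _ g1 _] := HC x y s ltac:(by rewrite x0 lexx) y0 ltac:(by rewrite !lexx).
    apply: (le_trans (ler_normB _ _)); rewrite !normrM.
    have : `|heatG x y s| * `|v1 y| <= C * expR (- y) * M by apply: ler_pM.
    have : `|heatGy x y s| * `|v y| <= C * expR (- y) * M by apply: ler_pM.
    lra.
  rewrite -[X in _ --> X](mulr0 (2 * C * M)).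
  by apply: cvgM; [exact: cvg_cst|exact: cvgr_expR].
have -> : heatH x s * a = 0 - - (heatH x s * a) by rewrite sub0r opprK.
(* The left ends use [n.+2] so that the segment is nondegenerate already for n = 0. *)
apply: (@FTC2_exhaust R `]0, +oo[ Phi (fun y => heatG x y s * v2 y - heatG2 x y s * v y)
  (fun n => n.+2%:R^-1) (fun n => n.+1%:R)).
- exact: measurable_itv.
- exact: vi.
- move=> n; split.
    by rewrite (@lt_le_trans _ _ 1)// ?ler1n// invf_lt1 ?ltr1n.
  by move=> y /=; rewrite !in_itv/= andbT => /andP[+ _]; apply: lt_le_trans; rewrite invr_gt0.
- move=> y /=; rewrite in_itv/= andbT => y0; near=> n; apply/andP; split.
    rewrite invf_ple ?posrE//; apply: (@le_trans _ _ n%:R).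
      by near: n; exact: nbhs_infty_ger.
    by rewrite ler_nat (leq_trans (leqnSn _)).
  apply: (@le_trans _ _ n%:R); last by rewrite ler_nat.
  by near: n; exact: nbhs_infty_ger.
- move=> y /=; rewrite in_itv/= andbT => y0.
  have h1 := vd _ y0; have h2 := v1d _ y0.
  have h3 := is_derive_heatG_y x s y; have h4 := is_derive_heatGy_y x s y.
  by apply: is_derive_eq; rewrite /GRing.scale /=; ring.
- move=> y /=; rewrite in_itv/= andbT => y0.
  apply: cvgB; apply: cvgM; first exact: continuous_heatG_y.
  - exact: v2c.
  - exact: continuous_heatG2_y.
  - exact: (derive_continuous (vd _ y0)).
- have := (@cvg_at_rightP R Phi 0 _).1 H0; apply; split => [n|].
    by rewrite invr_gt0.
  apply/cvgrPdist_lt => e e0; near=> n.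
  rewrite sub0r normrN ger0_norm ?invr_ge0//.
  apply: (@lt_trans _ _ (n.+1%:R^-1)); first by rewrite ltf_pV2 ?posrE// ltr_nat.
  by near: n; exact: near_invS.
- have := (@cvg_pinftyP R Phi 0).1 Hoo; apply.
  apply/cvgryPge => A; near=> n; apply: (@le_trans _ _ n%:R); last by rewrite ler_nat.
  by near: n; exact: nbhs_infty_ger.
Unshelve. all: by end_near. Qed.
End kernel2.

(** * Approximate identities on the line and the half-line *)

Section halfline.
Context {R : realType}.
Notation mu := (@lebesgue_measure R).

Lemma FTC2_0t (F f : R -> R) (t a b : R) : 0 < t -> intble `]0, t[ f ->
  (forall s : R, 0 < s < t -> is_derive s 1 F (f s)) ->
  (forall s : R, 0 < s < t -> {for s, continuous f}) ->
  F s @[s --> 0^'+] --> a -> F s @[s --> t^'-] --> b ->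
  \int[mu]_(s in `]0, t[) f s = b - a.
Proof.
move=> t0 fi Fd fc Fa Fb.
have r0 n : 0 < t / n.+3%:R by rewrite divr_gt0.
have r1 n : t / n.+3%:R <= t / 3.
  by rewrite ler_wpM2l ?(ltW t0)// lef_pV2 ?posrE// ler_nat.
have lim0 (e : R) : 0 < e -> \forall n \near \oo, t / n.+3%:R < e.
  move=> e0; near=> n; apply: (@lt_trans _ _ (t * n.+1%:R^-1)).
    by rewrite ltr_pM2l// ltf_pV2 ?posrE// ltr_nat.
  rewrite mulrC -ltr_pdivlMr//; near: n; apply: near_invS; exact: divr_gt0.
(* With [n.+3] the first segment runs from t/3 to 2t/3; with [n.+2] it would degenerate to a
   point. *)
apply: (@FTC2_exhaust R `]0, t[ F f (fun n => t / n.+3%:R) (fun n => t - t / n.+3%:R)).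
- exact: measurable_itv.
- exact: fi.
- move=> n; move: (r0 n) (r1 n); move: (t / n.+3%:R) => c h1 h2; split; first lra.
  move=> s /=; rewrite !in_itv/= => /andP[s1 s2]; apply/andP; split; lra.
- move=> s /=; rewrite in_itv/= => /andP[s0 st]; near=> n.
  have h1 : t / n.+3%:R < s by near: n; exact: lim0.
  have h2 : t / n.+3%:R < t - s by near: n; apply: lim0; rewrite subr_gt0.
  by move: (t / n.+3%:R) h1 h2 => c h1 h2; apply/andP; split; lra.
- by move=> s /=; rewrite in_itv/=; exact: fc.
- apply: (cvg_comp (fun n => t / n.+3%:R) F _ Fa) => A [e /= e0 He].
  have := lim0 e e0; apply: filterS => n ne; apply: He => //=.
  by rewrite sub0r normrN gtr0_norm.
- apply: (cvg_comp (fun n => t - t / n.+3%:R) F _ Fb) => A [e /= e0 He].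
  have := lim0 e e0; apply: filterS => n ne; apply: He => /=.
    by rewrite opprB addrC subrK gtr0_norm.
  by rewrite ltrBlDr ltrDl.
Unshelve. all: by end_near. Qed.

Lemma Rint_le_setT (D : set R) (f : R -> R) : measurable D -> (forall y, 0 <= f y) ->
  intble setT f -> \int[mu]_(y in D) f y <= \int[mu]_(y in setT) f y.
Proof.
move=> mD f0 fi; rewrite Rintegral_mkcond; apply: le_Rint => //.
  apply: (intble_dom _ _ fi) => // [|y _].
    by apply/(measurable_restrict f) => //; rewrite setTI; apply: measurable_funTS; exact: intble_meas.
  by rewrite patchE; case: ifP => _; rewrite ?normr0// ger0_norm.
by move=> y _; rewrite patchE; case: ifP.
Qed.

(* The weight B accounts for integrands that are merely dominated by an integrable function. *)
Lemma heatK_approx (x F0 M : R) (F : R -> R -> R) (B : R -> R) :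
  intble setT B -> (forall y, 0 <= B y) ->
  (\forall e \near 0^'+, measurable_fun (setT : set R) (F e) /\ forall y, `|F e y| <= M + B y) ->
  (forall eta : R, 0 < eta -> exists2 d : R, 0 < d &
     forall e y : R, 0 < e < d -> `|y - x| < d -> `|F e y - F0| <= eta) ->
  \int[mu]_(y in setT) (heatK (x - y) e * F e y) @[e --> 0^'+] --> F0.
Proof.
move=> iB B0 FM Fx; apply/cvgrPdist_le => eta eta0.
have [d d0 Hd] := Fx (eta / 2) ltac:(by rewrite divr_gt0).
pose k := (Num.sqrt (4 * pi))^-1 : R.
have k0 : 0 <= k by rewrite invr_ge0 sqrtr_ge0.
pose c := 8 / d ^+ 2.
have c0 : 0 < c by rewrite divr_gt0// exprn_gt0.
pose IB := \int[mu]_(y in setT) B y.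
have IB0 : 0 <= IB by exact: Rintegral_ge0.
(* The contribution of the points at distance at least [d] from x. There the kernel is at most 2 q
   K(x - y, 2e) with q = exp(-d^2/(8e)) <= c e. The constant part of the data is integrated against
   K(x - y, 2e), of mass 1; the weight [B] is integrated against the supremum of the kernel, of
   order e^(-1/2), so that q e^(-1/2) <= c e^(1/2) remains. *)
pose rem (e : R) := 2 * (c * e) * (`|M| + `|F0|) + 2 * k * c * IB * Num.sqrt e.
have rem0 : rem e @[e --> 0^'+] --> 0.
  have E0 : rem 0 = 0 by rewrite /rem sqrtr0 !(mulr0, mul0r) addr0.
  rewrite -[X in _ --> X]E0.
  apply: cvg_at_right_filter; apply: cvgD; apply: cvgM; try exact: cvg_cst.
    by apply: cvgM; [exact: cvg_cst|apply: cvgM; [exact: cvg_cst|exact: cvg_id]].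
  exact: sqrt_continuous.
have e2 : 0 < eta / 2 by rewrite divr_gt0.
near=> e.
have e0 : 0 < e by near: e; exact: nbhs_right_gt.
have ed : e < d by near: e; exact: nbhs_right_lt.
have [mF FB] : measurable_fun (setT : set R) (F e) /\ forall y, `|F e y| <= M + B y by near: e.
have reme : rem e <= eta / 2.
  near: e; move/cvgrPdist_le : rem0 => /(_ _ e2).
  by apply: filterS => e; rewrite sub0r normrN; apply: le_trans; exact: ler_norm.
have e20 : 0 < 2 * e by rewrite mulr_gt0.
have iK := intble_heatK x e0; have iK2 := intble_heatK x e20.
have mKF : measurable_fun (setT : set R) (fun y => heatK (x - y) e * F e y).
  by apply: measurable_funM => //; exact: intble_meas.
have iKF : intble setT (fun y => heatK (x - y) e * F e y).
  pose kk := k * (Num.sqrt e)^-1.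
  apply: (@intble_dom _ _ _ (fun y => M * heatK (x - y) e + kk * B y)) => //.
    by apply: intbleD => //; exact: intbleZ.
  move=> y _; rewrite normrM ger0_norm ?heatK_ge0//.
  have := heatK_le (x - y) e; rewrite -/k -/kk => H1.
  have H0 := heatK_ge0 (x - y) e; have := FB y; have := B0 y => H2 H3.
  apply: (@le_trans _ _ (heatK (x - y) e * (M + B y))); first by rewrite ler_wpM2l.
  by rewrite mulrDr mulrC lerD2l ler_wpM2r.
have -> : F0 = \int[mu]_(y in setT) (F0 * heatK (x - y) e).
  by rewrite RintZ// Rint_heatK// mulr1.
rewrite -RintB//; last exact: intbleZ.
pose q := expR (- (d ^+ 2 / 8 * e^-1)).
have qe : q <= c * e.
  have ce0 : 0 < c * e by exact: mulr_gt0.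
  rewrite /q expRN invf_ple ?posrE ?expR_gt0//.
  rewrite (_ : (c * e)^-1 = d ^+ 2 / 8 * e^-1) ?ler_expR_id//.
  by rewrite /c; field; rewrite !gt_eqF.
have q0 : 0 <= q by exact: expR_ge0.
pose maj y := eta / 2 * heatK (x - y) e +
  (2 * q * (`|M| + `|F0|) * heatK (x - y) (2 * e) + 2 * q * (k * (Num.sqrt e)^-1) * B y).
have imaj : intble setT maj.
  by apply: intbleD => //; [exact: intbleZ|apply: intbleD => //; exact: intbleZ].
have H : forall y, setT y -> `|F0 * heatK (x - y) e - heatK (x - y) e * F e y| <= maj y.
  move=> y _; rewrite mulrC -mulrBr normrM ger0_norm ?heatK_ge0// distrC /maj.
  have H0 := heatK_ge0 (x - y) e; have H00 := heatK_ge0 (x - y) (2 * e).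
  have H02 : 0 <= 2 * q * (k * (Num.sqrt e)^-1) * B y.
    by rewrite !mulr_ge0// invr_ge0 sqrtr_ge0.
  have [yx|xy] := ltP `|y - x| d.
    have := Hd e y ltac:(by rewrite e0 ed) yx => H1.
    apply: ler_wpDr; first by rewrite addr_ge0// !mulr_ge0// addr_ge0.
    by rewrite mulrC ler_wpM2r.
  apply: ler_wpDl; first by rewrite mulr_ge0// divr_ge0// ltW.
  have KK := @heatK_far R d (x - y) e e0 (ltW d0) ltac:(by rewrite distrC).
  have := FB y => H3.
  apply: (@le_trans _ _ (2 * q * heatK (x - y) (2 * e) * ((`|M| + `|F0|) + B y))).
    apply: ler_pM => //; apply: (le_trans (ler_normB _ _)).
    have := ler_norm M; clear - H3; lra.
  rewrite mulrDr; apply: lerD; first by apply: eq_imp_le; ring.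
  rewrite ler_wpM2r// ler_wpM2l ?mulr_ge0//.
  apply: (le_trans (heatK_le _ _)); rewrite ler_wpM2l// lef_pV2 ?posrE ?sqrtr_gt0//.
  by apply: ler_wsqrtr; rewrite ler_peMl ?(ltW e0)// ler1n.
have mm : measurable_fun (setT : set R)
    (fun y => F0 * heatK (x - y) e - heatK (x - y) e * F e y).
  by apply: measurable_funB => //; apply: measurable_funM => //; exact: intble_meas.
apply: (le_trans (Rint_dom measurableT mm imaj H)).
have -> : eta = eta / 2 + eta / 2 by field.
rewrite /maj RintD//; last 2 first.
- exact: intbleZ.
- by apply: intbleD => //; exact: intbleZ.
rewrite RintD//; try exact: intbleZ.
rewrite (RintZ _ _ iK)// (RintZ _ _ iK2)// (RintZ _ _ iB)// !Rint_heatK// !mulr1 -/IB lerD2l (le_trans _ reme)//.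
have M0 : 0 <= `|M| + `|F0| by rewrite addr_ge0.
apply: lerD; first by rewrite ler_wpM2r// ler_wpM2l.
have sq0 : 0 < Num.sqrt e by rewrite sqrtr_gt0.
have E : q * (Num.sqrt e)^-1 <= c * Num.sqrt e.
  by rewrite ler_pdivrMr// -mulrA -expr2 sqr_sqrtr// ltW.
rewrite [leLHS](_ : _ = 2 * k * IB * (q * (Num.sqrt e)^-1)); last by ring.
rewrite [leRHS](_ : _ = 2 * k * IB * (c * Num.sqrt e)); last by ring.
by rewrite ler_wpM2l// !mulr_ge0.
Unshelve. all: by end_near. Qed.

(** The data are extended by 0 to the line. Since K(x + y) = K(-x - y), the reflected term is an
    approximate identity at -x, where the extension vanishes, and it tends to 0. *)
Lemma heatG_approx (x F0 M : R) (F : R -> R -> R) (B : R -> R) : 0 < x ->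
  intble (`]0, +oo[ : set R) B -> (forall y : R, 0 < y -> 0 <= B y) -> 0 <= M ->
  (\forall e \near (0 : R)^'+, measurable_fun (`]0, +oo[ : set R) (F e) /\
     forall y : R, 0 < y -> `|F e y| <= M + B y) ->
  (forall eta : R, 0 < eta -> exists2 d : R, 0 < d &
     forall e y : R, 0 < e < d -> 0 < y -> `|y - x| < d -> `|F e y - F0| <= eta) ->
  \int[mu]_(y in `]0, +oo[) (heatG x y e * F e y) @[e --> 0^'+] --> F0.
Proof.
move=> x0 iB B0 M0 FM Fx.
pose D := `]0, +oo[%classic : set R.
have mD : measurable D by exact: measurable_itv.
have DE y : (y \in D) = (0 < y) by apply/idP/idP; rewrite inE /D/= in_itv/= andbT.
pose B' := B \_ D; pose F' e := F e \_ D.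
have iB' : intble setT B'.
  have := (@integrable_mkcond _ _ _ mu D (EFin \o B) mD).1 iB.
  by rewrite restrict_EFin.
have B'0 y : 0 <= B' y by rewrite /B' patchE DE; case: ifPn => // /B0.
have FM' : \forall e \near 0^'+, measurable_fun (setT : set R) (F' e) /\ forall y, `|F' e y| <= M + B' y.
  apply: filterS FM => e [mF FB]; split.
    by apply/(measurable_restrict (F e)) => //; rewrite setTI.
  move=> y; rewrite /F' /B' !patchE DE; case: ifPn => [/FB//|_].
  by rewrite normr0 addr0.
have H1 : \int[mu]_(y in setT) (heatK (x - y) e * F' e y) @[e --> 0^'+] --> F0.
  apply: (@heatK_approx x F0 M F' B') => // eta eta0.
  have [d d0 Hd] := Fx eta eta0; exists (Num.min d x); first by rewrite lt_min d0.
  move=> e y /andP[e0]; rewrite !lt_min => /andP[ed _] /andP[yd yx].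
  have y0 : 0 < y by move: yx; rewrite ltr_norml => /andP[]; lra.
  by rewrite /F' patchE DE y0; apply: Hd => //; rewrite e0.
have H2 : \int[mu]_(y in setT) (heatK (- x - y) e * F' e y) @[e --> 0^'+] --> 0.
  apply: (@heatK_approx (- x) 0 M F' B') => // eta eta0.
  exists x => // e y _; rewrite opprK => yx.
  have y0 : y < 0 by move: yx; rewrite ltr_norml => /andP[]; lra.
  by rewrite /F' patchE DE ltNge (ltW y0) /= subrr normr0 ltW.
have H3 : \int[mu]_(y in setT) (heatK (x - y) e * F' e y) -
  \int[mu]_(y in setT) (heatK (- x - y) e * F' e y) @[e --> 0^'+] --> F0 - 0 by exact: cvgB.
rewrite subr0 in H3; apply: cvg_trans H3; apply: near_eq_cvg; near=> e.
have e0 : 0 < e by near: e; exact: nbhs_right_gt.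
have [mF FB] : measurable_fun (setT : set R) (F' e) /\ forall y, `|F' e y| <= M + B' y by near: e.
have iKF z : intble setT (fun y => heatK (z - y) e * F' e y).
  have iK := intble_heatK z e0.
  pose kk := (Num.sqrt (4 * pi))^-1 * (Num.sqrt e)^-1 : R.
  apply: (@intble_dom _ _ _ (fun y => M * heatK (z - y) e + kk * B' y)) => //.
  - by apply: measurable_funM => //; exact: intble_meas.
  - by apply: intbleD => //; exact: intbleZ.
  move=> y _; rewrite normrM ger0_norm ?heatK_ge0//.
  have := heatK_le (z - y) e; rewrite -/kk => H1'.
  have H0 := heatK_ge0 (z - y) e; have := FB y; have := B'0 y => H2' H3.
  apply: (@le_trans _ _ (heatK (z - y) e * (M + B' y))); first by rewrite ler_wpM2l.
  by rewrite mulrDr mulrC lerD2l ler_wpM2r.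
rewrite -RintB//.
rewrite [RHS]Rintegral_mkcond; apply: eq_Rint => y _.
rewrite /F' !patchE; case: ifP => _; last by rewrite !mulr0 subr0.
by rewrite /heatG mulrBl -opprD heatKN.
Unshelve. all: by end_near. Qed.
End halfline.

(** * The three kernel potentials *)

Section heatA.
Context {R : realType}.
Notation mu := (@lebesgue_measure R).
Notation hl := (`]0, +oo[%classic : set R).

Lemma in_hl (y : R) : hl y <-> 0 < y.
Proof. by rewrite /= in_itv/= andbT. Qed.

(** The derivative is a pointwise limit of forward difference quotients, so measurability is asked
    only for parameters to the right of [x0]; these stay positive when [x0] is. *)
Lemma measurable_fun_derive (D : set R) (k : R -> R -> R) (k' : R -> R) (x0 : R) :
  (forall x, x0 <= x -> measurable_fun D (k x)) ->
  (forall y, D y -> is_derive x0 1 (k ^~ y) (k' y)) -> measurable_fun D k'.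
Proof.
move=> mk kd.
apply: (@measurable_fun_cvg _ _ _ D (fun n y => n.+1%:R * (k (n.+1%:R^-1 + x0) y - k x0 y))).
  move=> n; apply: measurable_funM => //; apply: measurable_funB; apply: mk => //.
  by rewrite lerDr invr_ge0.
move=> y Dy; have [+ <-] := kd y Dy.
rewrite /derivable /derive => /cvg_ex[l Hl]; rewrite (cvg_lim _ Hl)//.
have Hn : (n.+1%:R^-1 : R) @[n --> \oo] --> 0^'.
  move=> A [e /= e0 He]; have := near_invS e0; apply: filterS => n ne; apply: He => /=.
    by rewrite sub0r normrN gtr0_norm.
  by rewrite gt_eqF.
have H2 := cvg_comp (fun n => n.+1%:R^-1 : R) _ Hn Hl.
apply: cvg_trans H2; apply: near_eq_cvg; near=> n => /=.
by rewrite invrK scaler1.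
Unshelve. all: by end_near. Qed.

Section fixed_data.
Variables (u : R -> R) (M : R).
Hypotheses (mu_ : measurable_fun hl u) (uM : forall y : R, 0 < y -> `|u y| <= M).

Lemma heat_data_ge0 : 0 <= M.
Proof. exact: le_trans (normr_ge0 _) (uM ltr01). Qed.
Let M0 := heat_data_ge0.

Lemma intble_env (k : R -> R) (C : R) : continuous k ->
  (forall y : R, 0 < y -> `|k y| <= C * expR (- y)) -> intble hl (fun y => k y * u y).
Proof.
move=> kc kC; apply: (@intble_dom _ _ _ (fun y => C * M * expR (- y))) => //.
- apply: measurable_funM => //; apply: measurable_funTS; exact: continuous_measurable_fun.
- by apply: intbleZ => //; exact: intble_expRN.
- move=> y /in_hl y0; rewrite normrM mulrAC; apply: ler_pM => //; [exact: kC|exact: uM].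
Qed.

(** The parameter [p] stands for either x or t, so that this one statement gives all derivatives of
    the initial-value potential. *)
Lemma derive_heat_gen (k k' : R -> R -> R) (p0 e C : R) : 0 < e ->
  (forall p, `|p - p0| < e -> continuous (k p)) ->
  (forall p y, `|p - p0| < e -> 0 < y -> is_derive p 1 (k ^~ y) (k' p y)) ->
  (forall p y, `|p - p0| < e -> 0 < y -> `|k p y| <= C * expR (- y)) ->
  (forall p y, `|p - p0| < e -> 0 < y -> `|k' p y| <= C * expR (- y)) ->
  is_derive p0 1 (fun p => \int[mu]_(y in hl) (k p y * u y))
    (\int[mu]_(y in hl) (k' p0 y * u y)).
Proof.
move=> e0 kc kd kC k'C.
have pp : `|p0 - p0| < e by rewrite subrr normr0.
apply: (@derive_Rint _ _ (fun p y => k p y * u y) (fun p y => k' p y * u y)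
  (fun y => C * M * expR (- y)) p0 e) => //.
- by apply: (intble_env (C := C)); [exact: kc|move=> y; exact: kC].
- move=> p pe; apply: measurable_funM => //; apply: measurable_funTS.
  by apply: continuous_measurable_fun; exact: kc.
- by apply: intbleZ => //; exact: intble_expRN.
- move=> p y pe /in_hl y0; have h := kd p y pe y0.
  have H := @is_deriveM _ _ (k ^~ y) (cst (u y)) p 1 _ _ h (is_derive_cst _ _ _).
  by apply: (is_derive_eq H); rewrite /GRing.scale /=; ring.
- move=> p y pe /in_hl y0; rewrite normrM mulrAC; apply: ler_pM => //.
    exact: k'C.
  exact: uM.
Qed.

Definition heatA (x t : R) : R := \int[mu]_(y in hl) (heatG x y t * u y).
Definition heatAx (x t : R) : R := \int[mu]_(y in hl) (heatGx x y t * u y).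
Definition heatA2 (x t : R) : R := \int[mu]_(y in hl) (heatG2 x y t * u y).

Lemma near_pos (x p : R) : 0 < x -> `|p - x| < x / 2 -> 0 < p <= 2 * x.
Proof. by move=> x0; rewrite ltr_norml => /andP[h1 h2]; apply/andP; split; lra. Qed.

Lemma is_derive_heatA_x (x t : R) : 0 < x -> 0 < t -> is_derive x 1 (heatA ^~ t) (heatAx x t).
Proof.
move=> x0 t0; have [C C0 HC] := heatG_env t (2 * x) t0.
have tt : t <= t <= t by rewrite lexx.
apply: (@derive_heat_gen (fun x y => heatG x y t) (fun x y => heatGx x y t) x (x / 2) C).
- by rewrite divr_gt0.
- by move=> p _; exact: continuous_heatG_y.
- by move=> p y _ _; exact: is_derive_heatG_x.
- by move=> p y px y0; have [] := HC p y t (near_pos x0 px) y0 tt.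
- by move=> p y px y0; have [] := HC p y t (near_pos x0 px) y0 tt.
Qed.

Lemma is_derive_heatAx_x (x t : R) : 0 < x -> 0 < t -> is_derive x 1 (heatAx ^~ t) (heatA2 x t).
Proof.
move=> x0 t0; have [C C0 HC] := heatG_env t (2 * x) t0.
have tt : t <= t <= t by rewrite lexx.
apply: (@derive_heat_gen (fun x y => heatGx x y t) (fun x y => heatG2 x y t) x (x / 2) C).
- by rewrite divr_gt0.
- by move=> p _; exact: continuous_heatGx_y.
- by move=> p y _ _; exact: is_derive_heatGx_x.
- by move=> p y px y0; have [] := HC p y t (near_pos x0 px) y0 tt.
- by move=> p y px y0; have [] := HC p y t (near_pos x0 px) y0 tt.
Qed.

Lemma is_derive_heatA_t (x t : R) : 0 < x -> 0 < t -> is_derive t 1 (heatA x) (heatA2 x t).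
Proof.
move=> x0 t0; have t2 : 0 < t / 2 by rewrite divr_gt0.
have [C C0 HC] := heatG_env (2 * t) x t2.
have xx : 0 < x <= x by rewrite x0 lexx.
have tt p : `|p - t| < t / 2 -> t / 2 <= p <= 2 * t.
  by rewrite ltr_norml => /andP[h1 h2]; apply/andP; split; lra.
apply: (@derive_heat_gen (fun t y => heatG x y t) (fun t y => heatG2 x y t) t (t / 2) C).
- by [].
- by move=> p _; exact: continuous_heatG_y.
- move=> p y /tt /andP[pt _] _; apply: is_derive_heatG_s; exact: lt_le_trans pt.
- by move=> p y px y0; have [] := HC x y p xx y0 (tt _ px).
- by move=> p y px y0; have [] := HC x y p xx y0 (tt _ px).
Qed.

Lemma heatG_norm_le (x y s : R) : `|heatG x y s| <= heatK (x - y) s + heatK (- x - y) s.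
Proof.
have -> : heatK (- x - y) s = heatK (x + y) s by rewrite -opprD heatKN.
by apply: (le_trans (ler_normB _ _)); rewrite !ger0_norm ?heatK_ge0.
Qed.

Lemma intble_heatG2 (x t : R) : 0 < t ->
  intble hl (fun y => heatK (x - y) t + heatK (- x - y) t) /\
  \int[mu]_(y in hl) (heatK (x - y) t + heatK (- x - y) t) <= 2.
Proof.
move=> t0.
have i z : intble hl (fun y => heatK (z - y) t).
  by apply: (@intbleS _ setT) => //; exact: intble_heatK.
split; first exact: intbleD.
have I z : \int[mu]_(y in hl) heatK (z - y) t <= 1.
  rewrite -(Rint_heatK z t0); apply: Rint_le_setT => //; last exact: intble_heatK.
  by move=> y; exact: heatK_ge0.
by rewrite RintD//; exact: (lerD (I x) (I (- x))).
Qed.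

Lemma heatA_le (x t : R) : 0 < t -> `|heatA x t| <= 2 * M.
Proof.
move=> t0; have [i I] := intble_heatG2 x t0.
apply: (@le_trans _ _ (\int[mu]_(y in hl) (M * (heatK (x - y) t + heatK (- x - y) t)))).
  apply: Rint_dom => //.
  - apply: measurable_funM => //; apply: measurable_funTS; apply: continuous_measurable_fun.
    exact: continuous_heatG_y.
  - exact: intbleZ.
  - move=> y /in_hl y0; rewrite normrM mulrC; apply: ler_pM => //; first exact: uM.
    exact: heatG_norm_le.
by rewrite RintZ// mulrC ler_wpM2r.
Qed.

Lemma heatA_cvg_t (x : R) : 0 < x -> {for x, continuous u} ->
  heatA x t @[t --> 0^'+] --> u x.
Proof.
move=> x0 uc.
apply: (@heatG_approx R x (u x) M (fun _ => u) (cst 0)) => //.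
- exact: integrable0.
- near=> e; split => // y y0; rewrite addr0; exact: uM.
move=> eta eta0; move/cvgrPdist_le : uc => /(_ _ eta0) [d /= d0 Hd].
by exists d => // e y _ _ yx; rewrite distrC; apply: Hd => /=; rewrite distrC.
Unshelve. all: by end_near. Qed.

Lemma heatA_cvg_x (t : R) : 0 < t -> heatA x t @[x --> 0^'+] --> 0.
Proof.
move=> t0; have [C C0 HC] := heatG_env t 1 t0.
have tt : t <= t <= t by rewrite lexx.
have E0 : \int[mu]_(y in hl) (0 : R) = 0 by rewrite Rintegral_cst// mul0r.
rewrite -[X in _ --> X]E0.
apply: (@Rint_dct _ _ _ hl (fun x y => heatG x y t * u y) _ (fun y => C * M * expR (- y))) => //.
- exact: seqfilter_right.
- by apply: intbleZ => //; exact: intble_expRN.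
- near=> x; apply: measurable_funM => //; apply: measurable_funTS.
  by apply: continuous_measurable_fun; exact: continuous_heatG_y.
- near=> x => y /in_hl y0.
  have x1 : 0 < x <= 1.
    apply/andP; split; first by near: x; exact: nbhs_right_gt.
    by near: x; apply: nbhs_right_le.
  have [h _ _ _] := HC x y t x1 y0 tt.
  by rewrite normrM mulrAC; apply: ler_pM => //; exact: uM.
- move=> y _; rewrite -[X in _ --> X](mul0r (u y)); apply: cvgM; last exact: cvg_cst.
  have G0 : heatG 0 y t = 0 by rewrite /heatG sub0r add0r heatKN subrr.
  rewrite -[X in _ --> X]G0; exact: (derive_nbhs_right (is_derive_heatG_x y t 0)).
Unshelve. all: by end_near. Qed.
End fixed_data.

(** Green's formula moves both derivatives from the kernel onto [u]. The result stays bounded as s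
    tends to 0, which a direct estimate of [heatG2] would not give; this is what makes the source
    potential twice differentiable. *)
Lemma heatA2_bound (u u1 u2 : R -> R) (M a b : R) (x s : R) : 0 < x -> 0 < s ->
  (forall y : R, 0 < y -> is_derive y 1 u (u1 y)) ->
  (forall y : R, 0 < y -> is_derive y 1 u1 (u2 y)) ->
  (forall y : R, 0 < y -> {for y, continuous u2}) ->
  u y @[y --> 0^'+] --> a -> u1 y @[y --> 0^'+] --> b ->
  (forall y : R, 0 < y -> [/\ `|u y| <= M, `|u1 y| <= M & `|u2 y| <= M]) ->
  heatA2 u x s = heatA u2 x s - heatH x s * a /\
  `|heatA2 u x s| <= 2 * M + `|heatH x s| * M.
Proof.
move=> x0 s0 ud u1d u2c ua ub uM.
have mcont (v : R -> R) : (forall y : R, 0 < y -> {for y, continuous v}) -> measurable_fun hl v.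
  move=> vc; apply: open_continuous_measurable_fun; first exact: interval_open.
  by move=> y /set_mem/in_hl; exact: vc.
have mu1 : measurable_fun hl u by apply: mcont => y y0; exact: derive_continuous (ud _ y0).
have mu2 : measurable_fun hl u2 by exact: mcont.
have uM0 y : 0 < y -> `|u y| <= M by move=> /uM[].
have uM2 y : 0 < y -> `|u2 y| <= M by move=> /uM[].
have [C C0 HC] := heatG_env s x s0.
have ss : s <= s <= s by rewrite lexx.
have xx : 0 < x <= x by rewrite x0 lexx.
have i1 : intble hl (fun y => heatG x y s * u2 y).
  apply: (intble_env mu2 uM2 (C := C)); first exact: continuous_heatG_y.
  by move=> y y0; have [] := HC x y s xx y0 ss.
have i2 : intble hl (fun y => heatG2 x y s * u y).
  apply: (intble_env mu1 uM0 (C := C)); first exact: continuous_heatG2_y.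
  by move=> y y0; have [] := HC x y s xx y0 ss.
have E : heatA2 u x s = heatA u2 x s - heatH x s * a.
  have := @heat_green R x s a b M u u1 u2 x0 s0 ud u1d u2c ua ub.
  rewrite RintB// -/(heatA u2 x s) -/(heatA2 u x s) => <-; first by ring.
    near=> y; have y0 : 0 < y by near: y; apply: nbhs_pinfty_gt; exact: num_real.
    by have [] := uM _ y0.
  exact: intbleB.
split => //; rewrite E; apply: (le_trans (ler_normB _ _)); apply: lerD.
  exact: heatA_le.
rewrite normrM ler_wpM2l//.
have : `|u y| @[y --> 0^'+] --> `|a| by exact: cvg_norm.
move=> /cvgr_to_le; apply; near=> y; apply: uM0.
by near: y; exact: nbhs_right_gt.
Unshelve. all: by end_near. Qed.

(** For the constant datum 1, Green's formula leaves only the boundary term. *)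
Lemma is_derive_heatA1 (x s : R) : 0 < x -> 0 < s ->
  is_derive s 1 (heatA (cst 1) x) (- heatH x s).
Proof.
move=> x0 s0.
have m1 : measurable_fun hl (cst 1 : R -> R) by exact: measurable_cst.
have b1 y : 0 < y -> `|(cst 1 : R -> R) y| <= 1 by rewrite normr1.
apply: (is_derive_eq (is_derive_heatA_t m1 b1 x0 s0)).
have [||||->] := @heatA2_bound (cst 1) (cst 0) (cst 0) 1 1 0 x s x0 s0.
- by move=> y _; exact: cvg_cst.
- exact: cvg_cst.
- exact: cvg_cst.
- by move=> y _; rewrite normr1 normr0.
rewrite mulr1 /heatA (eq_Rint (g := fun=> 0)) ?Rintegral_cst ?mul0r ?sub0r//.
by move=> y _; rewrite mulr0.
Qed.

Lemma intble_bounded (D : set R) (h : R -> R) (a b M : R) : D `<=` `[a, b] -> measurable D ->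
  measurable_fun D h -> (forall s, D s -> `|h s| <= M) -> intble D h.
Proof.
move=> Dab mD mh hM; apply: (@intble_dom _ _ _ (cst M)) => //.
apply: (@intbleS _ `[a, b]) => //.
apply: continuous_compact_integrable; first exact: segment_compact.
by apply: continuous_subspaceT => ?; exact: cvg_cst.
Qed.

Lemma cvg_refl_left (h : R -> R) (t l : R) :
  h s @[s --> 0^'+] --> l -> h (t - s) @[s --> t^'-] --> l.
Proof.
move=> hl A /hl[e /= e0 He]; exists e => //= s /= ts st.
by apply: He; rewrite /= ?sub0r ?normrN ?subr_gt0.
Qed.

(** The mass of the boundary kernel, obtained without evaluating an error function: [heatH] is minus
    the time derivative of the potential of the datum 1, whose initial value is 1. The defect
    [heatA (cst 1) x t] tends to 0 with x. *)
Lemma Rint_heatH (x t : R) : 0 < x -> 0 < t ->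
  intble `]0, t[ (fun s => heatH x (t - s)) /\
  \int[mu]_(s in `]0, t[) heatH x (t - s) = 1 - heatA (cst 1) x t.
Proof.
move=> x0 t0.
have m1 : measurable_fun hl (cst 1 : R -> R) by exact: measurable_cst.
have b1 y : 0 < y -> `|(cst 1 : R -> R) y| <= 1 by rewrite normr1.
have C1 s : 0 < s < t -> {for s, continuous (fun s => heatH x (t - s))}.
  move=> /andP[_ st]; have ts : 0 < t - s by rewrite subr_gt0.
  exact: (derive_continuous (is_derive_refl_comp (is_derive_heatH_s x ts))).
have I1 : intble `]0, t[ (fun s => heatH x (t - s)).
  have [C C0 HC] := heatH_bound x x0.
  apply: (@intble_bounded _ _ 0 t C) => //.
  - exact: subset_itvW.
  - apply: open_continuous_measurable_fun; first exact: interval_open.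
    by move=> s /set_mem/=; rewrite in_itv/=; exact: C1.
  - move=> s /=; rewrite in_itv/= => /andP[_ st].
    by have [] := HC x (t - s) ltac:(by rewrite lexx) ltac:(by rewrite subr_gt0).
split => //.
apply: (@FTC2_0t R (fun s => heatA (cst 1) x (t - s))) => //.
- move=> s /andP[_ st]; rewrite -[X in is_derive _ _ _ X]opprK.
  by apply: (is_derive_refl_comp (f := heatA (cst 1) x)); apply: is_derive_heatA1; rewrite // subr_gt0.
- rewrite -[X in heatA _ _ X](subr0 t); apply: cvg_at_right_filter.
  have H : is_derive (t - 0) 1 (heatA (cst 1) x) (- heatH x (t - 0)).
    by rewrite subr0; exact: is_derive_heatA1.
  exact: (derive_continuous (is_derive_refl_comp H)).
- apply: cvg_refl_left; have := @heatA_cvg_t (cst 1) 1 m1 b1 x x0; apply; exact: cvg_cst.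
Qed.
End heatA.

Lemma near_is_derive (R : realType) (f g : R -> R) (a df : R) :
  (\forall y \near a, f y = g y) -> is_derive a 1 f df -> is_derive a 1 g df.
Proof. exact: near_eq_is_derive. Qed.

(** * Duhamel's principle for a general family of heat solutions *)

Section duhamel.
Context {R : realType}.
Notation mu := (@lebesgue_measure R).
Variables (w w1 w2 : R -> R -> R -> R) (phi : R -> R -> R).
Hypothesis w_x : forall x s tau : R, 0 < x -> 0 < s -> 0 < tau ->
  is_derive x 1 (fun x => w x s tau) (w1 x s tau).
Hypothesis w_xx : forall x s tau : R, 0 < x -> 0 < s -> 0 < tau ->
  is_derive x 1 (fun x => w1 x s tau) (w2 x s tau).
Hypothesis w_s : forall x s tau : R, 0 < x -> 0 < s -> 0 < tau ->
  is_derive s 1 (fun s => w x s tau) (w2 x s tau).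
Hypothesis w_bound : forall d X T : R, 0 < d -> exists M : R, forall x s tau : R,
  d <= x <= X -> 0 < s <= T -> 0 < tau <= T -> `|w x s tau| <= M /\ `|w2 x s tau| <= M.
Hypothesis w_init : forall x tau : R, 0 < x -> 0 < tau ->
  w x s tau @[s --> 0^'+] --> phi x tau.
Hypothesis phi_cont : forall x tau : R, 0 < x -> 0 < tau -> {for tau, continuous (phi x)}.
Hypothesis w_meas : forall x t : R, 0 < x -> 0 < t ->
  measurable_fun (`]0, t[ : set R) (fun tau => w x (t - tau) tau).

(** Here [w x s tau] is the value at x, after elapsed time s, of the solution released at time tau
    with initial value [phi x tau]. The boundary term is the case phi = 0, the source term the case
    phi = f. *)
Definition duhamel (x t : R) : R := \int[mu]_(tau in `]0, t[) w x (t - tau) tau.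
Definition duhamel1 (x t : R) : R := \int[mu]_(tau in `]0, t[) w1 x (t - tau) tau.
Definition duhamel2 (x t : R) : R := \int[mu]_(tau in `]0, t[) w2 x (t - tau) tau.

Lemma in0t (t tau : R) : (`]0, t[%classic : set R) tau <-> 0 < tau < t.
Proof. by rewrite /= in_itv. Qed.

(* The first derivative is controlled by the function and its second derivative (Landau). *)
Lemma duhamel_w1_bound (d X T : R) : 0 < d -> exists M : R, forall x s tau : R,
  d <= x <= X -> 0 < s <= T -> 0 < tau <= T ->
  [/\ `|w x s tau| <= M, `|w1 x s tau| <= M & `|w2 x s tau| <= M].
Proof.
move=> d0; have [M HM] := w_bound (X + 1) T d0.
(* On [x, x + 1] some value of the first derivative equals an increment of [w], hence is at most 2M
   in absolute value; moving back to x costs at most M more. *)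
exists (3 * M) => x s tau /andP[dx xX] sT tT.
have /andP[s0 _] := sT; have /andP[t0 _] := tT.
have x0 : 0 < x by apply: lt_le_trans dx.
have B y : x <= y <= x + 1 -> `|w y s tau| <= M /\ `|w2 y s tau| <= M.
  by move=> /andP[xy yx]; apply: HM => //; apply/andP; split; lra.
have [wx w2x] : `|w x s tau| <= M /\ `|w2 x s tau| <= M by apply: B; rewrite lexx lerDl ler01.
have [wx1 _] : `|w (x + 1) s tau| <= M /\ `|w2 (x + 1) s tau| <= M.
  by apply: B; rewrite lexx lerDl ler01.
have M0 : 0 <= M by apply: le_trans wx.
split; [lra| |lra].
have [|||xi] := @MVT R (fun x => w x s tau) (fun x => w1 x s tau) x (x + 1).
- by rewrite ltrDl.
- by move=> y; rewrite in_itv/= => /andP[xy _]; apply: w_x => //; apply: lt_trans xy.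
- apply: derivable_within_continuous => y; rewrite in_itv/= => /andP[xy _].
  by have [] := @w_x y s tau (lt_le_trans x0 xy) s0 t0.
rewrite in_itv/= => /andP[xxi xix] E.
have : `|w1 xi s tau| <= 2 * M.
  have -> : w1 xi s tau = w (x + 1) s tau - w x s tau by rewrite E; ring.
  by apply: (le_trans (ler_normB _ _)); lra.
have := @lip_of_derive R (fun x => w1 x s tau) (fun x => w2 x s tau) x xi M.
move=> /(_ _ _ (ltW xxi)) H.
have : `|w1 xi s tau - w1 x s tau| <= M * (xi - x).
  apply: H => y /andP[xy yxi].
    by apply: w_xx => //; apply: lt_le_trans xy.
  by have [] := B y ltac:(apply/andP; split; lra).
have : M * (xi - x) <= M by rewrite ler_piMr//; lra.
have := ler_normB (w1 xi s tau) (w1 xi s tau - w1 x s tau).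
rewrite (_ : w1 xi s tau - (w1 xi s tau - w1 x s tau) = w1 x s tau); last by ring.
lra.
Qed.

Lemma duhamel_meas1 (x t : R) : 0 < x -> 0 < t ->
  measurable_fun (`]0, t[ : set R) (fun tau => w1 x (t - tau) tau).
Proof.
move=> x0 t0; apply: (@measurable_fun_derive _ _ (fun x tau => w x (t - tau) tau) _ x).
  by move=> y xy; apply: w_meas => //; apply: lt_le_trans xy.
by move=> tau /in0t/andP[t1 t2]; apply: w_x => //; rewrite subr_gt0.
Qed.

Lemma duhamel_meas2 (x t : R) : 0 < x -> 0 < t ->
  measurable_fun (`]0, t[ : set R) (fun tau => w2 x (t - tau) tau).
Proof.
move=> x0 t0; apply: (@measurable_fun_derive _ _ (fun x tau => w1 x (t - tau) tau) _ x).
  by move=> y xy; apply: duhamel_meas1 => //; apply: lt_le_trans xy.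
by move=> tau /in0t/andP[t1 t2]; apply: w_xx => //; rewrite subr_gt0.
Qed.

Let sub0t (t : R) : (`]0, t[%classic : set R) `<=` `[0, t].
Proof. exact: subset_itvW. Qed.

Let range (t tau : R) : (`]0, t[%classic : set R) tau -> 0 < t - tau <= t /\ 0 < tau <= t.
Proof. by move=> /in0t/andP[h1 h2]; split; apply/andP; split; lra. Qed.

Lemma intble_duhamel (x t : R) : 0 < x -> 0 < t ->
  intble `]0, t[ (fun tau => w x (t - tau) tau).
Proof.
move=> x0 t0; have [M HM] := w_bound x t x0.
apply: (intble_bounded (@sub0t t) _ (w_meas x0 t0) (M := M)) => // tau /range[h1 h2].
by have [] := HM x _ _ ltac:(by rewrite lexx) h1 h2.
Qed.

Lemma is_derive_duhamel_x (x t : R) : 0 < x -> 0 < t ->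
  is_derive x 1 (duhamel ^~ t) (duhamel1 x t).
Proof.
move=> x0 t0; have x20 : 0 < x / 2 by rewrite divr_gt0.
have [M HM] := duhamel_w1_bound (2 * x) t x20.
have N p : `|p - x| < x / 2 -> 0 < p /\ x / 2 <= p <= 2 * x.
  by rewrite ltr_norml => /andP[h1 h2]; split; [|apply/andP; split]; lra.
apply: (@derive_Rint _ _ (fun x tau => w x (t - tau) tau)
  (fun x tau => w1 x (t - tau) tau) (cst M) x (x / 2)) => //.
- exact: intble_duhamel.
- by move=> p /N[p0 _]; exact: w_meas.
- by apply: (intble_bounded (@sub0t t) (M := `|M|)).
- by move=> p tau /N[p0 _] /range[/andP[s0 _] /andP[tau0 _]]; exact: w_x.
- by move=> p tau /N[p0 pp] /range[h1 h2]; have [] := HM _ _ _ pp h1 h2.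
Qed.

Lemma is_derive_duhamel1_x (x t : R) : 0 < x -> 0 < t ->
  is_derive x 1 (duhamel1 ^~ t) (duhamel2 x t).
Proof.
move=> x0 t0; have x20 : 0 < x / 2 by rewrite divr_gt0.
have [M HM] := duhamel_w1_bound (2 * x) t x20.
have N p : `|p - x| < x / 2 -> 0 < p /\ x / 2 <= p <= 2 * x.
  by rewrite ltr_norml => /andP[h1 h2]; split; [|apply/andP; split]; lra.
apply: (@derive_Rint _ _ (fun x tau => w1 x (t - tau) tau)
  (fun x tau => w2 x (t - tau) tau) (cst M) x (x / 2)) => //.
- apply: (intble_bounded (@sub0t t) _ (duhamel_meas1 x0 t0) (M := M)) => // tau /range[h1 h2].
  by have [] := HM x _ _ ltac:(apply/andP; split; lra) h1 h2.
- by move=> p /N[p0 _]; exact: duhamel_meas1.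
- by apply: (intble_bounded (@sub0t t) (M := `|M|)).
- by move=> p tau /N[p0 _] /range[/andP[s0 _] /andP[tau0 _]]; exact: w_xx.
- by move=> p tau /N[p0 pp] /range[h1 h2]; have [] := HM _ _ _ pp h1 h2.
Qed.

(* The jump of the integrand at [tau = t] is [phi x t]; after subtracting it the
   integrand, extended by 0, is Lipschitz in [t]. *)
Let r (x s tau : R) : R := if 0 < s then w x s tau - phi x tau else 0.

(** [w2] is the s-derivative and is bounded down to s = 0, so the increments of [w] from a small
    time [e] to [s] are controlled; then [e] tends to 0. *)
Lemma duhamel_rem_le (x T M : R) : 0 < x ->
  (forall s tau : R, 0 < s <= T -> 0 < tau <= T -> `|w2 x s tau| <= M) ->
  forall s tau, 0 < s <= T -> 0 < tau <= T -> `|w x s tau - phi x tau| <= M * s.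
Proof.
move=> x0 HM s tau /andP[s0 sT] tauT; have /andP[tau0 _] := tauT.
have M0 : 0 <= M by apply: le_trans (HM s tau _ tauT); rewrite ?normr_ge0// s0.
have H : `|w x s tau - w x e tau| @[e --> 0^'+] --> `|w x s tau - phi x tau|.
  by apply: cvg_norm; apply: cvgB; [exact: cvg_cst|exact: w_init].
apply: (cvgr_to_le H); near=> e.
have e0 : 0 < e by near: e; exact: nbhs_right_gt.
have es : e < s by near: e; exact: nbhs_right_lt.
apply: (@le_trans _ _ (M * (s - e))); last by rewrite ler_wpM2l// gerBl ltW.
apply: (@lip_of_derive R (fun s => w x s tau) (fun s => w2 x s tau)); last exact: ltW.
  by move=> p /andP[ep _]; apply: w_s => //; apply: lt_le_trans ep.
move=> p /andP[ep ps]; apply: HM => //; apply/andP; split; lra.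
Unshelve. all: by end_near. Qed.

Lemma duhamel_r_lip (x T M : R) : 0 < x ->
  (forall s tau : R, 0 < s <= T -> 0 < tau <= T -> `|w2 x s tau| <= M) ->
  forall s s' tau, s <= T -> s' <= T -> 0 < tau <= T -> s' <= s ->
  `|r x s tau - r x s' tau| <= M * (s - s').
Proof.
move=> x0 HM s s' tau sT s'T tauT ss'; have /andP[tau0 tauT'] := tauT.
have T0 : 0 < T by apply: lt_le_trans tau0 _.
have M0 : 0 <= M by apply: le_trans (HM T tau _ tauT); rewrite ?normr_ge0// T0 lexx.
rewrite /r; have [s0|s0] := ltP 0 s; have [s'0|s'0] := ltP 0 s'.
- rewrite (_ : _ - _ - (_ - _) = w x s tau - w x s' tau); last by ring.
  apply: (@lip_of_derive R (fun s => w x s tau) (fun s => w2 x s tau)) => //.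
    by move=> p /andP[ep _]; apply: w_s => //; apply: lt_le_trans ep.
  move=> p /andP[ep ps]; apply: HM => //; apply/andP; split; lra.
(* The two times lie on both sides of the kink: the remainder is 0 at [s'] and at most [M * s] at
   [s], with [s <= s - s']. *)
- rewrite subr0; apply: (@le_trans _ _ (M * s)); last by rewrite ler_wpM2l//; lra.
  by apply: (duhamel_rem_le (T := T)) => //; rewrite s0.
- lra.
- by rewrite subrr normr0 mulr_ge0// subr_ge0.
Qed.

(** Subtracting the initial value splits the potential into the integral of phi up to t',
    differentiated by the fundamental theorem, and a remainder that can be integrated over a domain
    not depending on t' and differentiated under the integral sign. *)
Lemma is_derive_duhamel_t (x t : R) : 0 < x -> 0 < t ->
  is_derive t 1 (duhamel x) (phi x t + duhamel2 x t).
Proof.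
move=> x0 t0; pose T := 2 * t; have T0 : 0 < T by rewrite mulr_gt0.
have tT : t < T by rewrite /T; lra.
have [M HM] := w_bound x T x0.
have HM1 s tau : 0 < s <= T -> 0 < tau <= T -> `|w x s tau| <= M.
  by move=> h1 h2; have [] := HM x s tau ltac:(by rewrite lexx) h1 h2.
have HM2 s tau : 0 < s <= T -> 0 < tau <= T -> `|w2 x s tau| <= M.
  by move=> h1 h2; have [] := HM x s tau ltac:(by rewrite lexx) h1 h2.
have M0 : 0 <= M by apply: le_trans (HM1 T T _ _); rewrite ?normr_ge0// T0 lexx.
have phiM tau : 0 < tau <= T -> `|phi x tau| <= M.
  move=> tauT; have /andP[tau0 _] := tauT.
  apply: (cvgr_to_le (cvg_norm (w_init x0 tau0))); near=> e; apply: HM1 => //.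
  by apply/andP; split; near: e; [exact: nbhs_right_gt|exact: nbhs_right_le].
have mphi t' : measurable_fun (`]0, t'[ : set R) (phi x).
  apply: open_continuous_measurable_fun; first exact: interval_open.
  by move=> s /set_mem/in0t/andP[s0 _]; exact: phi_cont.
have iphi t' : t' <= T -> intble `]0, t'[ (phi x).
  move=> t'T; apply: (intble_bounded (@sub0t t') _ (mphi t') (M := M)) => // s /in0t/andP[s0 st].
  by apply: phiM; rewrite s0 (le_trans (ltW st)).
pose P t' := \int[mu]_(tau in `]0, t'[) phi x tau.
(* At tau = t the remainder has its kink in t' and need not be differentiable; removing this null
   set changes no integral. *)
pose D := (`]0, T[%classic : set R) `\ t.
have mD : measurable D by exact: measurableD.
have DT tau : D tau -> 0 < tau <= T.
  by move=> [/in0t/andP[h1 h2] _]; rewrite h1 ltW.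
pose k t' tau := r x (t' - tau) tau.
have cutE (h : R -> R) t' tau : 0 < tau ->
    (if 0 < t' - tau then h tau else 0) = (h \_ `]0, t'[) tau.
  move=> tau0; rewrite patchE subr_gt0; case: ltP => ht.
    by rewrite ifT// inE; apply/in0t; rewrite tau0.
  by rewrite ifF//; apply/negbTE/negP => /set_mem/in0t/andP[_]; rewrite ltNge ht.
have cut_meas (h : R -> R) t' : measurable_fun (`]0, t'[ : set R) h ->
    measurable_fun (`]0, T[ : set R) (fun tau => if 0 < t' - tau then h tau else 0).
  move=> mh; apply: (eq_measurable_fun (h \_ `]0, t'[)).
    by move=> tau /set_mem/in0t/andP[tau0 _]; rewrite cutE.
  apply/(measurable_restrict h) => //; apply: measurable_funS mh => //; exact: subIsetr.
have cut_int (h : R -> R) t' : t' <= T -> measurable_fun (`]0, t'[ : set R) h ->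
    \int[mu]_(tau in D) (if 0 < t' - tau then h tau else 0) = \int[mu]_(tau in `]0, t'[) h tau.
  move=> t'T mh; rewrite /Rintegral /D integral_setD1//; last first.
    by apply/measurable_EFinP; apply: measurable_funS (cut_meas _ _ mh) => //; exact: subDsetl.
  rewrite -/(Rintegral _ _ _) -/(Rintegral _ _ _).
  have -> : (`]0, t'[%classic : set R) = `]0, T[ `&` `]0, t'[.
    by rewrite setIidr//; apply: subset_itvl; rewrite bnd_simp.
  rewrite Rintegral_mkcondr; apply: eq_Rint => tau /in0t/andP[tau0 tauT].
  by rewrite cutE.
have mk t' : 0 < t' < T -> measurable_fun D (k t').
  move=> /andP[t'0 t'T]; apply: (@measurable_funS _ _ _ _ `]0, T[) => //; first exact: subDsetl.
  apply: cut_meas; apply: measurable_funB => //; exact: w_meas.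
have ik t' : 0 < t' < T -> intble D (k t').
  move=> t'T; apply: (@intble_bounded _ _ _ 0 T (M * T)) => //.
  - by move=> tau [/in0t/andP[h1 h2] _]; rewrite /= in_itv/= !ltW.
  - exact: mk.
  - move=> tau Dt; have /andP[tau0 tauT] := DT _ Dt; have /andP[t'0 t'T'] := t'T.
    rewrite /k /r; case: ltP => h; last by rewrite normr0 mulr_ge0// ltW.
    apply: (@le_trans _ _ (M * (t' - tau))).
      apply: (duhamel_rem_le (T := T)) => //; last by rewrite tau0.
      apply/andP; split; lra.
    by rewrite ler_wpM2l//; lra.
have near_t : \forall t' \near t, 0 < t' < T.
  near=> t'; apply/andP; split; near: t'; [exact: lt_nbhsr|exact: lt_nbhsl].
have splitE t' : 0 < t' < T -> duhamel x t' = P t' + \int[mu]_(tau in D) k t' tau.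
  move=> /andP[t'0 t'T].
  have iw := intble_duhamel x0 t'0; have ip := iphi t' (ltW t'T).
  rewrite (cut_int (fun tau => w x (t' - tau) tau - phi x tau)) ?ltW//; last first.
    by apply: measurable_funB => //; exact: w_meas.
  by rewrite RintB// /P /duhamel addrC subrK.
have dP : is_derive t 1 P (phi x t).
  (* The fundamental theorem needs integrability slightly beyond t. *)
  pose v := (t + T) / 2.
  have tv : t < v by rewrite /v; lra.
  have vT : v < T by rewrite /v; lra.
  have iv : intble [set` Interval (BRight 0) (BRight v)] (phi x).
    apply: intbleS (iphi T _) => // tau /=; rewrite !in_itv/= => /andP[-> h].
    exact: le_lt_trans vT.
  have b0 : (BRight 0 < BRight t)%O by rewrite bnd_simp.
  have [pd pE] := @continuous_FTC1 R (phi x) (BRight 0) t v tv iv b0 (phi_cont x0 t0).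
  apply: (@near_is_derive R
     (fun x1 => \int[mu]_(t in [set` Interval (BRight 0) (BRight x1)]) phi x t)).
    by apply: filterS near_t => t' /andP[t'0 t'T]; rewrite /P Rintegral_itv_bndo_bndc//; apply: iphi; exact: ltW.
  by apply: DeriveDef; [exact: pd|rewrite -derive1E pE].
pose k' tau := if 0 < t - tau then w2 x (t - tau) tau else 0.
have dK : is_derive t 1 (fun t' => \int[mu]_(tau in D) k t' tau) (\int[mu]_(tau in D) k' tau).
  apply: (@derive_Rint_lip _ D k k' (cst M) t) => //.
  - by apply: filterS near_t => t'; exact: ik.
  - apply: (@intble_bounded _ _ _ 0 T `|M|) => //.
    by move=> tau [/in0t/andP[h1 h2] _]; rewrite /= in_itv/= !ltW.
  - apply: filterS near_t => t' /andP[t'0 t'T] tau Dt; have tauT := DT _ Dt.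
    have /andP[tau0 _] := tauT.
    rewrite /k; have [tt'|t't] := leP t t'.
      rewrite (ger0_norm (x := t' - t)) ?subr_ge0//.
      rewrite (_ : t' - t = (t' - tau) - (t - tau)); last by ring.
      by apply: (duhamel_r_lip (T := T)) => //; lra.
    rewrite distrC (ltr0_norm (x := t' - t)) ?subr_lt0//.
    rewrite (_ : - (t' - t) = (t - tau) - (t' - tau)); last by ring.
    by apply: (duhamel_r_lip (T := T)) => //; lra.
  - move=> tau [/in0t/andP[tau0 tauT] /eqP tt]; rewrite /k' /k /r.
    have [h|h] := ltP 0 (t - tau).
      apply: (@near_is_derive R (fun t' => w x (t' - tau) tau - phi x tau)).
        near=> t'; rewrite ifT// subr_gt0; near: t'.
        by apply: lt_nbhsr; rewrite -subr_gt0.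
      have H := @is_derive_shift_comp R (fun s => w x s tau) (- tau) t _ (w_s x0 h tau0).
      have H2 := @is_deriveB _ _ _ _ (cst (phi x tau)) _ _ _ _ H (is_derive_cst _ _ _).
      by apply: (is_derive_eq H2); rewrite subr0.
    apply: (@near_is_derive R (cst 0)).
    have tt' : t < tau by rewrite lt_neqAle eq_sym tt /=; lra.
    near=> t'; rewrite ifF//; apply/negbTE; rewrite -leNgt subr_le0; apply: ltW.
    by near: t'; exact: lt_nbhsl.
have -> : duhamel2 x t = \int[mu]_(tau in D) k' tau.
  by rewrite (cut_int (fun tau => w2 x (t - tau) tau)) ?ltW//; exact: duhamel_meas2.
apply: (@near_is_derive R (fun t' => P t' + \int[mu]_(tau in D) k t' tau)).
  by apply: filterS near_t => t' /splitE ->.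
Unshelve. all: by end_near. Qed.

Lemma duhamel_cvg_t (x : R) : 0 < x -> duhamel x t @[t --> 0^'+] --> 0.
Proof.
move=> x0; have [M HM] := w_bound x 1 x0.
apply: (@cvg_dom _ _ _ _ _ (fun t => M * t)).
  near=> t; rewrite subr0.
  have t0 : 0 < t by near: t; exact: nbhs_right_gt.
  have t1 : t <= 1 by near: t; exact: nbhs_right_le.
  apply: (@le_trans _ _ (\int[mu]_(tau in `]0, t[) cst M tau)).
    apply: Rint_dom => //; first exact: w_meas.
      by apply: (intble_bounded (@sub0t t) (M := `|M|)).
    move=> tau /range[/andP[h1 h2] /andP[h3 h4]].
    have [] := HM x (t - tau) tau ltac:(by rewrite lexx) _ _ => //.
      by rewrite h1 (le_trans h2).
    by rewrite h3 (le_trans h4).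
  have -> : \int[mu]_(tau in `]0, t[) cst M tau = M * fine (mu `]0, t[) by exact: Rintegral_cst.
  by rewrite lebesgue_measure_itv/= lte_fin t0 /= subr0.
have E : M * 0 = 0 by rewrite mulr0.
rewrite -[X in _ --> X]E; apply: cvg_at_right_filter.
by apply: cvgM; [exact: cvg_cst|exact: cvg_id].
Unshelve. all: by end_near. Qed.
End duhamel.

(** * Boundary and source potentials: equation, initial values, boundary values *)

Section heat_solution.
Context {R : realType}.
Notation mu := (@lebesgue_measure R).
Notation hl := (`]0, +oo[%classic : set R).

Definition heatB (g : R -> R) : R -> R -> R :=
  duhamel (fun x s tau => heatH x s * g tau).
Definition heatD (f : R -> R -> R) : R -> R -> R :=
  duhamel (fun x s tau => heatA (f ^~ tau) x s).

Section boundary_term.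
Variable g : R -> R.
Hypothesis g_cont : forall t : R, 0 < t -> {for t, continuous g}.
Hypothesis g_bound : forall T : R, exists M : R, forall t : R, 0 < t <= T -> `|g t| <= M.

Lemma heatB_w_x (x s tau : R) : is_derive x 1 (fun x => heatH x s * g tau) (- 2 * heatK2 x s * g tau).
Proof.
have H := @is_deriveM _ _ (heatH ^~ s) (cst (g tau)) x 1 _ _ (is_derive_heatH_x s x) (is_derive_cst _ _ _).
by apply: (is_derive_eq H); rewrite /GRing.scale /=; ring.
Qed.

Lemma heatB_w_xx (x s tau : R) :
  is_derive x 1 (fun x => - 2 * heatK2 x s * g tau) (heatH2 x s * g tau).
Proof.
have H := @is_deriveM _ _ (fun x => - 2 * heatK2 x s) (cst (g tau)) x 1 _ _ (is_derive_heatHx_x s x)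
  (is_derive_cst _ _ _).
by apply: (is_derive_eq H); rewrite /GRing.scale /=; ring.
Qed.

Lemma heatB_w_s (x s tau : R) : 0 < s ->
  is_derive s 1 (fun s => heatH x s * g tau) (heatH2 x s * g tau).
Proof.
move=> s0.
have H := @is_deriveM _ _ (heatH x) (cst (g tau)) s 1 _ _ (is_derive_heatH_s x s0)
  (is_derive_cst _ _ _).
by apply: (is_derive_eq H); rewrite /GRing.scale /=; ring.
Qed.

Lemma heatB_w_bound (d X T : R) : 0 < d -> exists M : R, forall x s tau : R,
  d <= x <= X -> 0 < s <= T -> 0 < tau <= T ->
  `|heatH x s * g tau| <= M /\ `|heatH2 x s * g tau| <= M.
Proof.
move=> d0; have [C C0 HC] := heatH_bound X d0; have [M HM] := g_bound T.
exists (C * M) => x s tau dx /andP[s0 _] tT; have [h1 _ h2] := HC x s dx s0.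
by have gM := HM _ tT; split; rewrite normrM; apply: ler_pM.
Qed.

Lemma heatB_w_init (x tau : R) : 0 < x -> heatH x s * g tau @[s --> 0^'+] --> 0.
Proof.
move=> x0; have [C C0 HC] := heatH_bound x x0.
apply: (@cvg_dom _ _ _ _ _ (fun s => C * s * `|g tau|)).
  near=> s; rewrite subr0 normrM ler_wpM2r//.
  have s0 : 0 < s by near: s; exact: nbhs_right_gt.
  by have [] := HC x s ltac:(by rewrite lexx) s0.
have E : C * 0 * `|g tau| = 0 by rewrite mulr0 mul0r.
rewrite -[X in _ --> X]E; apply: cvg_at_right_filter.
by apply: cvgM; [apply: cvgM; [exact: cvg_cst|exact: cvg_id]|exact: cvg_cst].
Unshelve. all: by end_near. Qed.

Lemma heatB_w_cont (x t s : R) : 0 < s < t ->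
  {for s, continuous (fun tau => heatH x (t - tau) * g tau)}.
Proof.
move=> /andP[s0 st]; have ts : 0 < t - s by rewrite subr_gt0.
apply: cvgM; last exact: g_cont.
exact: (derive_continuous (is_derive_refl_comp (is_derive_heatH_s x ts))).
Qed.

Lemma heatB_w_meas (x t : R) : measurable_fun (`]0, t[ : set R) (fun tau => heatH x (t - tau) * g tau).
Proof.
apply: open_continuous_measurable_fun; first exact: interval_open.
by move=> s /set_mem/in0t; exact: heatB_w_cont.
Qed.

Lemma heatB_heat (x t : R) : 0 < x -> 0 < t -> exists B1 : R -> R -> R, exists B2 : R,
  [/\ forall y : R, 0 < y -> is_derive y 1 (heatB g ^~ t) (B1 y t),
      is_derive x 1 (B1 ^~ t) B2 & is_derive t 1 (heatB g x) B2].
Proof.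
move=> x0 t0.
have A1 (z s tau : R) : 0 < z -> 0 < s -> 0 < tau -> is_derive z 1 (fun x => heatH x s * g tau)
  (- 2 * heatK2 z s * g tau) by move=> *; exact: heatB_w_x.
have A2 (z s tau : R) : 0 < z -> 0 < s -> 0 < tau ->
  is_derive z 1 (fun x => - 2 * heatK2 x s * g tau) (heatH2 z s * g tau).
  by move=> *; exact: heatB_w_xx.
have A3 (z s tau : R) : 0 < z -> 0 < s -> 0 < tau ->
  is_derive s 1 (fun s => heatH z s * g tau) (heatH2 z s * g tau).
  by move=> *; exact: heatB_w_s.
have A4 (z tau : R) : 0 < z -> 0 < tau -> heatH z s * g tau @[s --> 0^'+] --> 0.
  by move=> *; exact: heatB_w_init.
have A5 (z t' : R) : 0 < z -> 0 < t' ->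
  measurable_fun (`]0, t'[ : set R) (fun tau => heatH z (t' - tau) * g tau).
  by move=> *; exact: heatB_w_meas.
exists (duhamel1 (fun x s tau => - 2 * heatK2 x s * g tau)).
exists (duhamel2 (fun x s tau => heatH2 x s * g tau) x t); split.
- by move=> y y0; apply: (is_derive_duhamel_x A1 A2 heatB_w_bound A5).
- exact: (is_derive_duhamel1_x A1 A2 heatB_w_bound A5).
- rewrite -[X in is_derive _ _ _ X]add0r.
  apply: (is_derive_duhamel_t (phi := fun _ _ => 0) A1 A2 A3 heatB_w_bound A4 _ A5) => //.
  by move=> *; exact: cvg_cst.
Qed.

Lemma heatB_cvg_t (x : R) : 0 < x -> heatB g x t @[t --> 0^'+] --> 0.
Proof.
move=> x0; apply: (duhamel_cvg_t heatB_w_bound _ x0).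
by move=> *; exact: heatB_w_meas.
Qed.

(** As x tends to 0 the kernel [heatH] is an approximate identity in elapsed time. Its mass formula
    lets g(t) be written as an integral against it plus a vanishing defect; the rest is continuity
    of g near t and smallness of the kernel at elapsed times at least [d]. *)
Lemma heatB_cvg_x (t : R) : 0 < t -> heatB g x t @[x --> 0^'+] --> g t.
Proof.
move=> t0.
have m1 : measurable_fun hl (cst 1 : R -> R) by exact: measurable_cst.
have b1 (y : R) : 0 < y -> `|(cst 1 : R -> R) y| <= 1 by rewrite normr1.
have A10 : heatA (cst 1) x t @[x --> 0^'+] --> 0 by exact: (heatA_cvg_x m1 b1).
have [M HM] := g_bound t.
have gt : `|g t| <= M by apply: HM; rewrite t0 lexx.
have M0 : 0 <= M by apply: le_trans gt.
apply/cvgrPdist_le => e e0.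
have e4 : 0 < e / 4 by rewrite divr_gt0.
have /cvgrPdist_le/(_ _ e4)[d /= d0 Hd] := g_cont t0.
pose c := d^-1 * ((Num.sqrt (4 * pi))^-1 * (Num.sqrt d)^-1) : R.
have c0 : 0 <= c by rewrite !mulr_ge0// ?invr_ge0 ?sqrtr_ge0// ltW.
have Mc : 0 <= 2 * M * c by apply: mulr_ge0 => //; apply: mulr_ge0.
(* The three errors: elapsed times at least [d], the mass defect of the kernel multiplied by g(t),
   and the excess of the mass over 1 allowed in the estimate near tau = t. *)
pose rem (x : R) := x * (2 * M * c * t) + `|g t| * `|heatA (cst 1) x t| + e / 4 * `|heatA (cst 1) x t|.
have rem0 : rem x @[x --> 0^'+] --> 0.
  have E0 : 0 * (2 * M * c * t) + `|g t| * `|0 : R| + e / 4 * `|0 : R| = 0.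
    by rewrite normr0 !(mulr0, mul0r) !addr0.
  rewrite -[X in _ --> X]E0; apply: cvgD; [apply: cvgD|].
  - apply: cvgM; last exact: cvg_cst.
    by apply: cvg_at_right_filter; exact: cvg_id.
  - by apply: cvgM; [exact: cvg_cst|exact: cvg_norm].
  - by apply: cvgM; [exact: cvg_cst|exact: cvg_norm].
have e2 : 0 < e / 2 by rewrite divr_gt0.
near=> x.
have x0 : 0 < x by near: x; exact: nbhs_right_gt.
have remx : rem x <= e / 2.
  near: x; move/cvgrPdist_le : rem0 => /(_ _ e2).
  by apply: filterS => x; rewrite sub0r normrN; apply: le_trans; exact: ler_norm.
have [iH IH] := Rint_heatH x0 t0.
have iB : intble `]0, t[ (fun tau => heatH x (t - tau) * g tau).
  apply: (@intble_dom _ _ _ (fun tau => M * heatH x (t - tau))) => //.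
  - exact: heatB_w_meas.
  - exact: intbleZ.
  - move=> tau /in0t/andP[h1 h2]; rewrite normrM mulrC; apply: ler_pM => //.
      by apply: HM; rewrite h1 ltW.
    by rewrite ger0_norm// heatH_ge0// ?ltW// subr_gt0.
have -> : g t = \int[mu]_(tau in `]0, t[) (g t * heatH x (t - tau)) + g t * heatA (cst 1) x t.
  by rewrite RintZ// IH; ring.
rewrite /heatB /duhamel addrAC -RintB//; last exact: intbleZ.
apply: (le_trans (ler_normD _ _)).
have ic : intble `]0, t[ (cst (x * (2 * M * c)) : R -> R).
  by apply: (@intble_bounded _ _ _ 0 t `|x * (2 * M * c)|) => //; exact: subset_itvW.
have H1 : `|\int[mu]_(tau in `]0, t[) (g t * heatH x (t - tau) - heatH x (t - tau) * g tau)| <=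
    \int[mu]_(tau in `]0, t[) (e / 4 * heatH x (t - tau) + cst (x * (2 * M * c)) tau).
  apply: Rint_dom => //.
  - apply: measurable_funB; apply: intble_meas => //; exact: intbleZ.
  - by apply: intbleD => //; exact: intbleZ.
  move=> tau /in0t/andP[h1 h2]; rewrite mulrC -mulrBr normrM.
  have ts : 0 < t - tau by rewrite subr_gt0.
  have H0 : 0 <= heatH x (t - tau) by rewrite heatH_ge0// ltW.
  rewrite ger0_norm//.
  have [td|dt] := ltP `|t - tau| d.
    have := Hd tau td => /= h; apply: ler_wpDr.
      by apply: mulr_ge0; [exact: ltW|exact: Mc].
    by rewrite mulrC ler_wpM2r.
  apply: ler_wpDl; first by rewrite mulr_ge0// ltW.
  rewrite ger0_norm ?(ltW ts)// in dt.
  rewrite /= (mulrC (2 * M)) mulrA; apply: ler_pM => //; first exact: heatH_small.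
  apply: (le_trans (ler_normB _ _)).
  rewrite (_ : 2 * M = M + M); last by ring.
  by apply: lerD => //; apply: HM; rewrite h1 ltW.
apply: (le_trans (lerD H1 (lexx _))).
rewrite RintD//; last exact: intbleZ.
rewrite RintZ// IH.
have -> : \int[mu]_(tau in `]0, t[) cst (x * (2 * M * c)) tau = x * (2 * M * c) * fine (mu `]0, t[).
  exact: Rintegral_cst.
rewrite lebesgue_measure_itv/= lte_fin t0 /= subr0 normrM.
have : e / 4 * (1 - heatA (cst 1) x t) <= e / 4 + e / 4 * `|heatA (cst 1) x t|.
  rewrite mulrBr mulr1 lerD2l -mulrN ler_wpM2l ?(ltW e4)//.
  by rewrite -normrN; exact: ler_norm.
move: remx; rewrite /rem; lra.
Unshelve. all: by end_near. Qed.
End boundary_term.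

Section source_term.
Variables (f fx fxx : R -> R -> R) (f0 fx0 : R -> R) (M : R).
Hypothesis f_x : forall x t : R, 0 < x -> 0 < t -> is_derive x 1 (f ^~ t) (fx x t).
Hypothesis f_xx : forall x t : R, 0 < x -> 0 < t -> is_derive x 1 (fx ^~ t) (fxx x t).
Hypothesis fxx_cont : forall x t : R, 0 < x -> 0 < t -> {for x, continuous (fxx ^~ t)}.
Hypothesis f_0 : forall t : R, 0 < t -> f x t @[x --> 0^'+] --> f0 t.
Hypothesis fx_0 : forall t : R, 0 < t -> fx x t @[x --> 0^'+] --> fx0 t.
Hypothesis f_t : forall x t : R, 0 < x -> 0 < t -> {for t, continuous (f x)}.
Hypothesis f_M : forall x t : R, 0 < x -> 0 < t ->
  [/\ `|f x t| <= M, `|fx x t| <= M & `|fxx x t| <= M].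

Lemma source_meas (t : R) : 0 < t -> measurable_fun hl (f ^~ t).
Proof.
move=> t0; apply: open_continuous_measurable_fun; first exact: interval_open.
by move=> y /set_mem/in_hl y0; exact: derive_continuous (f_x y0 t0).
Qed.

Lemma source_le (t : R) : 0 < t -> forall y : R, 0 < y -> `|f y t| <= M.
Proof. by move=> t0 y y0; have [] := f_M y0 t0. Qed.

Lemma source_M_ge0 : 0 <= M.
Proof. by apply: le_trans (source_le ltr01 ltr01). Qed.

(** The bound on the second derivative is uniform down to s = 0 thanks to [heatA2_bound]; here the
    two x-derivatives of the source and its traces at x = 0 enter. *)
Lemma heatD_w_bound (d X T : R) : 0 < d -> exists C : R, forall x s tau : R,
  d <= x <= X -> 0 < s <= T -> 0 < tau <= T ->
  `|heatA (f ^~ tau) x s| <= C /\ `|heatA2 (f ^~ tau) x s| <= C.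
Proof.
move=> d0; have [C C0 HC] := heatH_bound X d0; have M0 := source_M_ge0.
exists (2 * M + C * M) => x s tau dx /andP[s0 _] /andP[tau0 _].
have x0 : 0 < x by have /andP[dx1 _] := dx; apply: lt_le_trans dx1.
have [h1 _ _] := HC x s dx s0; split.
  apply: (le_trans (heatA_le (source_meas tau0) (source_le tau0) x s0)).
  by rewrite lerDl mulr_ge0.
have [||||||_ H] := @heatA2_bound R (f ^~ tau) (fx ^~ tau) (fxx ^~ tau) M (f0 tau) (fx0 tau) x s x0 s0.
- by move=> y y0; exact: f_x.
- by move=> y y0; exact: f_xx.
- by move=> y y0; exact: fxx_cont.
- exact: f_0.
- exact: fx_0.
- by move=> y y0; exact: f_M.
by apply: (le_trans H); rewrite lerD2l ler_wpM2r.
Qed.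

Lemma heatD_w_cont (x t tau : R) : 0 < x -> 0 < tau < t ->
  {for tau, continuous (fun tau => heatA (f ^~ tau) x (t - tau))}.
Proof.
move=> x0 /andP[tau0 taut].
pose d := Num.min tau (t - tau) / 2.
have d0 : 0 < d by rewrite divr_gt0// lt_min tau0 subr_gt0.
have d1 : d <= tau / 2 by rewrite ler_wpM2r// ge_min lexx.
have d2 : d <= (t - tau) / 2 by rewrite ler_wpM2r// ge_min lexx orbT.
have t20 : 0 < (t - tau) / 2 by rewrite divr_gt0// subr_gt0.
have [C C0 HC] := heatG_env t x t20.
have xx : 0 < x <= x by rewrite x0 lexx.
have nt : \forall s \near tau, 0 < s /\ (t - tau) / 2 <= t - s <= t.
  exists d => // s /=; rewrite ltr_norml => /andP[h1 h2].
  by split; [lra|apply/andP; split; lra].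
apply: (@Rint_dct _ _ _ hl (fun s y => heatG x y (t - s) * f y s) _ (fun y => C * M * expR (- y))) => //.
- exact: seqfilter_nbhs.
- by apply: intbleZ => //; exact: intble_expRN.
- apply: filterS nt => s [s0 _]; apply: measurable_funM; last exact: source_meas.
  by apply: measurable_funTS; apply: continuous_measurable_fun; exact: continuous_heatG_y.
- apply: filterS nt => s [s0 ts] y /in_hl y0.
  rewrite normrM mulrAC; apply: ler_pM => //; last exact: source_le.
  by have [] := HC x y (t - s) xx y0 ts.
- move=> y /in_hl y0; apply: cvgM; last exact: f_t.
  have ts : 0 < t - tau by rewrite subr_gt0.
  exact: (derive_continuous (is_derive_refl_comp (is_derive_heatG_s x y ts))).
Qed.

Lemma heatD_w_meas (x t : R) : 0 < x -> 0 < t ->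
  measurable_fun (`]0, t[ : set R) (fun tau => heatA (f ^~ tau) x (t - tau)).
Proof.
move=> x0 t0; apply: open_continuous_measurable_fun; first exact: interval_open.
by move=> s /set_mem/in0t; exact: heatD_w_cont.
Qed.

Lemma heatD_heat (x t : R) : 0 < x -> 0 < t -> exists D1 : R -> R -> R, exists D2 : R,
  [/\ forall y : R, 0 < y -> is_derive y 1 (heatD f ^~ t) (D1 y t),
      is_derive x 1 (D1 ^~ t) D2 & is_derive t 1 (heatD f x) (f x t + D2)].
Proof.
move=> x0 t0.
have A1 (z s tau : R) : 0 < z -> 0 < s -> 0 < tau ->
  is_derive z 1 (fun x => heatA (f ^~ tau) x s) (heatAx (f ^~ tau) z s).
  move=> h1 h2 h3; exact: (is_derive_heatA_x (source_meas h3) (source_le h3)).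
have A2 (z s tau : R) : 0 < z -> 0 < s -> 0 < tau ->
  is_derive z 1 (fun x => heatAx (f ^~ tau) x s) (heatA2 (f ^~ tau) z s).
  move=> h1 h2 h3; exact: (is_derive_heatAx_x (source_meas h3) (source_le h3)).
have A3 (z s tau : R) : 0 < z -> 0 < s -> 0 < tau ->
  is_derive s 1 (fun s => heatA (f ^~ tau) z s) (heatA2 (f ^~ tau) z s).
  move=> h1 h2 h3; exact: (is_derive_heatA_t (source_meas h3) (source_le h3)).
have A4 (z tau : R) : 0 < z -> 0 < tau ->
  heatA (f ^~ tau) z s @[s --> 0^'+] --> f z tau.
  move=> h1 h2; apply: (heatA_cvg_t (source_meas h2) (source_le h2) h1).
  exact: derive_continuous (f_x h1 h2).
exists (duhamel1 (fun x s tau => heatAx (f ^~ tau) x s)).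
exists (duhamel2 (fun x s tau => heatA2 (f ^~ tau) x s) x t); split.
- by move=> y y0; apply: (is_derive_duhamel_x A1 A2 heatD_w_bound heatD_w_meas).
- exact: (is_derive_duhamel1_x A1 A2 heatD_w_bound heatD_w_meas).
- exact: (is_derive_duhamel_t (phi := f) A1 A2 A3 heatD_w_bound A4 f_t heatD_w_meas).
Qed.

Lemma heatD_cvg_t (x : R) : 0 < x -> heatD f x t @[t --> 0^'+] --> 0.
Proof. by move=> x0; apply: (duhamel_cvg_t heatD_w_bound heatD_w_meas x0). Qed.

Lemma heatD_cvg_x (t : R) : 0 < t -> heatD f x t @[x --> 0^'+] --> 0.
Proof.
move=> t0.
have E0 : \int[mu]_(tau in `]0, t[) (0 : R) = 0 by rewrite Rintegral_cst// mul0r.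
rewrite -[X in _ --> X]E0.
apply: (@Rint_dct _ _ _ `]0, t[ (fun x tau => heatA (f ^~ tau) x (t - tau)) _ (cst (2 * M))) => //.
- exact: seqfilter_right.
- by apply: (@intble_bounded _ _ _ 0 t `|2 * M|) => //; exact: subset_itvW.
- near=> x; apply: heatD_w_meas => //; near: x; exact: nbhs_right_gt.
- near=> x => tau /in0t/andP[h1 h2].
  by apply: heatA_le; [exact: source_meas|exact: source_le|rewrite subr_gt0].
- move=> tau /in0t/andP[h1 h2].
  by apply: heatA_cvg_x; [exact: source_meas|exact: source_le|rewrite subr_gt0].
Unshelve. all: by end_near. Qed.
End source_term.
End heat_solution.

(** * Uniqueness *)

Lemma near_time_range {R : realType} (s tau t d : R) : - d < s - tau -> s - tau < d ->
  d <= tau / 2 -> d <= (t - tau) / 2 -> 0 < d -> 0 < tau -> tau < t ->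
  [/\ 0 < s, (t - tau) / 2 <= t - s <= t & 0 < s <= t].
Proof. by move=> *; split; [lra|apply/andP; split; lra|apply/andP; split; lra]. Qed.

Section heat_uniqueness.
Context {R : realType}.
Notation mu := (@lebesgue_measure R).
Notation hl := (`]0, +oo[%classic : set R).
Variables (f fx fxx : R -> R -> R) (f0 fx0 : R -> R) (M : R).
Hypothesis f_x : forall x t : R, 0 < x -> 0 < t -> is_derive x 1 (f ^~ t) (fx x t).
Hypothesis f_xx : forall x t : R, 0 < x -> 0 < t -> is_derive x 1 (fx ^~ t) (fxx x t).
Hypothesis fxx_cont : forall x t : R, 0 < x -> 0 < t -> {for x, continuous (fxx ^~ t)}.
Hypothesis f_0 : forall t : R, 0 < t -> f x t @[x --> 0^'+] --> f0 t.
Hypothesis fx_0 : forall t : R, 0 < t -> fx x t @[x --> 0^'+] --> fx0 t.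
Hypothesis f_t : forall x t : R, 0 < x -> 0 < t -> {for t, continuous (f x)}.
Hypothesis f_M : forall x t : R, 0 < x -> 0 < t ->
  [/\ `|f x t| <= M, `|fx x t| <= M & `|fxx x t| <= M].
Variables (u g : R -> R).
Hypothesis g_cont : forall t : R, 0 < t -> {for t, continuous g}.
Hypothesis g_bound : forall T : R, exists M : R, forall t : R, 0 < t <= T -> `|g t| <= M.
Variables (v vx vxx vt : R -> R -> R) (vx0 : R -> R).
Hypothesis v_x : forall x t : R, 0 < x -> 0 < t -> is_derive x 1 (v ^~ t) (vx x t).
Hypothesis v_xx : forall x t : R, 0 < x -> 0 < t -> is_derive x 1 (vx ^~ t) (vxx x t).
Hypothesis v_t : forall x t : R, 0 < x -> 0 < t -> is_derive t 1 (v x) (vt x t).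
Hypothesis vxx_cont : forall x t : R, 0 < x -> 0 < t -> {for x, continuous (vxx ^~ t)}.
Hypothesis v_heat : forall x t : R, 0 < x -> 0 < t -> vt x t - vxx x t = f x t.
Hypothesis v_init : forall x : R, 0 < x -> v x t @[t --> 0^'+] --> u x.
Hypothesis v_0 : forall t : R, 0 < t -> v x t @[x --> 0^'+] --> g t.
Hypothesis vx_0 : forall t : R, 0 < t -> vx x t @[x --> 0^'+] --> vx0 t.
Hypothesis v_cont : forall x t eta : R, 0 < x -> 0 < t -> 0 < eta ->
  exists2 d : R, 0 < d & forall x' t' : R, `|x' - x| < d -> `|t' - t| < d ->
  `|v x' t' - v x t| <= eta.
Hypothesis v_oo : forall t : R, 0 < t -> exists N : R,
  \forall x \near +oo, `|v x t| <= N /\ `|vx x t| <= N.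
Hypothesis v_dom : forall T : R, exists B : R -> R, [/\ forall x : R, 0 < x -> 0 <= B x,
  intble hl B & forall x t : R, 0 < x -> 0 < t <= T -> `|v x t| <= 1 + B x /\ `|vt x t| <= 1 + B x].

Lemma v_meas (t : R) : 0 < t -> measurable_fun hl (v ^~ t).
Proof.
move=> t0; apply: open_continuous_measurable_fun; first exact: interval_open.
by move=> y /set_mem/in_hl y0; exact: derive_continuous (v_x y0 t0).
Qed.

Lemma near_continuous (h k : R -> R) (y : R) : (\forall z \near y, h z = k z) ->
  {for y, continuous h} -> {for y, continuous k}.
Proof.
move=> E ch; have Ey := nbhs_singleton E.
by rewrite /prop_for /continuous_at -Ey; apply: cvg_trans ch; exact: near_eq_cvg.
Qed.

(** The equation writes [vt] as [vxx + f], and both terms are continuous in x. *)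
Lemma vt_meas (t : R) : 0 < t -> measurable_fun hl (vt ^~ t).
Proof.
move=> t0; apply: open_continuous_measurable_fun; first exact: interval_open.
move=> y /set_mem/in_hl y0.
apply: (@near_continuous (fun y => vxx y t + f y t)).
  near=> z; rewrite -(@v_heat z t) //; last by near: z; exact: lt_nbhsr.
  by rewrite addrC subrK.
by apply: cvgD; [exact: vxx_cont|exact: derive_continuous (f_x y0 t0)].
Unshelve. all: by end_near. Qed.

Lemma intble_weight (B : R -> R) (C : R) : intble hl B ->
  intble hl (fun y => C * (expR (- y) + B y)).
Proof. by move=> iB; apply: intbleZ => //; apply: intbleD => //; exact: intble_expRN. Qed.

(** The kernel decay makes the constant 1 integrable; next to [B], integrable by itself, the factor
    exp(-y) <= 1 is dropped. *)
Lemma weight_le (B : R -> R) (C a b y : R) : 0 <= C -> 0 < y -> 0 <= B y ->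
  `|a| <= C * expR (- y) -> `|b| <= 1 + B y -> `|a * b| <= C * (expR (- y) + B y).
Proof.
move=> C0 y0 B0 h1 h2; rewrite normrM.
apply: (@le_trans _ _ (C * expR (- y) * (1 + B y))); first exact: ler_pM.
rewrite -mulrA ler_wpM2l// mulrDr mulr1 lerD2l ler_piMl//.
by rewrite expR_le1 oppr_le0 ltW.
Qed.

(** Differentiating the kernel in t - tau produces -G_2 v, and G_2 is also the second y-derivative;
    so after [vt] is replaced by [vxx + f], the expression is that of Green's formula plus the
    source term. *)
Lemma heat_energy_derive (x t tau : R) : 0 < x -> 0 < tau < t ->
  is_derive tau 1 (fun tau => \int[mu]_(y in hl) (heatG x y (t - tau) * v y tau))
   (heatH x (t - tau) * g tau + heatA (f ^~ tau) x (t - tau)).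
Proof.
move=> x0 /andP[tau0 taut]; have ts : 0 < t - tau by rewrite subr_gt0.
have [B [B0 iB HB]] := v_dom t.
have t20 : 0 < (t - tau) / 2 by rewrite divr_gt0.
have [C C0 HC] := heatG_env t x t20.
have xx : 0 < x <= x by rewrite x0 lexx.
pose d := Num.min tau (t - tau) / 2.
have d0 : 0 < d by rewrite divr_gt0// lt_min tau0 subr_gt0.
have d1 : d <= tau / 2 by rewrite ler_wpM2r// ge_min lexx.
have d2 : d <= (t - tau) / 2 by rewrite ler_wpM2r// ge_min lexx orbT.
have nt s : `|s - tau| < d -> [/\ 0 < s, (t - tau) / 2 <= t - s <= t & 0 < s <= t].
  rewrite ltr_norml => /andP[h1 h2].
  exact: near_time_range h1 h2 d1 d2 d0 tau0 taut.
have tt : `|tau - tau| < d by rewrite subrr normr0.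
have mG s : measurable_fun hl (fun y => heatG x y s).
  by apply: measurable_funTS; apply: continuous_measurable_fun; exact: continuous_heatG_y.
have mG2 s : measurable_fun hl (fun y => heatG2 x y s).
  by apply: measurable_funTS; apply: continuous_measurable_fun; exact: continuous_heatG2_y.
have bnd s y : `|s - tau| < d -> 0 < y ->
   [/\ `|heatG x y (t - s) * v y s| <= C * (expR (- y) + B y),
       `|heatG x y (t - s) * vt y s| <= C * (expR (- y) + B y) &
       `|heatG2 x y (t - s) * v y s| <= C * (expR (- y) + B y)].
  move=> /nt[s0 ts1 ts2] y0; have [h1 h2] := HB y s y0 ts2.
  have [k1 _ _ k2] := HC x y (t - s) xx y0 ts1.
  by split; apply: weight_le => //; exact: B0.
have i1 : intble hl (fun y => heatG x y (t - tau) * v y tau).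
  apply: (@intble_dom _ _ _ (fun y => C * (expR (- y) + B y))) => //.
  - by apply: measurable_funM => //; exact: v_meas.
  - exact: intble_weight.
  - by move=> y /in_hl y0; have [] := bnd tau y tt y0.
have i2 : intble hl (fun y => heatG x y (t - tau) * vt y tau).
  apply: (@intble_dom _ _ _ (fun y => C * (expR (- y) + B y))) => //.
  - by apply: measurable_funM => //; exact: vt_meas.
  - exact: intble_weight.
  - by move=> y /in_hl y0; have [] := bnd tau y tt y0.
have i3 : intble hl (fun y => heatG2 x y (t - tau) * v y tau).
  apply: (@intble_dom _ _ _ (fun y => C * (expR (- y) + B y))) => //.
  - by apply: measurable_funM => //; exact: v_meas.
  - exact: intble_weight.
  - by move=> y /in_hl y0; have [] := bnd tau y tt y0.
have i4 : intble hl (fun y => heatG x y (t - tau) * f y tau).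
  apply: (intble_env (source_meas f_x tau0) (source_le f_M tau0) (C := C)).
    exact: continuous_heatG_y.
  move=> y y0; have [_ h _] := nt tau tt.
  by have [h1 _ _ _] := HC x y (t - tau) xx y0 h.
have E : \int[mu]_(y in hl) (heatG x y (t - tau) * vt y tau - heatG2 x y (t - tau) * v y tau) =
    heatH x (t - tau) * g tau + heatA (f ^~ tau) x (t - tau).
  have [N HN] := v_oo tau0.
  have iG : intble hl (fun y => heatG x y (t - tau) * vxx y tau - heatG2 x y (t - tau) * v y tau).
    apply: (eq_intble _ _ (intbleB _ (intbleB _ i2 i4) i3)) => // y /in_hl y0.
    by rewrite -(v_heat y0 tau0); ring.
  have HG : \int[mu]_(y in hl) (heatG x y (t - tau) * vxx y tau - heatG2 x y (t - tau) * v y tau) =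
      heatH x (t - tau) * g tau.
    apply: (@heat_green R x (t - tau) (g tau) (vx0 tau) N (v ^~ tau) (vx ^~ tau) (vxx ^~ tau)) => //.
    - by move=> y y0; exact: v_x.
    - by move=> y y0; exact: v_xx.
    - by move=> y y0; exact: vxx_cont.
    - exact: v_0.
    - exact: vx_0.
  rewrite -HG /heatA -RintD//; apply: eq_Rint => y /in_hl y0.
  by rewrite -(v_heat y0 tau0); ring.
rewrite -E.
have mv s : `|s - tau| < d -> measurable_fun hl (fun y => heatG x y (t - s) * v y s).
  by move=> /nt[s0 _ _]; apply: measurable_funM => //; exact: v_meas.
have dv s y : `|s - tau| < d -> hl y -> is_derive s 1 (fun s => heatG x y (t - s) * v y s)
    (heatG x y (t - s) * vt y s - heatG2 x y (t - s) * v y s).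
  move=> sd /in_hl y0; have [s0 /andP[ts1 _] _] := nt s sd.
  have ts2 : 0 < t - s by apply: lt_le_trans ts1.
  have H1 := is_derive_refl_comp (is_derive_heatG_s x y ts2).
  have H2 := v_t y0 s0.
  have H := is_deriveM H1 H2.
  by apply: (is_derive_eq H); rewrite /GRing.scale /=; ring.
have bv s y : `|s - tau| < d -> hl y -> `|heatG x y (t - s) * vt y s - heatG2 x y (t - s) * v y s| <=
    C * (expR (- y) + B y) + C * (expR (- y) + B y).
  move=> sd /in_hl y0; apply: (le_trans (ler_normB _ _)).
  by have [_ h1 h2] := bnd s y sd y0; exact: lerD.
have mhl : measurable hl by [].
have iw := intble_weight C iB.
exact: (derive_Rint mhl d0 i1 mv (intbleD mhl iw iw) dv bv).
Qed.

Lemma heat_unique (x t : R) : 0 < x -> 0 < t ->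
  v x t = heatA u x t + heatB g x t + heatD f x t.
Proof.
move=> x0 t0; have [B [B0 iB HB]] := v_dom t.
have xx : 0 < x <= x by rewrite x0 lexx.
have mB (z t' : R) : 0 < z -> 0 < t' ->
    measurable_fun (`]0, t'[ : set R) (fun tau => heatH z (t' - tau) * g tau).
  by move=> *; exact: heatB_w_meas.
have iBt := intble_duhamel (heatB_w_bound g_bound) mB x0 t0.
have iDt := intble_duhamel (heatD_w_bound f_x f_xx fxx_cont f_0 fx_0 f_M)
  (heatD_w_meas f_x f_t f_M) x0 t0.
have H : heatB g x t + heatD f x t = v x t - heatA u x t.
  rewrite /heatB /heatD /duhamel -RintD//.
  apply: (@FTC2_0t R (fun tau => \int[mu]_(y in hl) (heatG x y (t - tau) * v y tau))) => //.
  - exact: intbleD.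
  - by move=> s st; exact: heat_energy_derive.
  - move=> s st; apply: cvgD; first exact: heatB_w_cont.
    exact: (heatD_w_cont f_x f_t f_M).
  - have t20 : 0 < t / 2 by rewrite divr_gt0.
    have [C C0 HC] := heatG_env t x t20.
    rewrite /heatA.
    apply: (@Rint_dct _ _ _ hl (fun s y => heatG x y (t - s) * v y s) _
      (fun y => C * (expR (- y) + B y))) => //.
    + exact: seqfilter_right.
    + exact: intble_weight.
    + near=> s; apply: measurable_funM.
        by apply: measurable_funTS; apply: continuous_measurable_fun; exact: continuous_heatG_y.
      by apply: v_meas; near: s; exact: nbhs_right_gt.
    + near=> s => y /in_hl y0.
      have s0 : 0 < s by near: s; exact: nbhs_right_gt.
      (* Keeps t - s at least t/2, away from the singularity of the kernel, so that a single
         envelope applies. *)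
      have st : s < t / 2 by near: s; exact: nbhs_right_lt.
      have [h1 _] := HB y s y0 ltac:(apply/andP; split; lra).
      have [k1 _ _ _] := HC x y (t - s) xx y0 ltac:(apply/andP; split; lra).
      by apply: weight_le => //; exact: B0.
    + move=> y /in_hl y0; apply: cvgM; last exact: v_init.
      rewrite -[X in heatG _ _ X](subr0 t); apply: cvg_at_right_filter.
      have t00 : 0 < t - 0 by rewrite subr0.
      exact: (derive_continuous (is_derive_refl_comp (is_derive_heatG_s x y t00))).
  - rewrite (_ : (fun tau => _) = (fun s => (fun e => \int[mu]_(y in hl) (heatG x y e * v y (t - e))) (t - s))); last first.
      by apply/funext => s /=; rewrite opprB addrCA subrr addr0.
    (* In the reversed time e = t - tau the kernel at time e is an approximate identity while the
       data v(y, t - e) move with e. This is why [heatG_approx] allows integrands depending on e,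
       and joint continuity of [v] at (x, t) gives the limit. *)
    apply: (@cvg_refl_left R (fun e => \int[mu]_(y in hl) (heatG x y e * v y (t - e)))).
    apply: (@heatG_approx R x (v x t) 1 (fun e y => v y (t - e)) B) => //.
      near=> e; have e0 : 0 < e by near: e; exact: nbhs_right_gt.
      have et : e < t by near: e; exact: nbhs_right_lt.
      split; first by apply: v_meas; rewrite subr_gt0.
      by move=> y y0; have [] := HB y (t - e) y0 ltac:(apply/andP; split; lra).
    move=> eta eta0; have [d d0 Hd] := v_cont x0 t0 eta0; exists d => //.
    move=> e y /andP[e0 ed] y0 yx; apply: Hd => //.
    by rewrite addrAC subrr sub0r normrN gtr0_norm.
by rewrite -addrA H addrC subrK.
Unshelve. all: by end_near. Qed.
End heat_uniqueness.

(** * Gaussian integrals along rays *)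

Section gauss.
Context {R : realType}.
Notation mu := (@lebesgue_measure R).
Notation hl := (`]0, +oo[%classic : set R).

Lemma FTC2_0y (F f : R -> R) (a b : R) : intble hl f ->
  (forall y : R, 0 < y -> is_derive y 1 F (f y)) ->
  (forall y : R, 0 < y -> {for y, continuous f}) ->
  F y @[y --> 0^'+] --> a -> F y @[y --> +oo] --> b ->
  \int[mu]_(y in hl) f y = b - a.
Proof.
move=> fi Fd fc Fa Fb.
apply: (@FTC2_exhaust R hl F f (fun n => n.+2%:R^-1) (fun n => n.+1%:R)).
- exact: measurable_itv.
- exact: fi.
- move=> n; split.
    by rewrite (@lt_le_trans _ _ 1)// ?ler1n// invf_lt1 ?ltr1n.
  by move=> y /=; rewrite !in_itv/= andbT => /andP[+ _]; apply: lt_le_trans; rewrite invr_gt0.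
- move=> y /in_hl y0; near=> n; apply/andP; split.
    rewrite invf_ple ?posrE//; apply: (@le_trans _ _ n%:R).
      by near: n; exact: nbhs_infty_ger.
    by rewrite ler_nat (leq_trans (leqnSn _)).
  apply: (@le_trans _ _ n%:R); last by rewrite ler_nat.
  by near: n; exact: nbhs_infty_ger.
- by move=> y /in_hl; exact: Fd.
- by move=> y /in_hl; exact: fc.
- have := (@cvg_at_rightP R F 0 _).1 Fa; apply; split => [n|].
    by rewrite invr_gt0.
  apply/cvgrPdist_lt => e e0; near=> n.
  rewrite sub0r normrN ger0_norm ?invr_ge0//.
  apply: (@lt_trans _ _ (n.+1%:R^-1)); first by rewrite ltf_pV2 ?posrE// ltr_nat.
  by near: n; exact: near_invS.
- have := (@cvg_pinftyP R F b).1 Fb; apply.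
  apply/cvgryPge => A; near=> n; apply: (@le_trans _ _ n%:R); last by rewrite ler_nat.
  by near: n; exact: nbhs_infty_ger.
Unshelve. all: by end_near. Qed.

Lemma Rint_cvg_pinfty (f : R -> R) : intble hl f ->
  \int[mu]_(r in `[0, A]) f r @[A --> +oo] --> \int[mu]_(r in hl) f r.
Proof.
move=> fi.
have E A : 0 < A -> \int[mu]_(r in `[0, A]) f r = \int[mu]_(r in hl) (f \_ `]0, A]) r.
  move=> A0; have S : `]0, A] `<=` hl by apply: subset_itvl.
  rewrite -Rintegral_itv_obnd_cbnd; last by apply: intbleS fi.
  by rewrite -Rintegral_mkcondr setIidr.
apply: (@cvg_trans _ (\int[mu]_(r in hl) (f \_ `]0, A]) r @[A --> +oo])).
  apply: near_eq_cvg; near=> A.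
  have A0 : 0 < A by near: A; apply: nbhs_pinfty_gt; exact: num_real.
  by rewrite E.
apply: (@Rint_dct _ _ _ hl (fun A => f \_ `]0, A]) f (fun r => `|f r|)) => //.
- exact: seqfilter_pinfty.
- exact: intble_norm.
- near=> A; apply/(measurable_restrict f) => //.
  by apply: measurable_funS (intble_meas fi) => //; exact: subIsetl.
- by near=> A => r _; rewrite patchE; case: ifP => //; rewrite normr0.
- move=> r /in_hl r0; apply: (@cvg_trans _ (cst (f r) @ +oo)); last exact: cvg_cst.
  apply: near_eq_cvg; near=> A; rewrite patchE ifT// inE/= in_itv/= r0/=.
  by near: A; apply: nbhs_pinfty_ge; exact: num_real.
Unshelve. all: by end_near. Qed.

(** The factor 1 + r leaves room for the weight lambda in the boundary term and for the derivatives
    of trigonometric factors. *)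
Lemma expR_poly_bound (c : R) : 0 < c -> exists2 C, 0 <= C &
  forall r : R, 0 <= r -> (1 + r) * expR (- (r * c)) <= C * (1 + r ^+ 2)^-1.
Proof.
(* Cubing m (1 + r) <= exp(m (1 + r)) gives (1 + r)^3 <= m^(-3) exp(c + r c), and (1 + r)(1 + r^2)
   <= (1 + r)^3. *)
move=> c0; pose m := c / 3; have m0 : 0 < m by rewrite divr_gt0.
exists (m^-1 ^+ 3 * expR c) => [|r r0].
  by rewrite mulr_ge0 ?expR_ge0// exprn_ge0// invr_ge0 ltW.
have r1 : 0 < 1 + r by rewrite ltr_pwDl.
have rr : 0 < 1 + r ^+ 2 by rewrite ltr_pwDl// sqr_ge0.
rewrite expRN ler_pdivrMr ?expR_gt0// mulrAC ler_pdivlMr//.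
have H : (m * (1 + r)) ^+ 3 <= expR (m * (1 + r)) ^+ 3.
  by apply: exprn_le; [rewrite mulr_ge0 ?ltW|exact: ler_expR_id].
rewrite -expRM_natr (_ : m * (1 + r) * 3 = c + r * c) in H; last by rewrite /m; field.
rewrite expRD in H; apply: (@le_trans _ _ ((1 + r) ^+ 3)).
  have -> : (1 + r) ^+ 3 = (1 + r) * (1 + r ^+ 2) + (1 + r) * (2 * r) by ring.
  by rewrite lerDl mulr_ge0 ?mulr_ge0// ltW.
by rewrite exprVn -mulrA ler_pdivlMl ?exprn_gt0// -exprMn.
Qed.

(** Completing the square: r^2 s - r + 1/(4s) is s times the square of r - 1/(2s). The form [r * 1]
    fits [expR_poly_bound] with rate 1. *)
Lemma gauss_le_exp (s r : R) : 0 < s -> expR (- (r ^+ 2 * s)) <= expR ((4 * s)^-1) * expR (- (r * 1)).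
Proof.
move=> s0; rewrite -expRD ler_expR.
have : 0 <= (r - (2 * s)^-1) ^+ 2 * s by rewrite mulr_ge0 ?sqr_ge0 ?ltW.
have -> : (r - (2 * s)^-1) ^+ 2 * s = r ^+ 2 * s - r + (4 * s)^-1 by field; rewrite gt_eqF.
lra.
Qed.

Lemma gauss_poly_bound (s : R) : 0 < s -> exists2 C, 0 <= C &
  forall r : R, 0 <= r -> (1 + r) * expR (- (r ^+ 2 * s)) <= C * (1 + r ^+ 2)^-1.
Proof.
move=> s0; have [C C0 HC] := expR_poly_bound ltr01.
exists (expR ((4 * s)^-1) * C) => [|r r0]; first by rewrite mulr_ge0 ?expR_ge0.
apply: (@le_trans _ _ (expR ((4 * s)^-1) * ((1 + r) * expR (- (r * 1))))).
  by rewrite mulrCA ler_wpM2l ?gauss_le_exp// addr_ge0.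
by rewrite -mulrA ler_wpM2l ?expR_ge0// HC.
Qed.

Lemma continuous_measurable_hl (f : R -> R) : continuous f -> measurable_fun hl f.
Proof. by move=> fc; apply: measurable_funTS; exact: continuous_measurable_fun. Qed.

Lemma derive_continuousT (f f' : R -> R) : (forall x : R, is_derive x 1 f (f' x)) -> continuous f.
Proof. by move=> fd x; exact: (derive_continuous (fd x)). Qed.

(** At the dual time 1/(4s) the heat kernel is a multiple of exp(-r^2 s); its mass is 1, and
    evenness halves it. *)
Lemma Rint_gauss (s : R) : 0 < s ->
  \int[mu]_(r in hl) expR (- (r ^+ 2 * s)) = pi * heatK 0 s.
Proof.
move=> s0; pose s' := (4 * s)^-1.
have s'0 : 0 < s' by rewrite invr_gt0 mulr_gt0.
have q0 : 0 < Num.sqrt s by rewrite sqrtr_gt0.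
have qp : 0 < Num.sqrt (pi : R) by rewrite sqrtr_gt0 pi_gt0.
have q4 : Num.sqrt 4 = 2 :> R.
  by rewrite (_ : 4 = 2 ^+ 2) ?sqrtr_sqr ?ger0_norm//; ring.
pose c : R := Num.sqrt s / Num.sqrt pi.
have KE y : heatK (0 - y) s' = c * expR (- (y ^+ 2 * s)).
  rewrite /heatK sub0r sqrrN /s' sqrtrV ?mulr_ge0 ?ltW// !sqrtrM// !q4 !invrK.
  congr (_ * expR _); last by field.
  by rewrite /c; field; rewrite gt_eqF.
have gc : continuous (fun r : R => expR (- (r ^+ 2 * s))).
  by apply: derive_continuousT => x; apply: is_derive_eq.
have I := Rint_heatK 0 s'0.
have iK := intble_heatK 0 s'0.
have iG : intble setT (fun y : R => expR (- (y ^+ 2 * s))).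
  apply: (@eq_intble R _ (fun y => c^-1 * heatK (0 - y) s')) => //.
    by move=> y _; rewrite KE mulrA mulVf ?mul1r// gt_eqF// divr_gt0.
  exact: intbleZ.
rewrite (eq_Rint (g := fun y => c * expR (- (y ^+ 2 * s)))) in I; last by move=> y _; exact: KE.
rewrite RintZ// in I.
have S : \int[mu]_(y in setT) expR (- (y ^+ 2 * s)) = 2 * \int[mu]_(r in hl) expR (- (r ^+ 2 * s)).
  have i0 : intble `[0, +oo[ (fun y : R => expR (- (y ^+ 2 * s))) by exact: (@intbleS R setT) iG.
  have i1 : intble hl (fun y : R => expR (- (y ^+ 2 * s))) by exact: (@intbleS R setT) iG.
  rewrite (Rintegral_itv_obnd_cbnd i1).
  rewrite /Rintegral ge0_symfun_integralT//; last first.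
    by move=> y; rewrite /= sqrrN.
  by rewrite -set_itvcy fineM//; exact: integrable_fin_num.
rewrite S in I.
have -> : \int[mu]_(r in hl) expR (- (r ^+ 2 * s)) = (2 * c)^-1.
  apply: (mulfI (x := 2 * c)); first by rewrite gt_eqF// mulr_gt0// divr_gt0.
  have -> : 2 * c / (2 * c) = 1 by rewrite mulfV// gt_eqF// mulr_gt0// divr_gt0.
  by rewrite -[RHS]I; ring.
rewrite /heatK expr0n/= mul0r mul0r oppr0 expR0 mulr1 sqrtrM// q4 /c.
have E : pi = Num.sqrt pi ^+ 2 :> R by rewrite sqr_sqrtr ?pi_ge0.
move: (Num.sqrt (pi : R)) (Num.sqrt s) q0 qp E {c KE I S iG iK} => p q q0 p0 ->.
by field; rewrite !gt_eqF.
Qed.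

Lemma intble_hl_dom (f : R -> R) (C : R) : continuous f ->
  (forall r : R, 0 < r -> `|f r| <= C * (1 + r ^+ 2)^-1) -> intble hl f.
Proof.
move=> fc fC; apply: (@intble_dom R _ _ (fun r => C * (1 + r ^+ 2)^-1)) => //.
- exact: continuous_measurable_hl.
- by apply: intbleZ => //; exact: intble_oneDsqr.
- by move=> r /in_hl; exact: fC.
Qed.

Lemma cos_gauss_cont (s z : R) : continuous (fun r : R => cos (r * z) * expR (- (r ^+ 2 * s))).
Proof. by apply: derive_continuousT => x; apply: is_derive_eq. Qed.

Lemma sin_gauss_cont (s z : R) : continuous (fun r : R => - r * sin (r * z) * expR (- (r ^+ 2 * s))).
Proof. by apply: derive_continuousT => x; apply: is_derive_eq. Qed.

(** The classical argument by a differential equation: integrating the r-derivative of sin(r w)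
    exp(-r^2 s) over the half-line gives w P(w) + 2 s P'(w) = 0 for the cosine integral P, and P(0)
    is the Gaussian integral. *)
Lemma gauss_cos (s z : R) : 0 < s ->
  intble hl (fun r => cos (r * z) * expR (- (r ^+ 2 * s))) /\
  \int[mu]_(r in hl) (cos (r * z) * expR (- (r ^+ 2 * s))) = pi * heatK z s.
Proof.
move=> s0; have [C C0 HC] := gauss_poly_bound s0.
have B (r w : R) : 0 < r -> `|w| <= 1 + r -> `|w * expR (- (r ^+ 2 * s))| <= C * (1 + r ^+ 2)^-1.
  move=> r0 w1; rewrite normrM (ger0_norm (expR_ge0 _)).
  by apply: le_trans (HC _ (ltW r0)); rewrite ler_wpM2r ?expR_ge0.
have cosB (r w : R) : 0 < r -> `|cos w| <= 1 + r.
  by move=> r0; apply: (le_trans (cos_max _)); rewrite lerDl ltW.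
have sinB (r w : R) : 0 < r -> `|- r * sin w| <= 1 + r.
  move=> r0; rewrite normrM normrN (gtr0_norm r0); have := sin_max w.
  have := normr_ge0 (sin w); nra.
have ci (w : R) : intble hl (fun r => cos (r * w) * expR (- (r ^+ 2 * s))).
  by apply: (intble_hl_dom (C := C)); [exact: cos_gauss_cont|move=> r r0; apply: B => //; exact: cosB].
have si (w : R) : intble hl (fun r => - r * sin (r * w) * expR (- (r ^+ 2 * s))).
  by apply: (intble_hl_dom (C := C)); [exact: sin_gauss_cont|move=> r r0; apply: B => //; exact: sinB].
split => //.
pose P (w : R) := \int[mu]_(r in hl) (cos (r * w) * expR (- (r ^+ 2 * s))).
have dP (w : R) : is_derive w 1 P (- (w / (2 * s)) * P w).
  have -> : - (w / (2 * s)) * P w = \int[mu]_(r in hl) (- r * sin (r * w) * expR (- (r ^+ 2 * s))).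
    have E : \int[mu]_(r in hl) (w * (cos (r * w) * expR (- (r ^+ 2 * s))) +
        2 * s * (- r * sin (r * w) * expR (- (r ^+ 2 * s)))) = 0 - 0.
      apply: (@FTC2_0y (fun r => sin (r * w) * expR (- (r ^+ 2 * s)))).
      - by apply: intbleD => //; exact: intbleZ.
      - move=> r r0; apply: is_derive_eq; rewrite /GRing.scale /=; ring.
      - move=> r r0; apply: cvgD; apply: cvgM; try exact: cvg_cst.
          exact: cos_gauss_cont.
        exact: sin_gauss_cont.
      - have E0 : sin (0 * w) * expR (- (0 ^+ 2 * s)) = 0 by rewrite mul0r sin0 mul0r.
        rewrite -[X in _ --> X]E0; apply: cvg_at_right_filter.
        have sc : continuous (fun r : R => sin (r * w) * expR (- (r ^+ 2 * s))).
          by apply: derive_continuousT => r; apply: is_derive_eq.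
        exact: sc.
      - apply: (@cvg_dom _ _ _ _ _ (fun r => expR ((4 * s)^-1) * expR (- r))).
          near=> r; rewrite subr0 normrM (ger0_norm (expR_ge0 _)).
          apply: le_trans (_ : 1 * expR (- (r ^+ 2 * s)) <= _).
            by rewrite ler_wpM2r ?expR_ge0// sin_max.
          by rewrite mul1r -[X in _ <= _ * expR (- X)]mulr1; exact: gauss_le_exp.
        rewrite -[X in _ --> X](mulr0 (expR ((4 * s)^-1))).
        by apply: cvgM; [exact: cvg_cst|exact: cvgr_expR].
    rewrite (RintD _ (intbleZ w _ (ci w)) (intbleZ (2 * s) _ (si w)))// in E.
    rewrite (RintZ w _ (ci w))// (RintZ (2 * s) _ (si w))// subrr in E.
    rewrite -/(P w) in E; apply: (mulfI (x := 2 * s)); first by rewrite gt_eqF ?mulr_gt0.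
    have -> : 2 * s * (- (w / (2 * s)) * P w) = - (w * P w) by field; rewrite gt_eqF.
    by apply/esym/eqP; rewrite -addr_eq0 addrC E.
  apply: (@derive_Rint R hl (fun w r => cos (r * w) * expR (- (r ^+ 2 * s)))
    (fun w r => - r * sin (r * w) * expR (- (r ^+ 2 * s))) (fun r => C * (1 + r ^+ 2)^-1) w 1) => //.
  - by move=> t _; apply: continuous_measurable_hl; exact: cos_gauss_cont.
  - by apply: intbleZ => //; exact: intble_oneDsqr.
  - by move=> t r _ _; apply: is_derive_eq; rewrite /GRing.scale /=; ring.
  - by move=> t r _ /in_hl r0; apply: B => //; exact: sinB.
(* The integrating factor turns the differential equation into Q' = 0. *)
pose Q w := P w * expR (w ^+ 2 / (4 * s)).
have dQ (w : R) : is_derive w 1 Q 0.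
  have h := dP w; rewrite /Q; apply: is_derive_eq; rewrite /GRing.scale /=.
  by field; rewrite gt_eqF.
have Q0 : Q z = Q 0.
  have H (a b : R) : a <= b -> Q b = Q a.
    move=> ab; apply/eqP; rewrite -subr_eq0 -normr_le0 -[leRHS](mul0r (b - a)).
    apply: (@lip_of_derive R Q (fun=> 0)) => //.
    by move=> x _; rewrite normr0.
  have [zz|zz] := leP 0 z; first exact: H.
  by rewrite (H z 0)// ltW.
have P0 : P 0 = pi * heatK 0 s.
  rewrite -Rint_gauss//; apply: eq_Rint => r _; by rewrite mulr0 cos0 mul1r.
have -> : \int[mu]_(r in hl) (cos (r * z) * expR (- (r ^+ 2 * s))) = Q z * expR (- (z ^+ 2 / (4 * s))).
  by rewrite /Q -mulrA -expRD subrr expR0 mulr1.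
rewrite Q0 /Q P0 /heatK expr0n/= !mul0r oppr0 !expR0 !mulr1 -!mulrA.
by congr (_ * (_ * (_ * expR _))); field; rewrite gt_eqF.
Unshelve. all: by end_near. Qed.

(* Rotation of the ray [r (1 + i sigma)], [0 <= sigma <= 1], in the integral of
   [exp (i lambda z - lambda^2 s)]; [rot_q] is the real part of
   [(1 + i sigma) exp (i r (1 + i sigma) z - r^2 (1 + i sigma)^2 s)], whose
   derivative in [sigma] is an exact derivative in [r]. *)
Definition rot_a (z s sigma r : R) : R := - (r * sigma * z) - r ^+ 2 * (1 - sigma ^+ 2) * s.
Definition rot_b (z s sigma r : R) : R := r * z - 2 * r ^+ 2 * sigma * s.
Definition rot_q (z s sigma r : R) : R :=
  expR (rot_a z s sigma r) * (cos (rot_b z s sigma r) - sigma * sin (rot_b z s sigma r)).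
Definition rot_p (z s sigma r : R) : R :=
  - (r * expR (rot_a z s sigma r) * sin (rot_b z s sigma r)).
Definition rot_dp (z s sigma r : R) : R :=
  expR (rot_a z s sigma r) * (- sin (rot_b z s sigma r) +
    r * (sigma * z + 2 * r * (1 - sigma ^+ 2) * s) * sin (rot_b z s sigma r) -
    r * (z - 4 * r * sigma * s) * cos (rot_b z s sigma r)).

Lemma is_derive_rot_q (z s sigma r : R) :
  is_derive sigma 1 (fun sigma => rot_q z s sigma r) (rot_dp z s sigma r).
Proof.
rewrite /rot_q /rot_dp /rot_a /rot_b; apply: is_derive_eq; rewrite /GRing.scale /=.
by move: (expR _) (sin _) (cos _) => e si co; ring.
Qed.

(** [rot_p] is the real part of i r F(r (1 + i sigma)) with F the exponential. For holomorphic F,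
    the sigma-derivative of (1 + i sigma) F(r (1 + i sigma)) equals the r-derivative of i r F(r (1 +
    i sigma)); this replaces Cauchy's theorem. *)
Lemma is_derive_rot_p (z s sigma r : R) :
  is_derive r 1 (rot_p z s sigma) (rot_dp z s sigma r).
Proof.
rewrite /rot_p /rot_dp /rot_a /rot_b; apply: is_derive_eq; rewrite /GRing.scale /=.
by move: (expR _) (sin _) (cos _) => e si co; ring.
Qed.

Lemma continuous_rot_q (z s sigma : R) : continuous (rot_q z s sigma).
Proof. by apply: derive_continuousT => r; rewrite /rot_q /rot_a /rot_b; apply: is_derive_eq. Qed.

Lemma continuous_rot_dp (z s sigma : R) : continuous (rot_dp z s sigma).
Proof. by apply: derive_continuousT => r; rewrite /rot_dp /rot_a /rot_b; apply: is_derive_eq. Qed.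

(** A crude majorant on a bounded r-interval, for differentiating under the integral sign. The range
    2 for sigma covers the unit neighbourhoods of the points of [0, 1]. *)
Lemma rot_dp_bound (z s A sigma r : R) : 0 < z -> 0 < s -> `|sigma| <= 2 -> 0 <= r <= A ->
  `|rot_dp z s sigma r| <= expR (2 * A * z + 5 * A ^+ 2 * s) *
    (1 + A * (2 * z + 10 * A * s) + A * (z + 8 * A * s)).
Proof.
move=> z0 s0 sg /andP[r0 rA]; have A0 : 0 <= A by apply: le_trans rA.
have /andP[sg1 sg2] : -2 <= sigma <= 2 by rewrite -ler_norml.
have sg3 : `|1 - sigma ^+ 2| <= 5 by rewrite ler_norml; apply/andP; split; nra.
have r2 : r ^+ 2 <= A ^+ 2 by exact: exprn_le.
rewrite /rot_dp normrM (ger0_norm (expR_ge0 _)).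
apply: ler_pM; rewrite ?expR_ge0//.
  rewrite ler_expR /rot_a; apply: lerD.
    apply: (le_trans (ler_norm _)); rewrite normrN !normrM (ger0_norm r0) (gtr0_norm z0).
    rewrite ler_wpM2r ?(ltW z0)// mulrC; apply: ler_pM => //.
  apply: (le_trans (ler_norm _)); rewrite normrN !normrM (gtr0_norm s0) ler_wpM2r ?(ltW s0)//.
  by rewrite ger0_norm ?sqr_ge0// mulrC; apply: ler_pM => //; exact: sqr_ge0.
apply: (le_trans (ler_normB _ _)); apply: lerD; last first.
  rewrite !normrM (ger0_norm r0) -[leRHS]mulr1; apply: ler_pM => //; last exact: cos_max.
    by rewrite mulr_ge0.
  apply: ler_pM => //; apply: (le_trans (ler_normB _ _)); rewrite (gtr0_norm z0) lerD2l.
  rewrite !normrM (gtr0_norm s0) (ger0_norm r0) ger0_norm// ler_wpM2r ?(ltW s0)//.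
  apply: (@le_trans _ _ (4 * r * 2)); first by rewrite ler_wpM2l// mulr_ge0.
  lra.
apply: (le_trans (ler_normD _ _)); apply: lerD; first by rewrite normrN sin_max.
rewrite !normrM (ger0_norm r0) -[leRHS]mulr1; apply: ler_pM => //; last exact: sin_max.
  by rewrite mulr_ge0.
apply: ler_pM => //; apply: (le_trans (ler_normD _ _)); apply: lerD.
  by rewrite normrM (gtr0_norm z0) ler_wpM2r// ltW.
rewrite !normrM (gtr0_norm s0) (ger0_norm r0) ger0_norm// ler_wpM2r ?(ltW s0)//.
apply: (@le_trans _ _ (2 * r * 5)); first by rewrite ler_wpM2l// mulr_ge0.
lra.
Qed.

(** The truncated integral over [0, A] has sigma-derivative [rot_p z s sigma A], the boundary term
    on the arc, since the term at r = 0 vanishes. It tends to 0 uniformly in sigma as A grows, so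
    the integrals for sigma = 0 and sigma = 1 agree. At sigma = 1 the Gaussian decay is lost and
    exp(-r z) takes over, whence the condition on z. *)
Lemma gauss_rotate (z s : R) : 0 < z -> 0 < s ->
  intble hl (rot_q z s 1) /\ \int[mu]_(r in hl) rot_q z s 1 r = pi * heatK z s.
Proof.
move=> z0 s0; have [iG <-] := gauss_cos z s0.
have [C C0 HC] := expR_poly_bound z0.
have i1 : intble hl (rot_q z s 1).
  apply: (intble_hl_dom (C := 2 * C)); first exact: continuous_rot_q.
  move=> r r0; rewrite /rot_q normrM (ger0_norm (expR_ge0 _)) /rot_a.
  have -> : - (r * 1 * z) - r ^+ 2 * (1 - 1 ^+ 2) * s = - (r * z) by ring.
  have h1 : `|cos (rot_b z s 1 r) - 1 * sin (rot_b z s 1 r)| <= 2.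
    by apply: (le_trans (ler_normB _ _)); rewrite mul1r; apply: lerD; [exact: cos_max|exact: sin_max].
  have h2 : expR (- (r * z)) <= C * (1 + r ^+ 2)^-1.
    by apply: le_trans (HC r (ltW r0)); rewrite ler_peMl ?expR_ge0// lerDl ltW.
  by rewrite -mulrA (mulrC 2); apply: ler_pM; rewrite ?expR_ge0.
split => //.
have i0 : intble hl (rot_q z s 0).
  apply: eq_intble iG => // r _; rewrite /rot_q /rot_a /rot_b.
  by rewrite !(mulr0, mul0r, expr0n, subr0, mulr1, oppr0, add0r) mulrC.
have -> : \int[mu]_(r in hl) (cos (r * z) * expR (- (r ^+ 2 * s))) = \int[mu]_(r in hl) rot_q z s 0 r.
  apply: eq_Rint => r _; rewrite /rot_q /rot_a /rot_b.
  by rewrite !(mulr0, mul0r, expr0n, subr0, mulr1, oppr0, add0r) mulrC.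
pose Q (A sigma : R) := \int[mu]_(r in `[0, A]) rot_q z s sigma r.
have iA (h : R -> R) A : continuous h -> intble `[0, A] h.
  move=> hc; apply: continuous_compact_integrable; first exact: segment_compact.
  exact: continuous_subspaceT.
have mA (h : R -> R) A : continuous h -> measurable_fun (`[0, A] : set R) h.
  by move=> hc; apply: measurable_funTS; exact: continuous_measurable_fun.
have dQ (A sigma : R) : 0 < A -> 0 <= sigma <= 1 -> is_derive sigma 1 (Q A) (rot_p z s sigma A).
  move=> A0 /andP[sg0 sg1].
  have -> : rot_p z s sigma A = \int[mu]_(r in `[0, A]) rot_dp z s sigma r.
    have [||_ ->] := @FTC2_segment R (rot_p z s sigma) (rot_dp z s sigma) 0 A A0.
    - by move=> r _; exact: is_derive_rot_p.
    - by move=> r _; exact: continuous_rot_dp.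
    by rewrite [X in _ - X](_ : _ = 0) ?subr0// /rot_p !mul0r oppr0.
  apply: (@derive_Rint R _ (rot_q z s) (rot_dp z s) (cst (expR (2 * A * z + 5 * A ^+ 2 * s) *
    (1 + A * (2 * z + 10 * A * s) + A * (z + 8 * A * s)))) sigma 1) => //.
  - by apply: iA; exact: continuous_rot_q.
  - by move=> t _; apply: mA; exact: continuous_rot_q.
  - by apply: iA => ?; exact: cvg_cst.
  - by move=> t r _ _; exact: is_derive_rot_q.
  - move=> t r; rewrite ltr_norml => /andP[t1 t2] /=; rewrite in_itv/= => rA.
    by apply: rot_dp_bound => //; rewrite ler_norml; apply/andP; split; lra.
have [C1 C10 HC1] := expR_poly_bound (c := z / 2) ltac:(by rewrite divr_gt0).
have [C2 C20 HC2] := gauss_poly_bound (s := 3 / 4 * s) ltac:(by rewrite mulr_gt0).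
have pB (A sigma : R) : 0 < A -> 0 <= sigma <= 1 -> `|rot_p z s sigma A| <= (C1 + C2) * (1 + A ^+ 2)^-1.
  move=> A0 /andP[sg0 sg1].
  have A2 : 0 <= A ^+ 2 by exact: sqr_ge0.
  have K0 : 0 <= (1 + A ^+ 2)^-1 by rewrite invr_ge0 addr_ge0.
  rewrite /rot_p normrN !normrM (gtr0_norm A0) (ger0_norm (expR_ge0 _)).
  apply: (@le_trans _ _ ((1 + A) * expR (rot_a z s sigma A))).
    rewrite -[leRHS]mulr1; apply: ler_pM => //; [by rewrite mulr_ge0 ?expR_ge0 ?ltW| |exact: sin_max].
    by rewrite ler_wpM2r ?expR_ge0// lerDr.
  have A1 : 0 <= 1 + A by rewrite addr_ge0// ltW.
  (* For sigma <= 1/2 the Gaussian factor decays at rate at least 3s/4; beyond 1/2 the exponential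
     factor decays at rate at least z/2. *)
  rewrite [leRHS]mulrDl; have [h|h] := leP sigma (1 / 2).
    apply: ler_wpDl; first by rewrite mulr_ge0.
    apply: le_trans (HC2 A (ltW A0)); rewrite ler_wpM2l// ler_expR /rot_a.
    have u1 : 0 <= A * sigma * z by rewrite !mulr_ge0// ltW.
    have u2 : 3 / 4 <= 1 - sigma ^+ 2 by nra.
    have u3 : A ^+ 2 * (3 / 4) * s <= A ^+ 2 * (1 - sigma ^+ 2) * s.
      by rewrite ler_wpM2r ?(ltW s0)// ler_wpM2l.
    rewrite mulrA; lra.
  apply: ler_wpDr; first by rewrite mulr_ge0.
  apply: le_trans (HC1 A (ltW A0)); rewrite ler_wpM2l// ler_expR /rot_a.
  have u1 : A * (z / 2) <= A * sigma * z.
    by rewrite -mulrA ler_wpM2l ?(ltW A0)// mulrC ler_wpM2r ?(ltW z0)//; lra.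
  have u2 : 0 <= A ^+ 2 * (1 - sigma ^+ 2) * s.
    by rewrite mulr_ge0 ?(ltW s0)// mulr_ge0//; nra.
  lra.
have H0 := Rint_cvg_pinfty i0; have H1 := Rint_cvg_pinfty i1.
have H2 : \int[mu]_(r in `[0, A]) rot_q z s 1 r @[A --> +oo] --> \int[mu]_(r in hl) rot_q z s 0 r.
  have D0 : Q A 1 - Q A 0 @[A --> +oo] --> 0.
    apply: (@cvg_dom _ _ _ _ _ (fun A => (C1 + C2) * A^-1)).
      near=> A; rewrite subr0.
      have A1 : 1 <= A by near: A; apply: nbhs_pinfty_ge; exact: num_real.
      have A0 : 0 < A by apply: lt_le_trans A1.
      apply: (@le_trans _ _ ((C1 + C2) * (1 + A ^+ 2)^-1 * (1 - 0))).
        apply: (@lip_of_derive R (Q A) (fun sigma => rot_p z s sigma A)) => //.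
          by move=> sigma sg; exact: dQ.
        by move=> sigma sg; exact: pB.
      rewrite subr0 mulr1 ler_wpM2l ?addr_ge0// lef_pV2 ?posrE//; last first.
        by rewrite ltr_pwDl// sqr_ge0.
      by nra.
    rewrite -[X in _ --> X](mulr0 (C1 + C2)); apply: cvgM; first exact: cvg_cst.
    apply/(@gtr0_cvgV0 R R +oo _ id); last exact: cvg_id.
    by near=> A; near: A; apply: nbhs_pinfty_gt; exact: num_real.
  have H3 : (Q A 1 - Q A 0) + Q A 0 @[A --> +oo] --> 0 + \int[mu]_(r in hl) rot_q z s 0 r.
    by apply: cvgD.
  rewrite add0r in H3; apply: cvg_trans H3; apply: near_eq_cvg; near=> A.
  by rewrite subrK.
exact: (cvg_unique _ H1 H2).
Unshelve. all: by end_near. Qed.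
End gauss.

(** * Fubini's theorem for real-valued integrals *)

Section fubini.
Context {R : realType}.
Notation mu := (@lebesgue_measure R).
Notation hl := (`]0, +oo[%classic : set R).

(** Rounding x down to the grid of step 1/(n+1) gives functions whose preimages are countable unions
    of measurable rectangles, and continuity in x makes them converge pointwise to F. *)
Lemma measurable_caratheodory (F : R -> R -> R) : (forall y, continuous (F ^~ y)) ->
  (forall x, measurable_fun (setT : set R) (F x)) ->
  measurable_fun (setT : set (R * R)) (fun p => F p.1 p.2).
Proof.
move=> Fc Fm.
pose rd (n : nat) (k : int) : R := k%:~R / n.+1%:R.
pose fl (n : nat) (x : R) : int := Num.floor (x * n.+1%:R).
have flP n x : rd n (fl n x) <= x < rd n (fl n x + 1).
  rewrite /rd /fl; have n0 : (0 : R) < n.+1%:R by [].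
  rewrite ler_pdivrMr// ltr_pdivlMr//; exact: Num.Theory.floor_itv.
have rdD n k : rd n (k + 1) = rd n k + n.+1%:R^-1 by rewrite /rd intrD mulrDl mul1r.
apply: (@measurable_fun_cvg _ _ _ setT (fun n p => F (rd n (fl n p.1)) p.2)); last first.
  move=> [x y] _ /=.
  have H : rd n (fl n x) @[n --> \oo] --> x.
    apply/cvgrPdist_lt => e e0; near=> n.
    have /andP[h1 h2] := flP n x; rewrite rdD in h2.
    have h3 : n.+1%:R^-1 < e by near: n; exact: near_invS.
    by rewrite ger0_norm ?subr_ge0// ltrBlDr (lt_trans h2)// addrC ltrD2r.
  exact: (cvg_comp _ (F ^~ y) H (Fc y x)).
move=> n _ Y mY; rewrite setTI.
rewrite (_ : _ @^-1` Y = \bigcup_(k : int) (`[rd n k, rd n (k + 1)[ `*` (F (rd n k) @^-1` Y))).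
  apply: countable_bigcupT_measurable; first exact: countableP.
  move=> k; apply: measurableX; first exact: measurable_itv.
  by rewrite -[X in measurable X]setTI; exact: Fm.
apply/seteqP; split=> [[x y] /= FY|[x y] [k _ [/=]]].
  by exists (fl n x) => //; split => //=; rewrite in_itv/=; exact: flP.
rewrite in_itv/= => kx FY.
suff -> : fl n x = k by [].
have n0 : (0 : R) < n.+1%:R by [].
move: kx; rewrite /rd ler_pdivrMr// ltr_pdivlMr// => kx.
by apply/eqP; rewrite /fl floor_eq.
Unshelve. all: by end_near. Qed.

(** Tonelli applied to the extension of F by 0, with [c] dominating the inner integrals of absolute
    values. Integrability of every section, instead of almost every one, makes the real-valued inner
    integrals agree with the extended ones everywhere. *)
Lemma Rint_fubini (D1 D2 : set R) (F : R -> R -> R) (c : R -> R) :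
  measurable D1 -> measurable D2 ->
  measurable_fun (setT : set (R * R)) (fun p => F p.1 p.2) ->
  (forall x, D1 x -> intble D2 (F x)) ->
  (forall x, D1 x -> \int[mu]_(y in D2) `|F x y| <= c x) -> intble D1 c ->
  (forall y, D2 y -> intble D1 (F ^~ y)) ->
  [/\ intble D1 (fun x => \int[mu]_(y in D2) F x y),
      intble D2 (fun y => \int[mu]_(x in D1) F x y) &
      \int[mu]_(x in D1) (\int[mu]_(y in D2) F x y) =
      \int[mu]_(y in D2) (\int[mu]_(x in D1) F x y)].
Proof.
move=> mD1 mD2 mF i1 Fc ic i2.
pose G : R * R -> R := (fun p => F p.1 p.2) \_ (D1 `*` D2).
have GE x y : G (x, y) = if x \in D1 then (F x \_ D2) y else 0.
  rewrite /G /patch /=; case: (boolP (x \in D1)) => xD; case: (boolP (y \in D2)) => yD.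
  - by rewrite ifT//; apply/mem_set; split; exact/set_mem.
  - by rewrite ifF//; apply/negbTE/negP => /set_mem[_ /mem_set]; exact/negP.
  - by rewrite ifF//; apply/negbTE/negP => /set_mem[/mem_set h _]; move/negP: xD.
  - by rewrite ifF//; apply/negbTE/negP => /set_mem[/mem_set h _]; move/negP: xD.
have GE2 x y : G (x, y) = if y \in D2 then ((F ^~ y) \_ D1) x else 0.
  by rewrite GE /patch; case: ifP; case: ifP.
have mG : measurable_fun (setT : set (R * R)) G.
  apply/(measurable_restrict (fun p => F p.1 p.2)) => //; first exact: measurableX.
  by rewrite setTI; apply: measurable_funTS.
have I1 x : (\int[mu]_y (G (x, y))%:E = (((fun x => \int[mu]_(y in D2) F x y) \_ D1) x)%:E)%E.
  rewrite patchE; case: ifPn => xD.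
    under eq_integral do rewrite GE xD.
    rewrite -[RHS]/((Rintegral _ _ _)%:E) /Rintegral fineK; last first.
      by apply: integrable_fin_num => //; apply: i1; exact: set_mem.
    by rewrite [RHS]integral_mkcond; apply: eq_integral => y _; rewrite restrict_EFin.
  by rewrite integral0_eq// => y _; rewrite GE (negbTE xD).
have I2 y : (\int[mu]_x (G (x, y))%:E = (((fun y => \int[mu]_(x in D1) F x y) \_ D2) y)%:E)%E.
  rewrite patchE; case: ifPn => yD.
    under eq_integral do rewrite GE2 yD.
    rewrite -[RHS]/((Rintegral _ _ _)%:E) /Rintegral fineK; last first.
      by apply: integrable_fin_num => //; apply: i2; exact: set_mem.
    by rewrite [RHS]integral_mkcond; apply: eq_integral => x _; rewrite restrict_EFin.
  by rewrite integral0_eq// => x _; rewrite GE2 (negbTE yD).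
have I3 x : (\int[mu]_y `|(G (x, y))%:E| = (((fun x => \int[mu]_(y in D2) `|F x y|) \_ D1) x)%:E)%E.
  rewrite patchE; case: ifPn => xD.
    under eq_integral do rewrite GE xD.
    rewrite -[RHS]/((Rintegral _ _ _)%:E) /Rintegral fineK; last first.
      by apply: integrable_fin_num => //; apply: intble_norm; apply: i1; exact: set_mem.
    rewrite [RHS]integral_mkcond; apply: eq_integral => y _.
    by rewrite restrict_EFin /patch/=; case: ifP => //; rewrite normr0.
  by rewrite integral0_eq// => y _; rewrite GE (negbTE xD) abse0.
have iG : (mu \x mu)%E.-integrable setT (EFin \o G).
  apply/integrable12ltyP; first exact/measurable_EFinP.
  under eq_integral do rewrite /= I3.
  have ic' : mu.-integrable setT (EFin \o (c \_ D1)).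
    by have := (@integrable_mkcond _ _ _ mu D1 (EFin \o c) mD1).1 ic; rewrite restrict_EFin.
  apply: (@le_lt_trans _ _ (\int[mu]_x ((c \_ D1) x)%:E)%E).
    apply: ge0_le_integral => //.
    - by move=> x _; rewrite lee_fin patchE; case: ifP => // _; exact: Rintegral_ge0.
    - have mA : measurable_fun (setT : set (R * R)) (abse \o (EFin \o G)).
        by apply: measurableT_comp => //; exact/measurable_EFinP.
      have := @measurable_fun_fubini_tonelli_F _ _ _ _ _ mu _ mA (fun x => abse_ge0 _).
      by rewrite /fubini_F; under eq_fun do rewrite /= I3.
    - exact: (measurable_int mu ic').
    - move=> x _; rewrite lee_fin !patchE; case: ifPn => // xD.
      by apply: Fc; exact: set_mem.
  have := integrable_fin_num measurableT ic'; rewrite fin_numE => /andP[_ h].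
  by rewrite ltey.
have J1 : intble D1 (fun x => \int[mu]_(y in D2) F x y).
  apply/(@integrable_mkcond _ _ _ mu D1 _ mD1); rewrite restrict_EFin.
  have := integrable_fubini_F iG; rewrite /fubini_F.
  by under eq_fun do rewrite /= I1.
have J2 : intble D2 (fun y => \int[mu]_(x in D1) F x y).
  apply/(@integrable_mkcond _ _ _ mu D2 _ mD2); rewrite restrict_EFin.
  have mA : measurable_fun (setT : set (R * R)) (abse \o (EFin \o G)).
    by apply: measurableT_comp => //; exact/measurable_EFinP.
  have mH := measurable_fubini_G iG.
  have : mu.-integrable setT (fubini_G mu (EFin \o G)).
    apply/integrableP; split; first exact: mH.
    have iG' : (\int[mu]_y \int[mu]_x `|(EFin \o G) (x, y)| < +oo)%E.
      by apply/integrable21ltyP => //; exact/measurable_EFinP.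
    apply: le_lt_trans iG'; apply: ge0_le_integral => //.
    - exact: measurableT_comp mH.
    - exact: (@measurable_fun_fubini_tonelli_G _ _ _ _ _ mu _ mA (fun x => abse_ge0 _)).
    - move=> y _; apply: le_abse_integral => //; apply/measurable_EFinP.
      under eq_fun do rewrite GE2; case: (boolP (y \in D2)) => yD; last exact: measurable_cst.
      apply/(measurable_restrict (F ^~ y)) => //; rewrite setTI; apply: intble_meas.
      by apply: i2; exact: set_mem.
  by rewrite /fubini_G; under eq_fun do rewrite /= I2.
split; [exact: J1|exact: J2|].
have := Fubini iG; under eq_integral do rewrite /= I1.
under [X in _ = X -> _]eq_integral do rewrite /= I2.
move=> E; rewrite [LHS]Rintegral_mkcond [RHS]Rintegral_mkcond /Rintegral.
exact: (congr1 fine E).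
Qed.
End fubini.

(** * Complex-valued integrals *)

Local Open Scope complex_scope.
Local Notation re := (@complex.Re _).
Local Notation im := (@complex.Im _).

Section complex_integral.
Context {R : realType}.
Notation mu := (@lebesgue_measure R).
Notation hl := (`]0, +oo[%classic : set R).
Implicit Types (z w : R[i]) (h k : R -> R[i]) (D : set R).

Lemma reM z w : re (z * w) = re z * re w - im z * im w.
Proof. by case: z => a b; case: w => c d. Qed.

Lemma imM z w : im (z * w) = re z * im w + im z * re w.
Proof. by case: z => a b; case: w => c d. Qed.

Lemma reD z w : re (z + w) = re z + re w.
Proof. by case: z => a b; case: w => c d. Qed.

Lemma imD z w : im (z + w) = im z + im w.
Proof. by case: z => a b; case: w => c d. Qed.

Lemma reN z : re (- z) = - re z.
Proof. by case: z. Qed.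

Lemma imN z : im (- z) = - im z.
Proof. by case: z. Qed.

Lemma complex_eq z w : re z = re w -> im z = im w -> z = w.
Proof. by case: z => a b; case: w => c d /= -> ->. Qed.

Lemma normc_re z : `|re z| <= normc z.
Proof. by case: z => a b /=; rewrite -sqrtr_sqr ler_wsqrtr// lerDl sqr_ge0. Qed.

Lemma normc_im z : `|im z| <= normc z.
Proof. by case: z => a b /=; rewrite -sqrtr_sqr ler_wsqrtr// lerDr sqr_ge0. Qed.

Lemma normc_ge0 z : 0 <= normc z.
Proof. by case: z => a b /=; exact: sqrtr_ge0. Qed.

Lemma normc_le z (a : R) : `|re z| <= a -> `|im z| <= a -> normc z <= 2 * a.
Proof.
move=> h1 h2; have a0 : 0 <= a by apply: le_trans h1.
have -> : 2 * a = Num.sqrt ((2 * a) ^+ 2) by rewrite sqrtr_sqr ger0_norm ?mulr_ge0.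
case: z h1 h2 => x y /= h1 h2; apply: ler_wsqrtr.
have : x ^+ 2 <= a ^+ 2 by rewrite -(real_normK (num_real x)) exprn_le.
have : y ^+ 2 <= a ^+ 2 by rewrite -(real_normK (num_real y)) exprn_le.
have := sqr_ge0 a; rewrite exprMn; lra.
Qed.

Lemma normcM z w : normc (z * w) = normc z * normc w.
Proof. exact: ComplexField.Normc.normcM. Qed.

Lemma re_cexp z : re (cexp z) = expR (re z) * cos (im z).
Proof. by rewrite /cexp reM /= mul0r subr0. Qed.

Lemma im_cexp z : im (cexp z) = expR (re z) * sin (im z).
Proof. by rewrite /cexp imM /= mul0r addr0. Qed.

Lemma cexpD z w : cexp (z + w) = cexp z * cexp w.
Proof.
apply: complex_eq.
  by rewrite re_cexp [in RHS]reM !re_cexp !im_cexp reD imD expRD cosD; ring.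
by rewrite im_cexp [in RHS]imM !re_cexp !im_cexp reD imD expRD sinD; ring.
Qed.

Lemma normc_cexp z : normc (cexp z) = expR (re z).
Proof.
have E := re_cexp z; have F := im_cexp z.
case: (cexp z) E F => a b /= -> ->.
rewrite !exprMn -mulrDr cos2Dsin2 mulr1 sqrtr_sqr ger0_norm//; exact: expR_ge0.
Qed.

Definition cintble D h := intble D (fun x => re (h x)) /\ intble D (fun x => im (h x)).
Definition cmeas D h := measurable_fun D (fun x => re (h x)) /\ measurable_fun D (fun x => im (h x)).
Definition ccont_at (x : R) h :=
  {for x, continuous (fun x => re (h x))} /\ {for x, continuous (fun x => im (h x))}.

Lemma cmeas_cont D h : open D -> (forall x, D x -> ccont_at x h) -> cmeas D h.
Proof.
by move=> oD hc; split; apply: open_continuous_measurable_fun => // x /set_mem Dx;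
  have [] := hc x Dx.
Qed.

Lemma cmeasM D h k : cmeas D h -> cmeas D k -> cmeas D (fun x => h x * k x).
Proof.
move=> [h1 h2] [k1 k2]; split.
  by under eq_fun do rewrite reM; apply: measurable_funB; apply: measurable_funM.
by under eq_fun do rewrite imM; apply: measurable_funD; apply: measurable_funM.
Qed.

Lemma ccont_atM (x : R) h k : ccont_at x h -> ccont_at x k -> ccont_at x (fun x => h x * k x).
Proof.
move=> [h1 h2] [k1 k2]; split.
  rewrite (_ : (fun x => re (h x * k x)) = (fun x => re (h x) * re (k x) - im (h x) * im (k x))).
    by apply: cvgB; apply: cvgM.
  by apply/funext => y; rewrite reM.
rewrite (_ : (fun x => im (h x * k x)) = (fun x => re (h x) * im (k x) + im (h x) * re (k x))).
  by apply: cvgD; apply: cvgM.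
by apply/funext => y; rewrite imM.
Qed.

Lemma ccont_at_cst (x : R) z : ccont_at x (fun=> z).
Proof. by split; exact: cvg_cst. Qed.

Lemma ccont_at_cexp (x : R) h : ccont_at x h -> ccont_at x (fun x => cexp (h x)).
Proof.
move=> [h1 h2].
have cc (F G : R -> R) : continuous F -> {for x, continuous G} -> {for x, continuous (fun y => F (G y))}.
  by move=> cF cG; apply: (@continuous_comp _ _ _ G F x cG); exact: cF.
split.
  rewrite (_ : (fun x => re (cexp (h x))) = (fun x => expR (re (h x)) * cos (im (h x)))).
    by apply: cvgM; apply: cc => //; [exact: continuous_expR|exact: continuous_cos].
  by apply/funext => y; rewrite re_cexp.
rewrite (_ : (fun x => im (cexp (h x))) = (fun x => expR (re (h x)) * sin (im (h x)))).
  by apply: cvgM; apply: cc => //; [exact: continuous_expR|exact: continuous_sin].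
by apply/funext => y; rewrite im_cexp.
Qed.

Lemma cint_dom D h (m : R -> R) : measurable D -> cmeas D h -> intble D m ->
  (forall x, D x -> normc (h x) <= m x) -> cintble D h.
Proof.
move=> mD [h1 h2] im hm; split; apply: (intble_dom mD _ im) => // x Dx;
  apply: le_trans (hm x Dx); [exact: normc_re|exact: normc_im].
Qed.

(** Real and imaginary parts are bounded separately, which costs the factor 2. *)
Lemma cint_norm D h (m : R -> R) (c : R) : measurable D -> cmeas D h -> intble D m ->
  (forall x, D x -> normc (h x) <= m x) -> \int[mu]_(x in D) m x <= c ->
  normc (cintegral D h) <= 2 * c.
Proof.
move=> mD [h1 h2] im hm mc; apply: normc_le; apply: le_trans mc; apply: Rint_dom => // x Dx;
  apply: le_trans (hm x Dx); [exact: normc_re|exact: normc_im].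
Qed.

Lemma eq_cint D h k : (forall x, D x -> h x = k x) -> cintegral D h = cintegral D k.
Proof. by move=> hk; congr Complex; apply: eq_Rint => x Dx; rewrite hk. Qed.

Lemma eq_cintble D h k : measurable D -> (forall x, D x -> h x = k x) -> cintble D h -> cintble D k.
Proof.
by move=> mD hk [h1 h2]; split; [apply: eq_intble h1|apply: eq_intble h2] => // x Dx; rewrite hk.
Qed.

Lemma cintZ D h z : measurable D -> cintble D h ->
  cintble D (fun x => z * h x) /\ cintegral D (fun x => z * h x) = z * cintegral D h.
Proof.
move=> mD [h1 h2]; split.
  split; [under eq_fun do rewrite reM|under eq_fun do rewrite imM].
    by apply: intbleB => //; exact: intbleZ.
  by apply: intbleD => //; exact: intbleZ.
apply: complex_eq; rewrite /cintegral /= ?reM ?imM /=.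
  rewrite (eq_Rint (g := fun x => re z * re (h x) - im z * im (h x))); last by move=> x _; rewrite reM.
  by rewrite RintB// ?RintZ//; exact: intbleZ.
rewrite (eq_Rint (g := fun x => re z * im (h x) + im z * re (h x))); last by move=> x _; rewrite imM.
by rewrite RintD// ?RintZ//; exact: intbleZ.
Qed.

Lemma cintB D h k : measurable D -> cintble D h -> cintble D k ->
  cintegral D (fun x => h x - k x) = cintegral D h - cintegral D k.
Proof.
move=> mD [h1 h2] [k1 k2]; apply: complex_eq; rewrite /cintegral ?(reD, imD, reN, imN) /=.
  rewrite (eq_Rint (g := fun x => re (h x) - re (k x))) ?RintB// => x _.
  by rewrite reD reN.
rewrite (eq_Rint (g := fun x => im (h x) - im (k x))) ?RintB// => x _.
by rewrite imD imN.
Qed.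

Lemma cint_closed (b : itv_bound R) h : cintble [set` Interval (BRight 0) b] h ->
  cintegral [set` Interval (BRight 0) b] h = cintegral [set` Interval (BLeft 0) b] h.
Proof. by move=> [h1 h2]; congr Complex; exact: Rintegral_itv_obnd_cbnd. Qed.

Lemma cint_closed2 (t : R) h : cmeas `]0, t[ h -> cintegral `]0, t[ h = cintegral `[0, t] h.
Proof.
move=> [h1 h2]; congr Complex; rewrite /Rintegral; congr fine; symmetry;
  by apply: (@integral_itv_bndoo _ 0 t _ true false); apply/measurable_EFinP.
Qed.

(** Continuity in x and measurability in y are asked on the whole plane, where they imply joint
    measurability, but the domination only on D1 x D2. Integrands are therefore first extended
    suitably outside their domain. *)
Lemma cfubini (D1 D2 : set R) (H : R -> R -> R[i]) (m : R -> R -> R) (c : R -> R) :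
  measurable D1 -> measurable D2 ->
  (forall y x, ccont_at x (H ^~ y)) -> (forall x, cmeas setT (H x)) ->
  (forall x y, D1 x -> D2 y -> normc (H x y) <= m x y) ->
  (forall x, D1 x -> intble D2 (m x)) -> (forall y, D2 y -> intble D1 (m ^~ y)) ->
  (forall x, D1 x -> \int[mu]_(y in D2) m x y <= c x) -> intble D1 c ->
  [/\ cintble D1 (fun x => cintegral D2 (H x)),
      cintble D2 (fun y => cintegral D1 (H ^~ y)) &
      cintegral D1 (fun x => cintegral D2 (H x)) = cintegral D2 (fun y => cintegral D1 (H ^~ y))].
Proof.
move=> mD1 mD2 Hc Hm Hb m1 m2 mc ic.
have F (f : R[i] -> R) : (forall z, `|f z| <= normc z) ->
    (forall y x, {for x, continuous (fun x => f (H x y))}) ->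
    (forall x, measurable_fun setT (fun y => f (H x y))) ->
  [/\ intble D1 (fun x => \int[mu]_(y in D2) f (H x y)),
      intble D2 (fun y => \int[mu]_(x in D1) f (H x y)) &
      \int[mu]_(x in D1) (\int[mu]_(y in D2) f (H x y)) =
      \int[mu]_(y in D2) (\int[mu]_(x in D1) f (H x y))].
  move=> fn fc fm.
  have B x y : D1 x -> D2 y -> `|f (H x y)| <= m x y.
    by move=> h1 h2; apply: le_trans (Hb x y h1 h2).
  have i1 x : D1 x -> intble D2 (fun y => f (H x y)).
    move=> Dx; apply: (intble_dom mD2 _ (m1 x Dx)); first exact: measurable_funTS.
    by move=> y Dy; exact: B.
  apply: (Rint_fubini (c := c)) => //.
  - by by apply: (@measurable_caratheodory _ (fun x y => f (H x y))).
  - move=> x Dx; apply: le_trans (mc x Dx); apply: le_Rint => //; last by move=> y Dy; exact: B.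
      exact/intble_norm/i1.
    exact: m1.
  - move=> y Dy; apply: (intble_dom mD1 _ (m2 y Dy)); last by move=> x Dx; exact: B.
    apply: measurable_funTS; apply: continuous_measurable_fun => x; exact: fc.
have [a1 a2 a3] := F re (@normc_re) (fun y x => (Hc y x).1) (fun x => (Hm x).1).
have [b1 b2 b3] := F im (@normc_im) (fun y x => (Hc y x).2) (fun x => (Hm x).2).
by split; [exact: (conj a1 b1)|exact: (conj a2 b2)|apply: complex_eq; [exact: a3|exact: b3]].
Qed.

Lemma ccont_at_cint D (H : R -> R -> R[i]) (g : R -> R) (x0 : R) : measurable D ->
  (\forall x \near x0, cmeas D (H x)) ->
  (\forall x \near x0, forall y, D y -> normc (H x y) <= g y) -> intble D g ->
  (forall y, D y -> ccont_at x0 (H ^~ y)) -> ccont_at x0 (fun x => cintegral D (H x)).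
Proof.
move=> mD Hm Hg ig Hc; split.
  apply: (@Rint_dct _ _ _ D (fun x y => re (H x y)) _ g) => //.
  - exact: seqfilter_nbhs.
  - by apply: filterS Hm => x [].
  - by apply: filterS Hg => x h y Dy; apply: le_trans (h y Dy); exact: normc_re.
  - by move=> y Dy; have [] := Hc y Dy.
apply: (@Rint_dct _ _ _ D (fun x y => im (H x y)) _ g) => //.
- exact: seqfilter_nbhs.
- by apply: filterS Hm => x [].
- by apply: filterS Hg => x h y Dy; apply: le_trans (h y Dy); exact: normc_im.
- by move=> y Dy; have [] := Hc y Dy.
Qed.

Lemma ray_integralE (d : R[i]) (F : R[i] -> R[i]) : cintble hl (fun r => F (r%:C * d)) ->
  ray_integral d F = d * cintegral hl (fun r => F (r%:C * d)).
Proof.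
move=> [h1 h2]; rewrite /ray_integral; congr (_ * _); apply: complex_eq; rewrite /clim /=.
  by apply: cvg_lim => //; exact: Rint_cvg_pinfty.
by apply: cvg_lim => //; exact: Rint_cvg_pinfty.
Qed.
End complex_integral.

(** * The contour integrals *)

Section fokas_kernel.
Context {R : realType}.
Notation mu := (@lebesgue_measure R).
Notation hl := (`]0, +oo[%classic : set R).
Implicit Types (p q sg x y z s t r : R).

(* With [d = p +i* q], [ker p q z s r] is
   [exp(i (r d) z - (r d)^2 s)], split into modulus and phase. *)
Definition ker_re p q z s r : R := - (r * q * z) - r ^+ 2 * (p ^+ 2 - q ^+ 2) * s.
Definition ker_im p q z s r : R := r * p * z - 2 * r ^+ 2 * p * q * s.
Definition ker p q z s r : R[i] := cexp (ker_re p q z s r +i* ker_im p q z s r).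

(* Directions [d] and signs [sg] such that [d] bounds the contour on which
   [sg * lambda] enters the half-line Fourier transforms. *)
Definition adm p q sg : Prop :=
  [/\ q = 0, p ^+ 2 = 1 & sg = 1] \/ [/\ 0 < q, p ^+ 2 = q ^+ 2 & sg = - 1].

Lemma normc_ker p q z s r : normc (ker p q z s r) = expR (ker_re p q z s r).
Proof. by rewrite normc_cexp. Qed.

Lemma continuous_ker_re p q (z s r : R -> R) (v : R) : {for v, continuous z} ->
  {for v, continuous s} -> {for v, continuous r} ->
  {for v, continuous (fun v => ker_re p q (z v) (s v) (r v))}.
Proof.
move=> cz cs cr.
apply: cvgB; first by apply: cvgN; apply: cvgM => //; apply: cvgM => //; exact: cvg_cst.
by apply: cvgM => //; apply: cvgM; [apply: cvgM|exact: cvg_cst].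
Qed.

Lemma continuous_expR_ker_re p q (z s : R) : continuous (fun r => expR (ker_re p q z s r)).
Proof.
move=> r; apply: (@continuous_comp _ _ _ (ker_re p q z s) expR r); last exact: continuous_expR.
have := @continuous_ker_re p q (fun=> z) (fun=> s) (fun r => r) r.
by apply; [exact: cvg_cst..|exact: cvg_id].
Qed.

Lemma ccont_at_ker p q (z s r : R -> R) (v : R) : {for v, continuous z} ->
  {for v, continuous s} -> {for v, continuous r} ->
  ccont_at v (fun v => ker p q (z v) (s v) (r v)).
Proof.
move=> cz cs cr; apply: ccont_at_cexp; split => /=; first exact: continuous_ker_re.
apply: cvgB; first by apply: cvgM => //; apply: cvgM => //; exact: cvg_cst.
apply: cvgM => //; apply: cvgM; last exact: cvg_cst.
apply: cvgM; last exact: cvg_cst.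
by apply: cvgM; [exact: cvg_cst|apply: cvgM].
Qed.

(** The Fourier factor never increases the modulus: on the real line it has modulus 1, and on gamma,
    where the transform is taken at -lambda, it adds y > 0 to x. *)
Lemma ker_re_mono p q sg x y s r : adm p q sg -> 0 <= r -> 0 <= y ->
  ker_re p q (x - sg * y) s r <= ker_re p q x s r.
Proof.
move=> [[-> _ ->]|[q0 _ ->]] r0 y0; rewrite /ker_re lerD2r lerN2.
  by rewrite !mulr0 !mul0r.
by apply: ler_wpM2l; [rewrite mulr_ge0// ltW|rewrite mulN1r opprK lerDl].
Qed.

Lemma ker_re_le0 p q sg x s r : adm p q sg -> 0 <= r -> 0 <= x -> 0 <= s ->
  expR (ker_re p q x s r) <= 1.
Proof.
move=> [[-> p1 _]|[q0 pq _]] r0 x0 s0; rewrite -expR0 ler_expR /ker_re.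
  rewrite p1 mulr0 mul0r expr0n /= subr0 mulr1 oppr0 sub0r oppr_le0.
  by rewrite mulr_ge0// sqr_ge0.
by rewrite pq subrr mulr0 mul0r subr0 oppr_le0 !mulr_ge0// ltW.
Qed.

(** Two mechanisms: a Gaussian in r on the real line; on gamma, where p^2 = q^2 removes the
    Gaussian, the exponential exp(-r q x). *)
Lemma ker_decay p q sg x s : adm p q sg -> 0 < x -> 0 < s -> exists2 C, 0 <= C &
  forall r, 0 <= r -> (1 + r) * expR (ker_re p q x s r) <= C * (1 + r ^+ 2)^-1.
Proof.
move=> [[-> p1 _]|[q0 pq _]] x0 s0; rewrite /ker_re.
  have [C C0 h] := gauss_poly_bound s0; exists C => // r r0.
  by rewrite p1 mulr0 mul0r expr0n /= subr0 mulr1 oppr0 sub0r; exact: h.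
have [C C0 h] := expR_poly_bound (mulr_gt0 q0 x0); exists C => // r r0.
by rewrite pq subrr mulr0 mul0r subr0 -mulrA; exact: h.
Qed.

(** After multiplication by 1 + a, the integrand is at most 1 + a exp(-(t - tau) a), whose integral
    is t + 1 - exp(-t a). Applied with a = r^2, it supplies the decay in r on the real line, where
    the integrand at tau = t has none. *)
Lemma Rint_expR_shift (t a : R) : 0 < t -> 0 <= a ->
  intble `]0, t[ (fun tau => expR (- ((t - tau) * a))) /\
  \int[mu]_(tau in `]0, t[) expR (- ((t - tau) * a)) <= (1 + t) * (1 + a)^-1.
Proof.
move=> t0 a0.
have d1 (s : R) : is_derive s 1 (fun tau : R => expR (- ((t - tau) * a)))
    (a * expR (- ((t - s) * a))).
  apply: is_derive_eq; rewrite /GRing.scale /=.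
  by move: (expR _) => e; ring.
have d2 (s : R) : is_derive s 1 (fun tau : R => tau + expR (- ((t - tau) * a)))
    (1 + a * expR (- ((t - s) * a))) by apply: is_deriveD.
have ce : continuous (fun tau : R => expR (- ((t - tau) * a))) by exact: derive_continuousT d1.
have mt : measurable (`]0, t[%classic : set R) by [].
have I1 : intble `]0, t[ (fun tau => expR (- ((t - tau) * a))).
  apply: (@intble_bounded _ _ _ 0 t 1) => //.
  - by move=> s /=; rewrite !in_itv /= => /andP[h1 h2]; rewrite !ltW.
  - by apply: measurable_funTS; apply: continuous_measurable_fun => s; exact: ce.
  move=> s /in0t /andP[h1 h2]; rewrite ger0_norm ?expR_ge0//.
  by rewrite -expR0 ler_expR oppr_le0 mulr_ge0// subr_ge0 ltW.
split => //.
have I2 : intble `]0, t[ (fun tau => 1 + a * expR (- ((t - tau) * a))).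
  apply: intbleD => //; last exact: intbleZ.
  apply: (@intble_bounded _ _ _ 0 t 1) => //; last by move=> s _; rewrite normr1.
  by move=> s /=; rewrite !in_itv /= => /andP[h1 h2]; rewrite !ltW.
have E : \int[mu]_(tau in `]0, t[) (1 + a * expR (- ((t - tau) * a))) =
    (t + expR (- ((t - t) * a))) - (0 + expR (- ((t - 0) * a))).
  apply: (@FTC2_0t _ (fun tau : R => tau + expR (- ((t - tau) * a)))) => //.
  - by move=> s _; apply: cvgD; [exact: cvg_cst|apply: cvgM; [exact: cvg_cst|exact: ce]].
  - by apply: cvg_at_right_filter; exact: (derive_continuousT d2).
  - by apply: cvg_at_left_filter; exact: (derive_continuousT d2).
rewrite -(ler_pM2r (_ : 0 < 1 + a)) ?ltr_pwDl// -mulrA mulVf ?mulr1; last first.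
  by rewrite gt_eqF// ltr_pwDl.
rewrite mulrC -RintZ//; apply: (@le_trans _ _ (\int[mu]_(tau in `]0, t[) (1 + a * expR (- ((t - tau) * a))))).
  apply: le_Rint => //; first exact: intbleZ.
  move=> s /in0t /andP[h1 h2]; rewrite mulrDl mul1r lerD2r -expR0 ler_expR.
  by rewrite oppr_le0 mulr_ge0// subr_ge0 ltW.
rewrite E subrr mul0r oppr0 expR0 add0r.
by rewrite (addrC 1 t) gerBl expR_ge0.
Qed.

(** On the real line the decay in r appears only after integration in tau; on gamma it is already
    present for each tau through exp(-r q x). *)
Lemma ker_time_bound p q sg x t : adm p q sg -> 0 < x -> 0 < t -> exists2 C, 0 <= C &
  forall r, 0 <= r -> intble `]0, t[ (fun tau => expR (ker_re p q x (t - tau) r)) /\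
    \int[mu]_(tau in `]0, t[) expR (ker_re p q x (t - tau) r) <= C * (1 + r ^+ 2)^-1.
Proof.
move=> A x0 t0.
have E r tau : expR (ker_re p q x (t - tau) r) =
    expR (- (r * q * x)) * expR (- ((t - tau) * (r ^+ 2 * (p ^+ 2 - q ^+ 2)))).
  by rewrite -expRD /ker_re; congr expR; ring.
have a0 r : 0 <= r ^+ 2 * (p ^+ 2 - q ^+ 2).
  by case: A => [[-> -> _]|[_ -> _]]; rewrite ?subrr ?mulr0// expr0n /= subr0 mulr1 sqr_ge0.
have F r : intble `]0, t[ (fun tau => expR (ker_re p q x (t - tau) r)) /\
    \int[mu]_(tau in `]0, t[) expR (ker_re p q x (t - tau) r) <=
    expR (- (r * q * x)) * ((1 + t) * (1 + r ^+ 2 * (p ^+ 2 - q ^+ 2))^-1).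
  have [I J] := Rint_expR_shift t0 (a0 r); split.
    by apply: (@eq_intble _ _ (fun tau => expR (- (r * q * x)) *
      expR (- ((t - tau) * (r ^+ 2 * (p ^+ 2 - q ^+ 2))))) _ _ _ (intbleZ _ _ I)).
  rewrite (eq_Rint (g := fun tau => expR (- (r * q * x)) *
      expR (- ((t - tau) * (r ^+ 2 * (p ^+ 2 - q ^+ 2)))))) // RintZ//.
  by apply: ler_wpM2l => //; exact: expR_ge0.
have t1 : 0 <= 1 + t by rewrite addr_ge0// ltW.
case: A F => [[-> p1 _]|[q0 pq _]] F.
  exists (1 + t) => // r r0; have [I J] := F r; split => //; apply: le_trans J _.
  by rewrite p1 mulr0 mul0r oppr0 expR0 mul1r expr0n /= subr0 mulr1.
have [C C0 h] := expR_poly_bound (mulr_gt0 q0 x0); exists (C * (1 + t)); first exact: mulr_ge0.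
move=> r r0; have [I J] := F r; split => //; apply: le_trans J _.
rewrite pq subrr mulr0 addr0 invr1 mulr1 [leRHS]mulrAC; apply: ler_wpM2r => //.
apply: le_trans (h r r0); rewrite -mulrA ler_peMl ?expR_ge0//.
by rewrite lerDl.
Qed.

Definition czero (D : set R) (u : R -> R[i]) : R -> R[i] :=
  fun y => if y \in D then u y else 0.

Lemma cmeas_czero D u : measurable D -> cmeas D u -> cmeas setT (czero D u).
Proof.
move=> mD [h1 h2]; split.
  rewrite (_ : (fun y => re (czero D u y)) = (fun y => re (u y)) \_ D).
    by move/(measurable_restrictT _ mD) : h1.
  by apply/funext => y; rewrite /czero /patch; case: ifP.
rewrite (_ : (fun y => im (czero D u y)) = (fun y => im (u y)) \_ D).
  by move/(measurable_restrictT _ mD) : h2.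
by apply/funext => y; rewrite /czero /patch; case: ifP.
Qed.

Lemma czeroE D u y : D y -> czero D u y = u y.
Proof. by move=> Dy; rewrite /czero mem_set. Qed.

Lemma ccont_at_czero (D : set R) (W : R -> R -> R[i]) (v tau : R) :
  (D tau -> ccont_at v (W ^~ tau)) -> ccont_at v (fun r => czero D (W r) tau).
Proof.
rewrite /czero => h; case: (boolP (tau \in D)) => [/set_mem /h //|_]; exact: ccont_at_cst.
Qed.

Lemma hl_gt0 (y : R) : hl y -> 0 < y.
Proof. by rewrite /= in_itv /= andbT. Qed.

Lemma ker_swap_y p q sg x s (u : R -> R[i]) (m : R -> R) : adm p q sg -> 0 < x -> 0 < s ->
  cmeas hl u -> (forall y, 0 < y -> normc (u y) <= m y) -> intble hl m ->
  [/\ cintble hl (fun r => cintegral hl (fun y => ker p q (x - sg * y) s r * u y)),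
      cintble hl (fun y => cintegral hl (ker p q (x - sg * y) s) * u y) &
      cintegral hl (fun r => cintegral hl (fun y => ker p q (x - sg * y) s r * u y)) =
      cintegral hl (fun y => cintegral hl (ker p q (x - sg * y) s) * u y)].
Proof.
move=> A x0 s0 mu_ um im.
have [C C0 hC] := ker_decay A x0 s0.
have kap r : 0 <= r -> expR (ker_re p q x s r) <= C * (1 + r ^+ 2)^-1.
  move=> r0; apply: le_trans (hC r r0); rewrite ler_peMl ?expR_ge0//.
  by rewrite lerDl.
have cont_y : continuous (fun y : R => x - sg * y).
  by move=> y; apply: cvgB; [exact: cvg_cst|apply: cvgM; [exact: cvg_cst|exact: cvg_id]].
(* The absolute value of r and the cut-off of the data extend the integrand to the whole plane
   without changing it on the domain of integration. *)
pose H r y := ker p q (x - sg * y) s `|r| * czero hl u y.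
have cR (z : R) (v : R) : ccont_at v (fun r => ker p q z s `|r|).
  apply: (ccont_at_ker p q (z := fun=> z) (s := fun=> s) (r := fun r => `|r|)); [exact: cvg_cst..|].
  exact: norm_continuous.
have kmeas z : cmeas hl (ker p q z s).
  apply: cmeas_cont; first exact: interval_open.
  move=> r _; apply: (ccont_at_ker p q (z := fun=> z) (s := fun=> s) (r := fun r => r)); [exact: cvg_cst..|].
  exact: cvg_id.
have ki y : 0 < y -> cintble hl (ker p q (x - sg * y) s).
  move=> y0; apply: (cint_dom _ _ (intbleZ C _ intble_oneDsqr)) => //.
  move=> r /hl_gt0/ltW r0; rewrite normc_ker; apply: le_trans (kap r r0).
  by rewrite ler_expR; apply: (ker_re_mono _ _ A) => //; exact: ltW.
have [] := @cfubini R hl hl H (fun r y => expR (ker_re p q x s r) * m y)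
  (fun r => C * (1 + r ^+ 2)^-1 * \int[mu]_(y in hl) m y).
- by [].
- by [].
- move=> y r; apply: ccont_atM; first exact: cR.
  exact: ccont_at_cst.
- move=> r; apply: cmeasM; last exact: cmeas_czero.
  have h : forall y, ccont_at y (fun y => ker p q (x - sg * y) s `|r|).
    move=> y; apply: (ccont_at_ker p q (z := fun y => x - sg * y) (s := fun=> s) (r := fun=> `|r|));
      [exact: cont_y|exact: cvg_cst..].
  by apply: cmeas_cont => //; exact: openT.
- move=> r y /hl_gt0 r0 Dy; have y0 := hl_gt0 Dy; rewrite /H normcM normc_ker czeroE//.
  apply: ler_pM; [exact: expR_ge0|exact: normc_ge0| |exact: um].
  rewrite (gtr0_norm r0) ler_expR; apply: (ker_re_mono _ _ A); exact: ltW.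
- by move=> r _; exact: intbleZ.
- move=> y Dy; apply: eq_intble (intbleZ (m y) _ _) => //; last first.
    apply: (@intble_dom _ hl (fun r => expR (ker_re p q x s r)) _ _ _ (intbleZ C _ intble_oneDsqr)) => //.
      by apply: continuous_measurable_hl => r; exact: continuous_expR_ker_re.
    by move=> r /hl_gt0/ltW r0; rewrite ger0_norm ?expR_ge0//; exact: kap.
  by move=> r _; rewrite mulrC.
- move=> r /hl_gt0/ltW r0; rewrite RintZ//; apply: ler_wpM2r; last exact: kap.
  apply: Rintegral_ge0 => y /hl_gt0 y0; apply: le_trans (um y y0); exact: normc_ge0.
- apply: eq_intble (intbleZ (\int[mu]_(y in hl) m y) _ (intbleZ C _ intble_oneDsqr)) => //.
  by move=> r _; rewrite mulrC.
have E1 r : hl r -> cintegral hl (H r) = cintegral hl (fun y => ker p q (x - sg * y) s r * u y).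
  by move=> /hl_gt0 r0; apply: eq_cint => y Dy; rewrite /H czeroE// (gtr0_norm r0).
have E2 y : hl y -> cintegral hl (H ^~ y) = cintegral hl (ker p q (x - sg * y) s) * u y.
  move=> Dy; rewrite mulrC -(cintZ (u y) _ (ki y (hl_gt0 Dy))).2//.
  by apply: eq_cint => r /hl_gt0 r0; rewrite /H czeroE// (gtr0_norm r0) mulrC.
move=> h1 h2 h3; split.
- exact: eq_cintble E1 h1.
- exact: eq_cintble E2 h2.
- by rewrite -(eq_cint E1) -(eq_cint E2).
Qed.

Lemma cmeas_ker_y p q sg x s r : cmeas hl (fun y => ker p q (x - sg * y) s r).
Proof.
apply: cmeas_cont; first exact: interval_open.
move=> y _; apply: (ccont_at_ker p q (z := fun y => x - sg * y) (s := fun=> s) (r := fun=> r)); [|exact: cvg_cst..].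
by apply: cvgB; [exact: cvg_cst|apply: cvgM; [exact: cvg_cst|exact: cvg_id]].
Qed.

Lemma ccont_at_ker_time p q z t r (tau : R) : ccont_at tau (fun tau => ker p q z (t - tau) r).
Proof.
apply: (ccont_at_ker p q (z := fun=> z) (s := fun tau => t - tau) (r := fun=> r)); [exact: cvg_cst| |exact: cvg_cst].
by apply: cvgB; [exact: cvg_cst|exact: cvg_id].
Qed.

Lemma ccont_at_ker_abs p q z s (r : R) : ccont_at r (fun r => ker p q z s `|r|).
Proof.
apply: (ccont_at_ker p q (z := fun=> z) (s := fun=> s) (r := fun r => `|r|)); [exact: cvg_cst..|].
exact: norm_continuous.
Qed.

Lemma in0t_near (t tau : R) : 0 < tau < t -> \forall s \near tau, 0 < s < t.
Proof.
move=> /andP[h1 h2]; near=> s; apply/andP; split.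
  by near: s; exact: lt_nbhsr.
by near: s; exact: lt_nbhsl.
Unshelve. all: by end_near. Qed.

(** A triple integral: r and tau are exchanged for the integrand [W] already integrated in y, and
    for each fixed tau the variables r and y are exchanged by [ker_swap_y]. The factor 2 in the
    majorant is that of [cint_norm]. *)
Lemma ker_swap_t p q sg x t (f : R -> R -> R[i]) (m : R -> R) : adm p q sg -> 0 < x -> 0 < t ->
  (forall tau, 0 < tau -> cmeas hl (f ^~ tau)) ->
  (forall y tau, 0 < y -> 0 < tau -> ccont_at tau (f y)) ->
  (forall y tau, 0 < y -> 0 < tau -> normc (f y tau) <= m y) -> intble hl m ->
  let W r tau := cintegral hl (fun y => ker p q (x - sg * y) (t - tau) r * f y tau) in
  let L tau := cintegral hl (fun y => cintegral hl (ker p q (x - sg * y) (t - tau)) * f y tau) in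
  [/\ forall r, 0 < r -> cmeas `]0, t[ (W r),
      forall r, 0 < r -> cintble `]0, t[ (W r),
      cintble hl (fun r => cintegral `]0, t[ (W r)),
      cintble `]0, t[ L &
      cintegral hl (fun r => cintegral `]0, t[ (W r)) = cintegral `]0, t[ L].
Proof.
move=> A x0 t0 fm fc fb im W L.
have [C C0 hC] := ker_time_bound A x0 t0.
have mt : measurable (`]0, t[%classic : set R) by [].
have k1 y tau r : 0 < y -> 0 < tau < t -> 0 <= r ->
    expR (ker_re p q (x - sg * y) (t - tau) r) <= expR (ker_re p q x (t - tau) r).
  by move=> y0 _ r0; rewrite ler_expR; apply: (ker_re_mono _ _ A) => //; exact: ltW.
have k2 tau r : 0 < tau < t -> 0 <= r -> expR (ker_re p q x (t - tau) r) <= 1.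
  by move=> /andP[_ h] r0; apply: (ker_re_le0 A) => //; [exact: ltW|rewrite subr_ge0 ltW].
have Wb r y tau : 0 < y -> 0 < tau < t ->
    normc (ker p q (x - sg * y) (t - tau) `|r| * f y tau) <= m y.
  move=> y0 h; rewrite normcM normc_ker -[leRHS]mul1r; apply: ler_pM.
  - exact: expR_ge0.
  - exact: normc_ge0.
  - by apply: le_trans (k2 tau `|r| h _) => //; exact: k1.
  - by apply: fb => //; have /andP[] := h.
have Wm r tau : 0 < tau -> cmeas hl (fun y => ker p q (x - sg * y) (t - tau) `|r| * f y tau).
  by move=> h; apply: cmeasM; [exact: cmeas_ker_y|exact: fm].
have Wct r tau : 0 < tau < t -> ccont_at tau (W `|r|).
  move=> h.
  have N : \forall s \near tau, 0 < s < t by exact: in0t_near.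
  apply: (@ccont_at_cint _ hl (fun s y => ker p q (x - sg * y) (t - s) `|r| * f y s) m); [by []| | |exact: im|].
  - by apply: filterS N => s /andP[h1 h2]; exact: Wm.
  - by apply: filterS N => s hs y /hl_gt0 y0; exact: Wb.
  - move=> y /hl_gt0 y0; apply: ccont_atM; first exact: ccont_at_ker_time.
    by apply: fc => //; have /andP[] := h.
(* Thanks to the absolute value, the modulus stays below [m y] for all real r; on gamma it would
   grow for negative r. *)
have Wcr r tau : 0 < tau < t -> ccont_at r (fun r => W `|r| tau).
  move=> h.
  apply: (@ccont_at_cint _ hl (fun r y => ker p q (x - sg * y) (t - tau) `|r| * f y tau) m); [by []| | |exact: im|].
  - by apply: filterE => s; have /andP[h1 h2] := h; exact: Wm.
  - by apply: filterE => s y /hl_gt0 y0; exact: Wb.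
  - move=> y /hl_gt0 y0; apply: ccont_atM; first exact: ccont_at_ker_abs.
    exact: ccont_at_cst.
have Wmt r : cmeas `]0, t[ (W `|r|).
  apply: cmeas_cont; first exact: interval_open.
  by move=> tau /in0t; exact: Wct.
pose M := \int[mu]_(y in hl) m y.
have M0 : 0 <= M.
  apply: Rintegral_ge0 => y /hl_gt0 y0; apply: le_trans (fb y 1 y0 ltr01); exact: normc_ge0.
have WB r tau : 0 <= r -> 0 < tau < t -> normc (W `|r| tau) <= 2 * M * expR (ker_re p q x (t - tau) r).
  move=> r0 h; rewrite -mulrA.
  apply: (@cint_norm _ hl _ (fun y => expR (ker_re p q x (t - tau) r) * m y)) => //.
  - by apply: Wm; have /andP[] := h.
  - exact: intbleZ.
  - move=> y /hl_gt0 y0; rewrite normcM normc_ker (ger0_norm r0); apply: ler_pM.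
    + exact: expR_ge0.
    + exact: normc_ge0.
    + exact: k1.
    + by apply: fb => //; have /andP[] := h.
  - by rewrite RintZ// mulrC.
have [] := @cfubini R hl `]0, t[ (fun r => czero `]0, t[ (W `|r|))
  (fun r tau => 2 * M * expR (ker_re p q x (t - tau) r))
  (fun r => 2 * M * (C * (1 + r ^+ 2)^-1)).
- by [].
- by [].
- move=> tau r; apply: ccont_at_czero => /in0t; exact: Wcr.
- by move=> r; apply: cmeas_czero.
- by move=> r tau /hl_gt0/ltW r0 Dt; rewrite czeroE//; apply: WB => //; exact/in0t.
- by move=> r /hl_gt0/ltW r0; apply: intbleZ => //; exact: (hC r r0).1.
- move=> tau /in0t h; apply: intbleZ => //.
  have ht : 0 < t - tau by rewrite subr_gt0; have /andP[] := h.
  have [C' C'0 hC'] := ker_decay A x0 ht.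
  apply: (@intble_dom _ hl (fun r => expR (ker_re p q x (t - tau) r)) _ _ _ (intbleZ C' _ intble_oneDsqr)) => //.
    by apply: continuous_measurable_hl => r; exact: continuous_expR_ker_re.
  move=> r /hl_gt0/ltW r0; rewrite ger0_norm ?expR_ge0//; apply: le_trans (hC' r r0).
  by rewrite ler_peMl ?expR_ge0// lerDl.
- move=> r /hl_gt0/ltW r0; have [I J] := hC r r0; rewrite RintZ//.
  by apply: ler_wpM2l => //; exact: mulr_ge0.
- by apply: intbleZ => //; apply: intbleZ => //; exact: intble_oneDsqr.
have E1 r : hl r -> cintegral `]0, t[ (czero `]0, t[ (W `|r|)) = cintegral `]0, t[ (W r).
  by move=> /hl_gt0 r0; apply: eq_cint => tau Dt; rewrite czeroE// (gtr0_norm r0).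
have E2 tau : `]0, t[%classic tau -> cintegral hl (fun r => czero `]0, t[ (W `|r|) tau) = L tau.
  move=> Dt; have /in0t/andP[h1 h2] := Dt.
  have ht : 0 < t - tau by rewrite subr_gt0.
  have fbt y : 0 < y -> normc (f y tau) <= m y by move=> y0; exact: fb.
  rewrite /L; have [_ _ <-] := @ker_swap_y p q sg x (t - tau) (f ^~ tau) m A x0 ht (fm tau h1) fbt im.
  by apply: eq_cint => r /hl_gt0 r0; rewrite czeroE// (gtr0_norm r0).
move=> h1 h2 h3; split.
- by move=> r r0; rewrite -(gtr0_norm r0).
- move=> r r0; rewrite -(gtr0_norm r0); have [I _] := hC r (ltW r0).
  apply: (cint_dom mt (Wmt r) (intbleZ (2 * M) mt I)) => tau /in0t h.
  exact: (WB r tau (ltW r0) h).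
- exact: eq_cintble E1 h1.
- exact: eq_cintble E2 h2.
- by rewrite -(eq_cint E1) -(eq_cint E2).
Qed.

(** Since p^2 = q^2, the modulus of the kernel does not depend on the elapsed time, so the majorant
    in r is uniform in tau, even at tau = t and with the additional factor lambda. *)
Lemma ker_swap_g p q x t (g : R -> R[i]) (M : R) : 0 < q -> p ^+ 2 = q ^+ 2 -> 0 < x -> 0 < t ->
  (forall tau, 0 < tau -> ccont_at tau g) ->
  (forall tau, 0 < tau < t -> normc (g tau) <= M) ->
  let W r tau := ker p q x (t - tau) r * (r%:C * (p +i* q)) * g tau in
  let L tau := cintegral hl (fun r => ker p q x (t - tau) r * (r%:C * (p +i* q))) * g tau in
  [/\ forall r, 0 < r -> cmeas `]0, t[ (W r),
      forall r, 0 < r -> cintble `]0, t[ (W r),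
      cintble hl (fun r => cintegral `]0, t[ (W r)),
      cintble `]0, t[ L &
      cintegral hl (fun r => cintegral `]0, t[ (W r)) = cintegral `]0, t[ L].
Proof.
move=> q0 pq x0 t0 gc gM W L.
have A : adm p q (- 1) by right.
have [C C0 hC] := ker_decay A x0 t0.
have mt : measurable (`]0, t[%classic : set R) by [].
have ksame s r : ker_re p q x s r = ker_re p q x t r.
  by rewrite /ker_re pq subrr mulr0 !mul0r.
pose N := normc (p +i* q).
have N0 : 0 <= N by exact: normc_ge0.
have M0 : 0 <= M.
  have h : 0 < t / 2 < t by rewrite divr_gt0//= ltr_pdivrMr// ltr_pMr// ltr1n.
  by apply: le_trans (gM _ h); exact: normc_ge0.
have nr r : normc (r%:C : R[i]) = `|r| by rewrite /= expr0n /= addr0 sqrtr_sqr.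
have kb s r : 0 <= r -> normc (ker p q x s r * (r%:C * (p +i* q))) <= N * (C * (1 + r ^+ 2)^-1).
  move=> r0; rewrite normcM normc_ker normcM nr ksame (ger0_norm r0) -/N mulrA [leLHS]mulrC.
  apply: ler_wpM2l => //; apply: le_trans (hC r r0); rewrite mulrC; apply: ler_wpM2r; first exact: expR_ge0.
  by rewrite lerDr.
have cr s (r : R) : ccont_at r (fun r => ker p q x s `|r| * (`|r|%:C * (p +i* q))).
  apply: ccont_atM; first exact: ccont_at_ker_abs.
  apply: ccont_atM; last exact: ccont_at_cst.
  by split => /=; [exact: norm_continuous|exact: cvg_cst].
have crr s (r : R) : ccont_at r (fun r => ker p q x s r * (r%:C * (p +i* q))).
  apply: ccont_atM.
    apply: (ccont_at_ker p q (z := fun=> x) (s := fun=> s) (r := fun r => r)); [exact: cvg_cst..|].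
    exact: cvg_id.
  apply: ccont_atM; last exact: ccont_at_cst.
  by split => /=; [exact: cvg_id|exact: cvg_cst].
have Wmt r : cmeas `]0, t[ (W r).
  apply: cmeas_cont; first exact: interval_open.
  move=> tau /in0t/andP[h1 h2]; apply: ccont_atM; last exact: gc.
  by apply: ccont_atM; [exact: ccont_at_ker_time|exact: ccont_at_cst].
have WB r tau : 0 <= r -> 0 < tau < t -> normc (W r tau) <= N * (C * (1 + r ^+ 2)^-1) * M.
  move=> r0 h; rewrite normcM; apply: ler_pM; [exact: normc_ge0|exact: normc_ge0| |exact: gM].
  exact: kb.
have ic (c : R) : intble `]0, t[ (fun=> c).
  apply: (@intble_bounded _ _ _ 0 t `|c|) => //.
  by move=> s /=; rewrite !in_itv /= => /andP[h1 h2]; rewrite !ltW.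
have iC : intble hl (fun r => N * (C * (1 + r ^+ 2)^-1) * M).
  apply: eq_intble (intbleZ (N * C * M) _ intble_oneDsqr) => // r _.
  by rewrite !mulrA -!mulrA (mulrC M) !mulrA.
have [] := @cfubini R hl `]0, t[ (fun r => czero `]0, t[ (W `|r|))
  (fun r tau => N * (C * (1 + r ^+ 2)^-1) * M)
  (fun r => \int[mu]_(tau in `]0, t[) (N * (C * (1 + r ^+ 2)^-1) * M)).
- by [].
- by [].
- move=> tau r; apply: ccont_at_czero => _; apply: ccont_atM; [exact: cr|exact: ccont_at_cst].
- by move=> r; apply: cmeas_czero.
- move=> r tau /hl_gt0/ltW r0 Dt; rewrite czeroE// (ger0_norm r0).
  by apply: WB => //; exact/in0t.
- by [].
- by [].
- by [].
- apply: eq_intble (intbleZ (\int[mu]_(tau in `]0, t[) 1) _ iC) => // r _.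
  by rewrite mulrC -RintZ//; apply: eq_Rint => tau _; rewrite mulr1.
have E1 r : hl r -> cintegral `]0, t[ (czero `]0, t[ (W `|r|)) = cintegral `]0, t[ (W r).
  by move=> /hl_gt0 r0; apply: eq_cint => tau Dt; rewrite czeroE// (gtr0_norm r0).
have ki s : cintble hl (fun r => ker p q x s r * (r%:C * (p +i* q))).
  apply: (cint_dom _ _ (intbleZ N _ (intbleZ C _ intble_oneDsqr))) => //.
    by apply: cmeas_cont => [|r _]; [exact: interval_open|exact: crr].
  by move=> r /hl_gt0/ltW r0; exact: kb.
have E2 tau : `]0, t[%classic tau -> cintegral hl (fun r => czero `]0, t[ (W `|r|) tau) = L tau.
  move=> Dt; rewrite /L mulrC -(cintZ (g tau) _ (ki (t - tau))).2//.
  by apply: eq_cint => r /hl_gt0 r0; rewrite czeroE// (gtr0_norm r0) mulrC.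
move=> h1 h2 h3; split.
- by move=> r r0.
- move=> r r0; apply: (cint_dom mt (Wmt r) (ic (N * (C * (1 + r ^+ 2)^-1) * M))) => tau /in0t h.
  exact: (WB r tau (ltW r0) h).
- exact: eq_cintble E1 h1.
- exact: eq_cintble E2 h2.
- by rewrite -(eq_cint E1) -(eq_cint E2).
Qed.
End fokas_kernel.

Arguments cexp : simpl never.
Arguments ker : simpl never.

(** * Evaluation of the contour integrals of the exponential *)

Section fokas_evaluation.
Context {R : realType}.
Notation mu := (@lebesgue_measure R).
Notation hl := (`]0, +oo[%classic : set R).
Implicit Types (p q sg x y z s t r : R).

Lemma cexp_i (a : R) : cexp ('i%C * a%:C) = cos a +i* sin a.
Proof.
rewrite (_ : 'i%C * a%:C = 0 +i* a); last by apply: complex_eq => /=; ring.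
by apply: complex_eq; rewrite ?re_cexp ?im_cexp /= expR0 mul1r.
Qed.

Definition c8 : R := cos (pi / 4).

Lemma sin_c8 : sin (pi / 4) = c8 :> R.
Proof.
rewrite /c8 -cosBpihalf -cosN; congr cos.
have := @pi_gt0 R; move: (pi : R) => a _.
by lra.
Qed.

Lemma c8_gt0 : 0 < c8.
Proof.
apply: cos_gt0_pihalf; apply/andP; split; have := @pi_gt0 R; move: (pi : R) => a; lra.
Qed.

Lemma ray_out : cexp ('i%C * (pi / 4)%:C) = c8 +i* c8.
Proof. by rewrite cexp_i sin_c8. Qed.

Lemma ray_in : cexp ('i%C * (3 * pi / 4)%:C) = - c8 +i* c8.
Proof.
have E : 3 * pi / 4 = pi - pi / 4 :> R by move: (pi : R) => a; lra.
by rewrite cexp_i E cosB sinB cospi sinpi sin_c8 -/c8; congr Complex; ring.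
Qed.

Lemma cintble_ker p q sg x s : adm p q sg -> 0 < x -> 0 < s -> cintble hl (ker p q x s).
Proof.
move=> A x0 s0; have [C C0 hC] := ker_decay A x0 s0.
apply: (cint_dom _ _ (intbleZ C _ intble_oneDsqr)) => //.
  apply: cmeas_cont; first exact: interval_open.
  move=> r _; apply: (ccont_at_ker p q (z := fun=> x) (s := fun=> s) (r := fun r => r)); [exact: cvg_cst..|].
  exact: cvg_id.
move=> r /hl_gt0/ltW r0; rewrite normc_ker; apply: le_trans (hC r r0).
by rewrite ler_peMl ?expR_ge0// lerDl.
Qed.

Lemma cintble_ker_line p z s : p ^+ 2 = 1 -> 0 < s -> cintble hl (ker p 0 z s).
Proof.
move=> p1 s0; have A : adm p 0 1 by left.
have [C C0 hC] := ker_decay A (@ltr01 R) s0.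
apply: (cint_dom _ _ (intbleZ C _ intble_oneDsqr)) => //.
  apply: cmeas_cont; first exact: interval_open.
  move=> r _; apply: (ccont_at_ker p 0 (z := fun=> z) (s := fun=> s) (r := fun r => r)); [exact: cvg_cst..|].
  exact: cvg_id.
move=> r /hl_gt0/ltW r0; rewrite normc_ker; apply: le_trans (hC r r0).
rewrite (_ : ker_re p 0 z s r = ker_re p 0 1 s r); first by rewrite ler_peMl ?expR_ge0// lerDl.
by rewrite /ker_re; ring.
Qed.

Lemma re_ker p q z s r : re (ker p q z s r) = expR (ker_re p q z s r) * cos (ker_im p q z s r).
Proof. by rewrite re_cexp. Qed.

Lemma im_ker p q z s r : im (ker p q z s r) = expR (ker_re p q z s r) * sin (ker_im p q z s r).
Proof. by rewrite im_cexp. Qed.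

Lemma re_cint D (h : R -> R[i]) : re (cintegral D h) = \int[mu]_(v in D) re (h v).
Proof. by []. Qed.

Lemma im_cint D (h : R -> R[i]) : im (cintegral D h) = \int[mu]_(v in D) im (h v).
Proof. by []. Qed.

(** The kernels on the two half-lines are complex conjugates, so their sum is twice the cosine
    integral. *)
Lemma line_eval z s : 0 < s ->
  cintegral hl (ker 1 0 z s) + cintegral hl (ker (-1) 0 z s) = (2 * pi * heatK z s)%:C.
Proof.
move=> s0; have [I E] := gauss_cos z s0.
have [_ J] := @cintble_ker_line 1 z s (expr1n _ _) s0.
have K r : ker_re 1 0 z s r = - (r ^+ 2 * s) by rewrite /ker_re; ring.
have K' r : ker_re (-1) 0 z s r = - (r ^+ 2 * s) by rewrite /ker_re; ring.
apply: complex_eq.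
  rewrite reD !re_cint.
  rewrite (eq_Rint (g := fun r => cos (r * z) * expR (- (r ^+ 2 * s)))); last first.
    by move=> r _; rewrite re_ker K mulrC; congr (cos _ * _); rewrite /ker_im; ring.
  rewrite (eq_Rint (f := fun r => re (ker (-1) 0 z s r)) (g := fun r => cos (r * z) * expR (- (r ^+ 2 * s)))).
    by rewrite E /=; ring.
  by move=> r _; rewrite re_ker K' mulrC -cosN; congr (cos _ * _); rewrite /ker_im; ring.
rewrite imD !im_cint.
rewrite (eq_Rint (f := fun r => im (ker (-1) 0 z s r)) (g := fun r => - im (ker 1 0 z s r))).
  by rewrite RintN// subrr.
move=> r _; rewrite !im_ker K K' -[RHS]mulrN -sinN; congr (_ * sin _).
by rewrite /ker_im; ring.
Qed.

(** Reflection in the imaginary axis conjugates the kernels on the two rays, so the left side is 2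
    c8 times the difference of the real and imaginary parts of one ray integral. That difference is
    the rotated integral with z and s rescaled to c8 z and c8^2 s. *)
Lemma gamma_eval z s : 0 < z -> 0 < s ->
  (c8 +i* c8) * cintegral hl (ker c8 c8 z s) - (- c8 +i* c8) * cintegral hl (ker (- c8) c8 z s) =
  (2 * pi * heatK z s)%:C.
Proof.
move=> z0 s0; have c0 := c8_gt0.
have A : adm c8 c8 (-1) by right.
have [I J] := cintble_ker A z0 s0.
have s'0 : 0 < c8 ^+ 2 * s by rewrite mulr_gt0// exprn_gt0.
have [_ E] := gauss_rotate (mulr_gt0 c0 z0) s'0.
have E1 : cintegral hl (ker (- c8) c8 z s) =
    re (cintegral hl (ker c8 c8 z s)) +i* - im (cintegral hl (ker c8 c8 z s)).
  have H r : ker_re (- c8) c8 z s r = ker_re c8 c8 z s r by rewrite /ker_re; ring.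
  have H' r : ker_im (- c8) c8 z s r = - ker_im c8 c8 z s r by rewrite /ker_im; ring.
  apply: complex_eq.
    rewrite [RHS]/complex.Re !re_cint.
    by apply: eq_Rint => r _; rewrite !re_ker H H' cosN.
  rewrite [RHS]/complex.Im !im_cint.
  by rewrite -RintN//; apply: eq_Rint => r _; rewrite !im_ker H H' sinN mulrN.
have E2 : re (cintegral hl (ker c8 c8 z s)) - im (cintegral hl (ker c8 c8 z s)) =
    pi * heatK (c8 * z) (c8 ^+ 2 * s).
  rewrite -E re_cint im_cint -RintB//; apply: eq_Rint => r _.
  rewrite re_ker im_ker /rot_q -mulrBr mul1r; congr (expR _ * (cos _ - sin _)).
  - by rewrite /ker_re /rot_a; ring.
  - by rewrite /ker_im /rot_b; ring.
  - by rewrite /ker_im /rot_b; ring.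
(* Parabolic scaling: K(c z, c^2 s) = K(z, s)/c for c > 0. *)
have E3 : heatK (c8 * z) (c8 ^+ 2 * s) = c8^-1 * heatK z s.
  rewrite /heatK (sqrtrM s (sqr_ge0 c8)) sqrtr_sqr (gtr0_norm c0).
  rewrite (_ : (c8 * z) ^+ 2 / 4 * (c8 ^+ 2 * s)^-1 = z ^+ 2 / 4 * s^-1).
    by rewrite invfM; ring.
  by rewrite invfM -(exprVn c8) exprMn; have := mulVf (lt0r_neq0 c0); move: (c8^-1) (s^-1) => b e h;
    transitivity (z ^+ 2 / 4 * e * (b * c8) ^+ 2); [ring|rewrite h; ring].
rewrite E1; move: E2; rewrite E3; move: (cintegral _ _) => [a b] /= E2.
apply: complex_eq; rewrite ?reD ?imD ?reN ?imN ?reM ?imM /=; last by ring.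
transitivity (2 * c8 * (a - b)); first by ring.
rewrite E2; have := mulVf (lt0r_neq0 c0); move: (c8^-1) => b' h.
by transitivity (2 * pi * heatK z s * (b' * c8)); [ring|rewrite h; ring].
Qed.

Lemma cvg0_oneDsqr (f : R -> R) (C : R) :
  (forall r, 0 < r -> `|f r| <= C * (1 + r ^+ 2)^-1) -> f r @[r --> +oo] --> 0.
Proof.
move=> h; have C0 : 0 <= C.
  have := h 1 ltr01; rewrite expr1n => h1; have := le_trans (normr_ge0 _) h1.
  by rewrite pmulr_lge0// invr_gt0.
apply: (@cvg_dom _ _ _ _ _ (fun A : R => C * A^-1)).
  near=> A; rewrite subr0.
  have A1 : 1 <= A by near: A; apply: nbhs_pinfty_ge; exact: num_real.
  have A0 : 0 < A by apply: lt_le_trans A1.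
  apply: le_trans (h A A0) _; rewrite ler_wpM2l// lef_pV2 ?posrE//; last first.
    by rewrite ltr_pwDl// sqr_ge0.
  by nra.
rewrite -[X in _ --> X](mulr0 C); apply: cvgM; first exact: cvg_cst.
apply/(@gtr0_cvgV0 R R +oo _ id); last exact: cvg_id.
by near=> A; near: A; apply: nbhs_pinfty_gt; exact: num_real.
Unshelve. all: by end_near. Qed.

(** The r-derivative of [ker], arranged as a combination of the kernel and of the kernel times
    lambda. *)
Definition ker1 p q z s r : R[i] :=
  'i%C * (p +i* q) * z%:C * ker p q z s r -
  (2 * s)%:C * (p +i* q) * (ker p q z s r * (r%:C * (p +i* q))).

Lemma is_derive_re_ker p q z s r :
  is_derive r 1 (fun r => re (ker p q z s r)) (re (ker1 p q z s r)).
Proof.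
rewrite (_ : (fun r => re (ker p q z s r)) =
  (fun r => expR (ker_re p q z s r) * cos (ker_im p q z s r))); last by apply/funext => v; rewrite re_ker.
have := re_ker p q z s r; have := im_ker p q z s r; rewrite /ker1.
move: (ker p q z s r) => [k k'] /= -> ->.
rewrite /ker_re /ker_im; apply: is_derive_eq; rewrite /GRing.scale /=.
by move: (expR _) (sin _) (cos _) => e si co; ring.
Qed.

Lemma is_derive_im_ker p q z s r :
  is_derive r 1 (fun r => im (ker p q z s r)) (im (ker1 p q z s r)).
Proof.
rewrite (_ : (fun r => im (ker p q z s r)) =
  (fun r => expR (ker_re p q z s r) * sin (ker_im p q z s r))); last by apply/funext => v; rewrite im_ker.
have := re_ker p q z s r; have := im_ker p q z s r; rewrite /ker1.
move: (ker p q z s r) => [k k'] /= -> ->.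
rewrite /ker_re /ker_im; apply: is_derive_eq; rewrite /GRing.scale /=.
by move: (expR _) (sin _) (cos _) => e si co; ring.
Qed.

Lemma ccont_atB (v : R) (h k : R -> R[i]) : ccont_at v h -> ccont_at v k ->
  ccont_at v (fun v => h v - k v).
Proof.
move=> [h1 h2] [k1 k2]; split.
  rewrite (_ : (fun v => re (h v - k v)) = (fun v => re (h v) - re (k v))); first exact: cvgB.
  by apply/funext => w; rewrite reD reN.
rewrite (_ : (fun v => im (h v - k v)) = (fun v => im (h v) - im (k v))); first exact: cvgB.
by apply/funext => w; rewrite imD imN.
Qed.

Lemma ccont_at_ker_r p q z s (r : R) : ccont_at r (ker p q z s).
Proof.
apply: (ccont_at_ker p q (z := fun=> z) (s := fun=> s) (r := fun r => r)); [exact: cvg_cst..|].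
exact: cvg_id.
Qed.

Lemma ccont_at_ker_mul p q z s (r : R) : ccont_at r (fun r => ker p q z s r * (r%:C * (p +i* q))).
Proof.
apply: ccont_atM; first exact: ccont_at_ker_r.
apply: ccont_atM; last exact: ccont_at_cst.
by split => /=; [exact: cvg_id|exact: cvg_cst].
Qed.

Lemma cintble_ker_mul p q sg x s : adm p q sg -> 0 < x -> 0 < s ->
  cintble hl (fun r => ker p q x s r * (r%:C * (p +i* q))).
Proof.
move=> A x0 s0; have [C C0 hC] := ker_decay A x0 s0.
apply: (cint_dom _ _ (intbleZ (normc (p +i* q)) _ (intbleZ C _ intble_oneDsqr))) => //.
  by apply: cmeas_cont => [|r _]; [exact: interval_open|exact: ccont_at_ker_mul].
move=> r /hl_gt0/ltW r0; rewrite normcM normc_ker normcM.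
have -> : normc (r%:C : R[i]) = r by rewrite /= expr0n /= addr0 sqrtr_sqr ger0_norm.
rewrite mulrA [leLHS]mulrC; apply: ler_wpM2l; first exact: normc_ge0.
apply: le_trans (hC r r0); rewrite mulrC; apply: ler_wpM2r; first exact: expR_ge0.
by rewrite lerDr.
Qed.

(** The integral over the ray of the r-derivative of the kernel is minus its value 1 at r = 0. This
    expresses the first moment by the integral of the kernel itself. *)
Lemma ker_moment p q sg x s : adm p q sg -> 0 < x -> 0 < s ->
  (2 * s)%:C * ((p +i* q) * cintegral hl (fun r => ker p q x s r * (r%:C * (p +i* q)))) =
  'i%C * x%:C * ((p +i* q) * cintegral hl (ker p q x s)) + 1.
Proof.
move=> A x0 s0; have mh : measurable hl by [].
have I := cintble_ker A x0 s0; have J := cintble_ker_mul A x0 s0.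
have [I1 E1] := cintZ ('i%C * (p +i* q) * x%:C) mh I.
have [J1 E2] := cintZ ((2 * s)%:C * (p +i* q)) mh J.
have E3 := cintB mh I1 J1.
have [K1 K2] : cintble hl (ker1 p q x s).
  have [a1 a2] := I1; have [b1 b2] := J1; split.
    by apply: eq_intble (intbleB mh a1 b1) => // r _; rewrite /ker1 [in RHS]reD [in RHS]reN.
  by apply: eq_intble (intbleB mh a2 b2) => // r _; rewrite /ker1 [in RHS]imD [in RHS]imN.
have cK r : ccont_at r (ker1 p q x s).
  by apply: ccont_atB; apply: ccont_atM;
    [exact: ccont_at_cst|exact: ccont_at_ker_r|exact: ccont_at_cst|exact: ccont_at_ker_mul].
have k0 : ker p q x s 0 = 1.
  have a : ker_re p q x s 0 = 0 by rewrite /ker_re; ring.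
  have b : ker_im p q x s 0 = 0 by rewrite /ker_im; ring.
  by apply: complex_eq; rewrite ?re_ker ?im_ker a b expR0 ?cos0 ?sin0 ?mul1r.
have [C C0 hC] := ker_decay A x0 s0.
have nk r : 0 < r -> normc (ker p q x s r) <= C * (1 + r ^+ 2)^-1.
  move=> r0; rewrite normc_ker; apply: le_trans (hC r (ltW r0)).
  by rewrite ler_peMl ?expR_ge0// lerDl ltW.
have E4 : cintegral hl (ker1 p q x s) = - 1.
  have re0 : re (ker p q x s r) @[r --> +oo] --> 0.
    by apply: (cvg0_oneDsqr (C := C)) => r r0; apply: le_trans (nk r r0); exact: normc_re.
  have im0 : im (ker p q x s r) @[r --> +oo] --> 0.
    by apply: (cvg0_oneDsqr (C := C)) => r r0; apply: le_trans (nk r r0); exact: normc_im.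
  have D1 (r : R) (_ : 0 < r) := is_derive_re_ker p q x s r.
  have D2 (r : R) (_ : 0 < r) := is_derive_im_ker p q x s r.
  have C1 (r : R) (_ : 0 < r) := (cK r).1.
  have C2 (r : R) (_ : 0 < r) := (cK r).2.
  have L1 := cvg_at_right_filter (ccont_at_ker_r p q x s 0).1.
  have L2 := cvg_at_right_filter (ccont_at_ker_r p q x s 0).2.
  have F1 := @FTC2_0y R _ _ _ _ K1 D1 C1 L1 re0.
  have F2 := @FTC2_0y R _ _ _ _ K2 D2 C2 L2 im0.
  apply: complex_eq; rewrite ?re_cint ?im_cint.
    by rewrite F1 k0 sub0r.
  by rewrite F2 k0 /= subrr oppr0.
have E5 : cintegral hl (ker1 p q x s) =
    'i%C * (p +i* q) * x%:C * cintegral hl (ker p q x s) -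
    (2 * s)%:C * (p +i* q) * cintegral hl (fun r => ker p q x s r * (r%:C * (p +i* q))).
  by rewrite -E1 -E2 -E3.
rewrite E4 in E5; move: E5; move: (cintegral _ _) (cintegral _ _) => a b E6.
rewrite -[X in _ + X]opprK E6; ring.
Qed.

(** The end-point contributions 1 of the two rays meeting at 0 cancel in the difference. *)
Lemma moment_identity (K1 K2 M1 M2 : R[i]) x s (k : R) : 0 < s -> K1 - K2 = (2 * pi * k)%:C ->
  (2 * s)%:C * M1 = 'i%C * x%:C * K1 + 1 -> (2 * s)%:C * M2 = 'i%C * x%:C * K2 + 1 ->
  2 * 'i%C * (M1 - M2) = - (2 * pi * (x * s^-1 * k))%:C.
Proof.
move=> s0 E E1 E2.
have z0 : (2 * s)%:C != 0 :> R[i].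
  by apply/negP => /eqP /(congr1 re) /= h; have := mulr_gt0 (@ltr0n R 2) s0; rewrite h ltxx.
apply: (mulfI z0).
transitivity (2 * 'i%C * ((2 * s)%:C * M1 - (2 * s)%:C * M2)); first by ring.
rewrite E1 E2.
transitivity (2 * 'i%C * 'i%C * x%:C * (K1 - K2)); first by ring.
rewrite E; have := mulVf (lt0r_neq0 s0); move: (s^-1) => s' h.
have h2 : 2 * s * (2 * pi * (x * s' * k)) = 4 * pi * x * k :> R.
  by transitivity (4 * pi * x * k * (s' * s)); [ring|rewrite h mulr1].
apply: complex_eq; rewrite !(reM, imM, reN, imN) /=; rewrite ?mul0r ?subr0 ?mulr0 ?addr0.
  by rewrite mulrN h2; ring.
by ring.
Qed.

Lemma gamma_eval_mul x s : 0 < x -> 0 < s ->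
  2 * 'i%C * ((c8 +i* c8) * cintegral hl (fun r => ker c8 c8 x s r * (r%:C * (c8 +i* c8))) -
    (- c8 +i* c8) * cintegral hl (fun r => ker (- c8) c8 x s r * (r%:C * (- c8 +i* c8)))) =
  - (2 * pi * heatH x s)%:C.
Proof.
move=> x0 s0; have c0 := c8_gt0.
have A : adm c8 c8 (-1) by right.
have A' : adm (- c8) c8 (-1) by right; rewrite sqrrN.
rewrite heatHE; exact: (moment_identity s0 (gamma_eval x0 s0) (ker_moment A x0 s0) (ker_moment A' x0 s0)).
Qed.
End fokas_evaluation.

(** * From ray integrals of transforms to kernel potentials *)

Section fokas_representation.
Context {R : realType}.
Notation mu := (@lebesgue_measure R).
Notation hl := (`]0, +oo[%classic : set R).
Implicit Types (p q sg x y z s t r tau : R).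

Lemma cexp_neq0 (z : R[i]) : cexp z != 0.
Proof.
apply/negP => /eqP h; have := normc_cexp z; rewrite h /= expr0n /= addr0 sqrtr0 => e.
by have := expR_gt0 (re z); rewrite -e ltxx.
Qed.

(** The Fourier factor, the spectral exponential and the time exponential are treated as one family:
    multiplying by the first shifts z, multiplying by the last shifts s. *)
Lemma fourier_ker p q sg y r :
  cexp (- ('i%C * (sg%:C * (r%:C * (p +i* q))) * y%:C)) = ker p q (0 - sg * y) 0 r.
Proof. by congr cexp; apply: complex_eq; rewrite /= /ker_re /ker_im; ring. Qed.

Lemma exp_ker p q x t r :
  cexp ('i%C * (r%:C * (p +i* q)) * x%:C - (r%:C * (p +i* q)) ^+ 2 * t%:C) = ker p q x t r.
Proof. by congr cexp; apply: complex_eq; rewrite expr2 /= /ker_re /ker_im; ring. Qed.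

Lemma exp_ker_time p q x t tau r :
  ker p q x t r * cexp (omega (r%:C * (p +i* q)) * tau%:C) = ker p q x (t - tau) r.
Proof.
rewrite /ker -cexpD; congr cexp; apply: complex_eq;
  rewrite /omega expr2 /= /ker_re /ker_im; ring.
Qed.

Lemma cmeas_cst (D : set R) (z : R[i]) : cmeas D (fun=> z).
Proof. by split. Qed.

Lemma ker_shift p q sg x y s r : ker p q x s r * ker p q (0 - sg * y) 0 r = ker p q (x - sg * y) s r.
Proof.
rewrite /ker -cexpD; congr cexp; apply: complex_eq; rewrite /= /ker_re /ker_im; ring.
Qed.

Lemma half_fourierE p q sg (u : R -> R[i]) (m : R -> R) r : adm p q sg -> 0 < r ->
  cmeas hl u -> (forall y, 0 < y -> normc (u y) <= m y) -> intble hl m ->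
  cintble hl (fun y => ker p q (0 - sg * y) 0 r * u y) /\
  half_fourier u (sg%:C * (r%:C * (p +i* q))) = cintegral hl (fun y => ker p q (0 - sg * y) 0 r * u y).
Proof.
move=> A r0 hu um im.
have E y : cexp (- ('i%C * (sg%:C * (r%:C * (p +i* q))) * y%:C)) * u y =
  ker p q (0 - sg * y) 0 r * u y by rewrite fourier_ker.
have I : cintble hl (fun y => ker p q (0 - sg * y) 0 r * u y).
  apply: (cint_dom (m := m)) => //; first by apply: cmeasM => //; exact: cmeas_ker_y.
  move=> y /hl_gt0 y0; rewrite normcM normc_ker -[leRHS]mul1r; apply: ler_pM.
  - exact: expR_ge0.
  - exact: normc_ge0.
  - apply: le_trans (ker_re_le0 A (ltW r0) (lexx 0) (lexx 0)); rewrite ler_expR.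
    by apply: (ker_re_mono _ _ A) => //; exact: ltW.
  - exact: um.
split => //; rewrite /half_fourier -cint_closed.
  by apply: eq_cint => y _; exact: E.
by apply: eq_cintble I => // y _; rewrite E.
Qed.

Lemma half_fourier_ker p q sg (u : R -> R[i]) (m : R -> R) x s r : adm p q sg -> 0 < r ->
  cmeas hl u -> (forall y, 0 < y -> normc (u y) <= m y) -> intble hl m ->
  ker p q x s r * half_fourier u (sg%:C * (r%:C * (p +i* q))) =
  cintegral hl (fun y => ker p q (x - sg * y) s r * u y).
Proof.
move=> A r0 hu um im; have [I ->] := half_fourierE A r0 hu um im.
rewrite -(cintZ (ker p q x s r) _ I).2//; apply: eq_cint => y _.
by rewrite mulrA ker_shift.
Qed.

Lemma ray_u p q sg x t (u : R -> R[i]) (m : R -> R) : adm p q sg -> 0 < x -> 0 < t ->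
  cmeas hl u -> (forall y, 0 < y -> normc (u y) <= m y) -> intble hl m ->
  ray_integral (p +i* q) (fun la => cexp ('i%C * la * x%:C - la ^+ 2 * t%:C) *
    half_fourier u (sg%:C * la)) =
  (p +i* q) * cintegral hl (fun y => cintegral hl (ker p q (x - sg * y) t) * u y).
Proof.
move=> A x0 t0 hu um im; have [I _ <-] := ker_swap_y A x0 t0 hu um im.
have E r : hl r -> cintegral hl (fun y => ker p q (x - sg * y) t r * u y) =
    cexp ('i%C * (r%:C * (p +i* q)) * x%:C - (r%:C * (p +i* q)) ^+ 2 * t%:C) *
    half_fourier u (sg%:C * (r%:C * (p +i* q))).
  by move=> /hl_gt0 r0; rewrite exp_ker (half_fourier_ker _ _ A r0 hu um im).
rewrite (eq_cint E); apply: (ray_integralE (F := fun la => cexp ('i%C * la * x%:C - la ^+ 2 * t%:C) *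
    half_fourier u (sg%:C * la))).
exact: eq_cintble E I.
Qed.

(** The factor [e] does not vanish, so measurability and integrability of [k] are recovered from
    those of the product [W] and need no separate estimate. *)
Lemma time_piece (t : R) (e : R[i]) (k W : R -> R[i]) : e != 0 ->
  cmeas `]0, t[ W -> cintble `]0, t[ W -> (forall tau, 0 < tau < t -> e * k tau = W tau) ->
  e * cintegral `[0, t] k = cintegral `]0, t[ W.
Proof.
move=> e0 mW iW ek; have mt : measurable (`]0, t[%classic : set R) by [].
have [I E] := cintZ e^-1 mt iW.
have kE tau : `]0, t[%classic tau -> e^-1 * W tau = k tau.
  by move=> /in0t h; rewrite -ek// mulKf.
have mk : cmeas `]0, t[ k.
  have [h1 h2] := cmeasM (cmeas_cst `]0, t[ e^-1) mW; split.
    by apply: eq_measurable_fun h1 => tau /set_mem Dt; rewrite -kE.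
  by apply: eq_measurable_fun h2 => tau /set_mem Dt; rewrite -kE.
by rewrite -cint_closed2// -(eq_cint kE) E mulrA mulfV// mul1r.
Qed.

Lemma ray_f p q sg x t (f : R -> R -> R[i]) (m : R -> R) : adm p q sg -> 0 < x -> 0 < t ->
  (forall tau, 0 < tau -> cmeas hl (f ^~ tau)) ->
  (forall y tau, 0 < y -> 0 < tau -> ccont_at tau (f y)) ->
  (forall y tau, 0 < y -> 0 < tau -> normc (f y tau) <= m y) -> intble hl m ->
  let L tau := cintegral hl (fun y => cintegral hl (ker p q (x - sg * y) (t - tau)) * f y tau) in
  cintble `]0, t[ L /\
  ray_integral (p +i* q) (fun la => cexp ('i%C * la * x%:C - la ^+ 2 * t%:C) *
    time_transform (fun tau => half_fourier (fun y => f y tau) (sg%:C * la)) (omega la) t) =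
  (p +i* q) * cintegral `]0, t[ L.
Proof.
move=> A x0 t0 fm fc fb im L.
have [Wm Wi WI LI <-] := ker_swap_t A x0 t0 fm fc fb im.
split => //.
pose W r tau := cintegral hl (fun y => ker p q (x - sg * y) (t - tau) r * f y tau).
have E r : hl r -> cintegral `]0, t[ (W r) =
    cexp ('i%C * (r%:C * (p +i* q)) * x%:C - (r%:C * (p +i* q)) ^+ 2 * t%:C) *
    time_transform (fun tau => half_fourier (fun y => f y tau) (sg%:C * (r%:C * (p +i* q))))
      (omega (r%:C * (p +i* q))) t.
  move=> /hl_gt0 r0; rewrite exp_ker; symmetry; apply: time_piece; [exact: cexp_neq0|exact: Wm|exact: Wi|].
  move=> tau /andP[h1 h2]; rewrite mulrA exp_ker_time.
  have fbt y : 0 < y -> normc (f y tau) <= m y by move=> y0; exact: fb.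
  by rewrite (half_fourier_ker _ _ A r0 (fm tau h1) fbt im).
rewrite (eq_cint E); apply: (ray_integralE (F := fun la => cexp ('i%C * la * x%:C - la ^+ 2 * t%:C) *
    time_transform (fun tau => half_fourier (fun y => f y tau) (sg%:C * la)) (omega la) t)).
exact: eq_cintble E WI.
Qed.

Lemma ray_g p q x t (g : R -> R[i]) (M : R) : 0 < q -> p ^+ 2 = q ^+ 2 -> 0 < x -> 0 < t ->
  (forall tau, 0 < tau -> ccont_at tau g) ->
  (forall tau, 0 < tau < t -> normc (g tau) <= M) ->
  let L tau := cintegral hl (fun r => ker p q x (t - tau) r * (r%:C * (p +i* q))) * g tau in
  cintble `]0, t[ L /\
  ray_integral (p +i* q) (fun la => cexp ('i%C * la * x%:C - la ^+ 2 * t%:C) * la *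
    time_transform g (omega la) t) =
  (p +i* q) * cintegral `]0, t[ L.
Proof.
move=> q0 pq x0 t0 gc gM L.
have [Wm Wi WI LI <-] := ker_swap_g q0 pq x0 t0 gc gM.
split => //.
pose W r tau := ker p q x (t - tau) r * (r%:C * (p +i* q)) * g tau.
have E r : hl r -> cintegral `]0, t[ (W r) =
    cexp ('i%C * (r%:C * (p +i* q)) * x%:C - (r%:C * (p +i* q)) ^+ 2 * t%:C) *
    (r%:C * (p +i* q)) * time_transform g (omega (r%:C * (p +i* q))) t.
  move=> /hl_gt0 r0; rewrite exp_ker; symmetry; apply: time_piece; [|exact: Wm|exact: Wi|].
    rewrite mulf_neq0 ?cexp_neq0//; apply/negP => /eqP /(congr1 im) /= h.
    by have := mulr_gt0 r0 q0; move: h; rewrite mul0r addr0 => ->; rewrite ltxx.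
  move=> tau _; rewrite /W -(exp_ker_time p q x t tau r).
  by move: (ker _ _ _ _ _) (cexp _) => k e; ring.
rewrite (eq_cint E); apply: (ray_integralE (F := fun la => cexp ('i%C * la * x%:C - la ^+ 2 * t%:C) * la *
    time_transform g (omega la) t)).
exact: eq_cintble E WI.
Qed.

Lemma cint_comb D (a b : R[i]) (h k : R -> R[i]) : measurable D -> cintble D h -> cintble D k ->
  cintble D (fun v => a * h v - b * k v) /\
  cintegral D (fun v => a * h v - b * k v) = a * cintegral D h - b * cintegral D k.
Proof.
move=> mD ih ik; have [I1 E1] := cintZ a mD ih; have [I2 E2] := cintZ b mD ik.
split; last by rewrite -E1 -E2 -cintB.
have [a1 a2] := I1; have [b1 b2] := I2; split.
  by apply: eq_intble (intbleB mD a1 b1) => // v _; rewrite [in RHS]reD [in RHS]reN.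
by apply: eq_intble (intbleB mD a2 b2) => // v _; rewrite [in RHS]imD [in RHS]imN.
Qed.

(** Dividing by [a] transfers integrability from the combination of ray integrals to the real-kernel
    integrand, about which nothing is assumed. *)
Lemma cint_scale D (a : R) (h k : R -> R[i]) : measurable D -> a != 0 -> cintble D h ->
  (forall v, D v -> h v = a%:C * k v) -> cintble D k /\ cintegral D h = a%:C * cintegral D k.
Proof.
move=> mD a0 ih hk; have [I _] := cintZ (a^-1)%:C mD ih.
have ik : cintble D k.
  apply: eq_cintble I => // v Dv; rewrite hk// mulrA.
  rewrite (_ : (a^-1)%:C * a%:C = 1) ?mul1r//.
  by apply: complex_eq; rewrite /= ?mulVf// !(mulr0, mul0r, subr0, addr0).
by split => //; rewrite -(cintZ a%:C mD ik).2; exact: eq_cint.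
Qed.

Lemma cint_comb4 D (a b c d : R[i]) (h1 h2 h3 h4 k : R -> R[i]) (w : R) : measurable D -> w != 0 ->
  cintble D h1 -> cintble D h2 -> cintble D h3 -> cintble D h4 ->
  (forall v, D v -> (a * h1 v - b * h2 v) - (c * h3 v - d * h4 v) = w%:C * k v) ->
  cintble D k /\
  (a * cintegral D h1 - b * cintegral D h2) - (c * cintegral D h3 - d * cintegral D h4) =
  w%:C * cintegral D k.
Proof.
move=> mD w0 i1 i2 i3 i4 hk.
have [K1 E1] := cint_comb a b mD i1 i2; have [K2 E2] := cint_comb c d mD i3 i4.
have [K E] := cint_comb 1 1 mD K1 K2; rewrite -E1 -E2.
have hk' v : D v -> 1 * (a * h1 v - b * h2 v) - 1 * (c * h3 v - d * h4 v) = w%:C * k v.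
  by move=> Dv; rewrite (mul1r (a * _ - _)) (mul1r (c * _ - _)); exact: hk.
have [J F] := cint_scale mD w0 K hk'.
split => //; rewrite -F E.
by rewrite (mul1r (cintegral _ (fun v => a * _ - _))) mul1r.
Qed.

Definition heatAc (u : R -> R[i]) x s : R[i] :=
  heatA (fun y => re (u y)) x s +i* heatA (fun y => im (u y)) x s.

Lemma contour_identity (a b c d u : R[i]) (k1 k2 : R) : c + d = (2 * pi * k1)%:C ->
  (c8 +i* c8) * a - (- c8 +i* c8) * b = (2 * pi * k2)%:C ->
  ((1 +i* 0) * (c * u) - (-1 +i* 0) * (d * u)) -
  ((c8 +i* c8) * (a * u) - (- c8 +i* c8) * (b * u)) = (2 * pi)%:C * ((k1 - k2)%:C * u).
Proof.
move=> h1 h2.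
have -> : 1 +i* 0 = 1 :> R[i] by [].
have -> : -1 +i* 0 = -1 :> R[i] by apply: complex_eq; rewrite //= oppr0.
transitivity (((c + d) - ((c8 +i* c8) * a - (- c8 +i* c8) * b)) * u); first by ring.
by rewrite h1 h2 mulrA; congr (_ * _); apply: complex_eq; rewrite /=; ring.
Qed.

Lemma kernel_u x t (u : R -> R[i]) (m : R -> R) : 0 < x -> 0 < t ->
  cmeas hl u -> (forall y, 0 < y -> normc (u y) <= m y) -> intble hl m ->
  let L p q sg := cintegral hl (fun y => cintegral hl (ker p q (x - sg * y) t) * u y) in
  ((1 +i* 0) * L 1 0 1 - (-1 +i* 0) * L (-1) 0 1) -
  ((c8 +i* c8) * L c8 c8 (-1) - (- c8 +i* c8) * L (- c8) c8 (-1)) = (2 * pi)%:C * heatAc u x t.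
Proof.
move=> x0 t0 hu um im L; have mh : measurable hl by [].
have c0 := @c8_gt0 R.
have A1 : adm (1 : R) 0 1 by left; rewrite expr1n.
have A2 : adm (-1 : R) 0 1 by left; rewrite sqrrN expr1n.
have A3 : adm (c8 : R) c8 (-1) by right.
have A4 : adm (- c8 : R) c8 (-1) by right; rewrite sqrrN.
have [_ J1 _] := ker_swap_y A1 x0 t0 hu um im.
have [_ J2 _] := ker_swap_y A2 x0 t0 hu um im.
have [_ J3 _] := ker_swap_y A3 x0 t0 hu um im.
have [_ J4 _] := ker_swap_y A4 x0 t0 hu um im.
have a0 : 2 * pi != 0 :> R by rewrite mulf_neq0// gt_eqF// pi_gt0.
have H y : hl y -> ((1 +i* 0) * (cintegral hl (ker 1 0 (x - 1 * y) t) * u y) -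
    (-1 +i* 0) * (cintegral hl (ker (-1) 0 (x - 1 * y) t) * u y)) -
    ((c8 +i* c8) * (cintegral hl (ker c8 c8 (x - -1 * y) t) * u y) -
    (- c8 +i* c8) * (cintegral hl (ker (- c8) c8 (x - -1 * y) t) * u y)) =
    (2 * pi)%:C * ((heatG x y t)%:C * u y).
  move=> /hl_gt0 y0.
  have h1 := line_eval (x - 1 * y) t0.
  have xy : 0 < x - -1 * y by rewrite mulN1r opprK addr_gt0.
  have -> : heatG x y t = heatK (x - 1 * y) t - heatK (x - -1 * y) t.
    by rewrite /heatG mul1r mulN1r opprK.
  exact: (contour_identity _ h1 (gamma_eval xy t0)).
have [_ E] := cint_comb4 mh a0 J1 J2 J3 J4 H.
rewrite [LHS]E; congr (_ * _); apply: complex_eq.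
  rewrite re_cint /heatAc /heatA [RHS]/=.
  by apply: eq_Rint => y _; rewrite reM /= mul0r subr0.
rewrite im_cint /heatAc /heatA [RHS]/=.
by apply: eq_Rint => y _; rewrite imM /= mul0r addr0.
Qed.
End fokas_representation.

(** * The contour formula as a sum of three potentials *)

Section fokas_formula.
Context {R : realType}.
Notation mu := (@lebesgue_measure R).
Notation hl := (`]0, +oo[%classic : set R).
Implicit Types (p q sg x y z s t r tau : R).

Lemma pi2_neq0 : 2 * pi != 0 :> R.
Proof. by rewrite mulf_neq0// gt_eqF// pi_gt0. Qed.

Definition heatDc (f : R -> R -> R[i]) x t : R[i] :=
  heatD (fun y tau => re (f y tau)) x t +i* heatD (fun y tau => im (f y tau)) x t.

Definition heatBc (g : R -> R[i]) x t : R[i] :=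
  heatB (fun tau => re (g tau)) x t +i* heatB (fun tau => im (g tau)) x t.

Lemma adm_line (p : R) : p ^+ 2 = 1 -> adm p 0 1.
Proof. by move=> p1; left. Qed.

Lemma adm_gamma (p : R) : p ^+ 2 = c8 ^+ 2 -> adm p c8 (-1).
Proof. by move=> pc; right; split => //; exact: c8_gt0. Qed.

Lemma kernel_f x t (f : R -> R -> R[i]) (m : R -> R) : 0 < x -> 0 < t ->
  (forall tau, 0 < tau -> cmeas hl (f ^~ tau)) ->
  (forall y tau, 0 < y -> 0 < tau -> ccont_at tau (f y)) ->
  (forall y tau, 0 < y -> 0 < tau -> normc (f y tau) <= m y) -> intble hl m ->
  let L p q sg := cintegral `]0, t[
    (fun tau => cintegral hl (fun y => cintegral hl (ker p q (x - sg * y) (t - tau)) * f y tau)) in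
  ((1 +i* 0) * L 1 0 1 - (-1 +i* 0) * L (-1) 0 1) -
  ((c8 +i* c8) * L c8 c8 (-1) - (- c8 +i* c8) * L (- c8) c8 (-1)) = (2 * pi)%:C * heatDc f x t.
Proof.
move=> x0 t0 fm fc fb im L; have mt : measurable (`]0, t[%classic : set R) by [].
have [J1 _] := ray_f (adm_line (expr1n _ _)) x0 t0 fm fc fb im.
have [J2 _] := ray_f (adm_line (etrans (sqrrN _) (expr1n _ _))) x0 t0 fm fc fb im.
have [J3 _] := ray_f (adm_gamma erefl) x0 t0 fm fc fb im.
have [J4 _] := ray_f (adm_gamma (sqrrN _)) x0 t0 fm fc fb im.
have H tau : `]0, t[%classic tau ->
  ((1 +i* 0) * cintegral hl (fun y => cintegral hl (ker 1 0 (x - 1 * y) (t - tau)) * f y tau) -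
   (-1 +i* 0) * cintegral hl (fun y => cintegral hl (ker (-1) 0 (x - 1 * y) (t - tau)) * f y tau)) -
  ((c8 +i* c8) * cintegral hl (fun y => cintegral hl (ker c8 c8 (x - -1 * y) (t - tau)) * f y tau) -
   (- c8 +i* c8) * cintegral hl (fun y => cintegral hl (ker (- c8) c8 (x - -1 * y) (t - tau)) * f y tau)) =
  (2 * pi)%:C * heatAc (f ^~ tau) x (t - tau).
  move=> /in0t/andP[h1 h2]; have ht : 0 < t - tau by rewrite subr_gt0.
  have fbt y : 0 < y -> normc (f y tau) <= m y by move=> y0; exact: fb.
  exact: (kernel_u x0 ht (fm tau h1) fbt im).
have [_ E] := cint_comb4 mt pi2_neq0 J1 J2 J3 J4 H.
by rewrite [LHS]E.
Qed.

Lemma kernel_g x t (g : R -> R[i]) (M : R) : 0 < x -> 0 < t ->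
  (forall tau, 0 < tau -> ccont_at tau g) ->
  (forall tau, 0 < tau < t -> normc (g tau) <= M) ->
  let L p q := cintegral `]0, t[
    (fun tau => cintegral hl (fun r => ker p q x (t - tau) r * (r%:C * (p +i* q))) * g tau) in
  2 * 'i%C * ((c8 +i* c8) * L c8 c8 - (- c8 +i* c8) * L (- c8) c8) =
  - ((2 * pi)%:C * heatBc g x t).
Proof.
move=> x0 t0 gc gM L; have mt : measurable (`]0, t[%classic : set R) by [].
have c0 := @c8_gt0 R.
have [J1 _] := ray_g c0 erefl x0 t0 gc gM.
have [J2 _] := ray_g c0 (sqrrN _) x0 t0 gc gM.
have [K E] := cint_comb (2 * 'i%C * (c8 +i* c8)) (2 * 'i%C * (- c8 +i* c8)) mt J1 J2.
have n0 : - (2 * pi) != 0 :> R by rewrite oppr_eq0 pi2_neq0.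
have H tau : `]0, t[%classic tau ->
  2 * 'i%C * (c8 +i* c8) * (cintegral hl (fun r => ker c8 c8 x (t - tau) r * (r%:C * (c8 +i* c8))) * g tau) -
  2 * 'i%C * (- c8 +i* c8) * (cintegral hl (fun r => ker (- c8) c8 x (t - tau) r * (r%:C * (- c8 +i* c8))) * g tau) =
  (- (2 * pi))%:C * ((heatH x (t - tau))%:C * g tau).
  move=> /in0t/andP[h1 h2]; have ht : 0 < t - tau by rewrite subr_gt0.
  have := gamma_eval_mul x0 ht; set a := cintegral _ _; set b := cintegral _ _ => h.
  transitivity (2 * 'i%C * ((c8 +i* c8) * a - (- c8 +i* c8) * b) * g tau); first by ring.
  by rewrite h mulrA; congr (_ * _); apply: complex_eq; rewrite /=; ring.
have [_ F] := cint_scale mt n0 K H.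
have dist (a b c u v : R[i]) : a * (b * u - c * v) = a * b * u - a * c * v by ring.
apply: etrans (dist _ _ _ _ _) _; apply: etrans (etrans (esym E) F) _.
rewrite (_ : (- (2 * pi))%:C = - (2 * pi)%:C); last by apply: complex_eq; rewrite //= oppr0.
rewrite mulNr; congr (- (_ * _)); apply: complex_eq.
  by rewrite re_cint [RHS]/=; apply: eq_Rint => tau _; rewrite reM /= mul0r subr0.
by rewrite im_cint [RHS]/=; apply: eq_Rint => tau _; rewrite imM /= mul0r addr0.
Qed.

(** The minus sign in the boundary identity meets the minus sign of the formula, so that the
    potential of g0 enters with a plus. *)
Lemma five_terms (w : R) (r1 r2 r3 r4 G f1 f2 f3 f4 A B D : R[i]) : w != 0 ->
  (r1 - r2) - (r3 - r4) = w%:C * A -> 2 * 'i%C * G = - (w%:C * B) ->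
  (f1 - f2) - (f3 - f4) = w%:C * D ->
  (w%:C)^-1 * (r1 - r2 - (r3 - r4) - 2 * 'i%C * G + (f1 - f2) - (f3 - f4)) = A + B + D.
Proof.
move=> w0 h1 h2 h3.
have wc : w%:C != 0 :> R[i].
  by apply/negP => /eqP /(congr1 re) /= h; move: w0; rewrite h eqxx.
rewrite -[X in _ * X]addrA h1 h2 h3.
transitivity (w%:C^-1 * w%:C * (A + B + D)); first by ring.
by rewrite mulVf// mul1r.
Qed.

Lemma fokas_solution_kernel x t (u0 g0 : R -> R[i]) (f : R -> R -> R[i]) (mu0 mf : R -> R) (M : R) :
  0 < x -> 0 < t ->
  cmeas hl u0 -> (forall y, 0 < y -> normc (u0 y) <= mu0 y) -> intble hl mu0 ->
  (forall tau, 0 < tau -> ccont_at tau g0) ->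
  (forall tau, 0 < tau < t -> normc (g0 tau) <= M) ->
  (forall tau, 0 < tau -> cmeas hl (f ^~ tau)) ->
  (forall y tau, 0 < y -> 0 < tau -> ccont_at tau (f y)) ->
  (forall y tau, 0 < y -> 0 < tau -> normc (f y tau) <= mf y) -> intble hl mf ->
  fokas_solution u0 g0 f x t = heatAc u0 x t + heatBc g0 x t + heatDc f x t.
Proof.
move=> x0 t0 hu um im gc gM fm fc fb ifm.
have c0 := @c8_gt0 R.
have A1 := @adm_line 1 (expr1n _ _).
have A2 := @adm_line (-1) (etrans (sqrrN _) (expr1n _ _)).
have A3 := @adm_gamma c8 erefl.
have A4 := @adm_gamma (- c8) (sqrrN _).
have o1 : 1 = 1 +i* 0 :> R[i] by [].
have o2 : -1 = -1 +i* 0 :> R[i] by apply: complex_eq; rewrite //= oppr0.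
have la1 (la : R[i]) : 1%:C * la = la by rewrite mul1r.
have la2 (la : R[i]) : (-1)%:C * la = - la.
  by rewrite -[RHS]mulN1r; congr (_ * _); rewrite o2.
have U1 := ray_u A1 x0 t0 hu um im; have U2 := ray_u A2 x0 t0 hu um im.
have U3 := ray_u A3 x0 t0 hu um im; have U4 := ray_u A4 x0 t0 hu um im.
have [_ F1] := ray_f A1 x0 t0 fm fc fb ifm; have [_ F2] := ray_f A2 x0 t0 fm fc fb ifm.
have [_ F3] := ray_f A3 x0 t0 fm fc fb ifm; have [_ F4] := ray_f A4 x0 t0 fm fc fb ifm.
have [_ G1] := ray_g c0 erefl x0 t0 gc gM.
have [_ G2] := ray_g c0 (sqrrN _) x0 t0 gc gM.
have KU := kernel_u x0 t0 hu um im; have KG := kernel_g x0 t0 gc gM.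
have KF := kernel_f x0 t0 fm fc fb ifm.
have E1 : (fun la : R[i] => cexp ('i%C * la * x%:C - la ^+ 2 * t%:C) * half_fourier u0 (1%:C * la)) =
  (fun la => cexp ('i%C * la * x%:C - la ^+ 2 * t%:C) * half_fourier u0 la).
  by apply/funext => la; rewrite la1.
have E2 : (fun la : R[i] => cexp ('i%C * la * x%:C - la ^+ 2 * t%:C) * half_fourier u0 ((-1)%:C * la)) =
  (fun la => cexp ('i%C * la * x%:C - la ^+ 2 * t%:C) * half_fourier u0 (- la)).
  by apply/funext => la; rewrite la2.
have E3 : (fun la : R[i] => cexp ('i%C * la * x%:C - la ^+ 2 * t%:C) *
    time_transform (fun tau => half_fourier (fun y => f y tau) (1%:C * la)) (omega la) t) =
  (fun la => cexp ('i%C * la * x%:C - la ^+ 2 * t%:C) *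
    time_transform (fun tau => half_fourier (fun y => f y tau) la) (omega la) t).
  by apply/funext => la; rewrite la1.
have E4 : (fun la : R[i] => cexp ('i%C * la * x%:C - la ^+ 2 * t%:C) *
    time_transform (fun tau => half_fourier (fun y => f y tau) ((-1)%:C * la)) (omega la) t) =
  (fun la => cexp ('i%C * la * x%:C - la ^+ 2 * t%:C) *
    time_transform (fun tau => half_fourier (fun y => f y tau) (- la)) (omega la) t).
  by apply/funext => la; rewrite la2.
rewrite E1 in U1 U2; rewrite E2 in U3 U4; rewrite E3 in F1 F2; rewrite E4 in F3 F4.
rewrite /fokas_solution /line_integral /gamma_integral ray_out ray_in.
apply: (five_terms pi2_neq0).
- by rewrite {1}o1 o2 U1 U2 U3 U4; exact: KU.
- by rewrite G1 G2; exact: KG.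
- by rewrite {1}o1 o2 F1 F2 F3 F4; exact: KF.
Qed.
End fokas_formula.

(** * The theorem *)

Section heat_formula.
Context {R : realType}.
Notation hl := (`]0, +oo[%classic : set R).

Definition heat_formula (u g : R -> R) (f : R -> R -> R) (x t : R) : R :=
  heatA u x t + heatB g x t + heatD f x t.

Variables (f fx fxx : R -> R -> R) (f0 fx0 : R -> R) (M : R).
Hypothesis f_x : forall x t : R, 0 < x -> 0 < t -> is_derive x 1 (f ^~ t) (fx x t).
Hypothesis f_xx : forall x t : R, 0 < x -> 0 < t -> is_derive x 1 (fx ^~ t) (fxx x t).
Hypothesis fxx_cont : forall x t : R, 0 < x -> 0 < t -> {for x, continuous (fxx ^~ t)}.
Hypothesis f_0 : forall t : R, 0 < t -> f x t @[x --> 0^'+] --> f0 t.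
Hypothesis fx_0 : forall t : R, 0 < t -> fx x t @[x --> 0^'+] --> fx0 t.
Hypothesis f_t : forall x t : R, 0 < x -> 0 < t -> {for t, continuous (f x)}.
Hypothesis f_M : forall x t : R, 0 < x -> 0 < t ->
  [/\ `|f x t| <= M, `|fx x t| <= M & `|fxx x t| <= M].
Variables (u g : R -> R) (Mu : R).
Hypothesis u_meas : measurable_fun hl u.
Hypothesis u_M : forall y : R, 0 < y -> `|u y| <= Mu.
Hypothesis u_cont : forall y : R, 0 < y -> {for y, continuous u}.
Hypothesis g_cont : forall t : R, 0 < t -> {for t, continuous g}.
Hypothesis g_bound : forall T : R, exists M : R, forall t : R, 0 < t <= T -> `|g t| <= M.
Variable w : R -> R -> R.
Hypothesis wE : forall x t : R, 0 < x -> 0 < t -> w x t = heat_formula u g f x t.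

(** The function [w] is known only on the open quadrant, so derivatives are transferred by local
    equality. The first derivative is provided at all y > 0, because a second derivative at x refers
    to a neighbourhood of x. *)
Lemma heat_formula_solves :
  [/\ forall x t : R, 0 < x -> 0 < t -> exists (w1 : R -> R) (w2 : R),
        [/\ forall y : R, 0 < y -> is_derive y 1 (w ^~ t) (w1 y),
            is_derive x 1 w1 w2 & is_derive t 1 (w x) (f x t + w2)],
      forall x : R, 0 < x -> w x t @[t --> 0^'+] --> u x &
      forall t : R, 0 < t -> w x t @[x --> 0^'+] --> g t].
Proof.
split => [x t x0 t0|x x0|t t0].
- have [B1 [B2 [b1 b2 b3]]] := heatB_heat g_cont g_bound x0 t0.
  have [D1 [D2 [d1 d2 d3]]] := heatD_heat f_x f_xx fxx_cont f_0 fx_0 f_t f_M x0 t0.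
  exists (fun y => heatAx u y t + B1 y t + D1 y t), (heatA2 u x t + B2 + D2); split.
  + move=> y y0; apply: (@near_is_derive _ (fun y => heatA u y t + heatB g y t + heatD f y t)).
      near=> z; rewrite wE//; near: z; exact: lt_nbhsr.
    by apply: is_deriveD; [apply: is_deriveD; [exact: is_derive_heatA_x u_meas u_M _ _ y0 t0|exact: b1]|exact: d1].
  + by apply: is_deriveD; apply: is_deriveD; exact: is_derive_heatAx_x u_meas u_M _ _ x0 t0.
  + apply: (@near_is_derive _ (fun t => heatA u x t + heatB g x t + heatD f x t)).
      near=> s; rewrite wE//; near: s; exact: lt_nbhsr.
    rewrite (_ : f x t + _ = heatA2 u x t + B2 + (f x t + D2)); last by ring.
    by apply: is_deriveD; apply: is_deriveD; exact: is_derive_heatA_t u_meas u_M _ _ x0 t0.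
- have h : heatA u x t + heatB g x t + heatD f x t @[t --> 0^'+] --> u x.
    rewrite -[X in _ --> X]addr0 -[X in _ --> X + _]addr0; apply: cvgD; first apply: cvgD.
    + exact: (heatA_cvg_t u_meas u_M x0 (u_cont x0)).
    + exact: (heatB_cvg_t g_cont g_bound x0).
    + exact: (heatD_cvg_t f_x f_xx fxx_cont f_0 fx_0 f_t f_M x0).
  apply: cvg_trans h; apply: near_eq_cvg; near=> t; rewrite wE//.
- have h : heatA u x t + heatB g x t + heatD f x t @[x --> 0^'+] --> g t.
    rewrite -[X in _ --> X]addr0 -[X in _ --> X + _]add0r; apply: cvgD; first apply: cvgD.
    + exact: (heatA_cvg_x u_meas u_M t0).
    + exact: (heatB_cvg_x g_cont g_bound t0).
    + exact: (heatD_cvg_x f_x f_t f_M t0).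
  apply: cvg_trans h; apply: near_eq_cvg; near=> x; rewrite wE//.
Unshelve. all: by end_near. Qed.
End heat_formula.

(** * Real-variable consequences of the regularity classes *)

Section extraction.
Context {R : realType}.
Notation hl := (`]0, +oo[%classic : set R).
Implicit Types (P : R[i] -> R).

(** Lets the real theory be applied to the real and the imaginary part by a single argument. *)
Definition part P : Prop := P = re \/ P = im.

Lemma part_norm P (z : R[i]) : part P -> `|P z| <= normc z.
Proof. by move=> [->|->]; [exact: normc_re|exact: normc_im]. Qed.

Lemma part_derive P (h : R -> R[i]) (x : R) : part P -> cderivable h x ->
  is_derive x 1 (fun y => P (h y)) (P (cderive h x)).
Proof.
by move=> [->|->] [h1 h2]; apply: DeriveDef; rewrite // /cderive /= derive1E.
Qed.

Lemma part_cvg P (T : Type) (F : set_system T) (h : T -> R[i]) (l : R[i]) : part P ->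
  ccvg F h l -> P (h x) @[x --> F] --> P l.
Proof. by move=> [->|->] []. Qed.

Lemma part_cont P (T : topologicalType) (A : set T) (h : T -> R[i]) : part P ->
  ccontinuous_on A h -> {within A, continuous (fun p => P (h p))}.
Proof. by move=> [->|->] []. Qed.

Lemma cderivable_ccont (h : R -> R[i]) (x : R) : cderivable h x -> ccont_at x h.
Proof.
by move=> [h1 h2]; split; apply: differentiable_continuous; exact/derivable1_diffP.
Qed.

Lemma part_ccont P (h : R -> R[i]) (x : R) : part P -> ccont_at x h ->
  {for x, continuous (fun y => P (h y))}.
Proof. by move=> [->|->] []. Qed.

Lemma within_cvg (S T : topologicalType) (V : Type) (F : set_system V) {FF : Filter F} (A : set T)
    (h : T -> S) (c : V -> T) (p : T) : {within A, continuous h} -> A p ->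
  c x @[x --> F] --> p -> (\forall x \near F, A (c x)) -> h (c x) @[x --> F] --> h p.
Proof.
move=> /subspace_continuousP hc Ap cp cA; apply: (@cvg_trans _ (h @ within A (nbhs p))); last exact: hc.
move=> B /= hB; rewrite /nbhs /= /fmap /= in hB *.
have := cp _ hB; rewrite /nbhs /= => h1; apply: filterS2 cA h1 => x Ax; exact.
Qed.

Lemma pair_cvg_l (x t : R) (F : set_system R) {FF : Filter F} : F --> x ->
  (y, t) @[y --> F] --> (x, t).
Proof. by move=> Fx; exact: (cvg_pair (f := id) Fx (cvg_cst t)). Qed.

(** The Schwartz seminorms with weights 1 and y^2 add up to the integrable majorant. *)
Lemma decay_bound (a y M0 M2 : R) : a <= M0 -> y ^+ 2 * a <= M2 ->
  a <= (M0 + M2) * (1 + y ^+ 2)^-1.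
Proof.
move=> h0 h2; rewrite -ler_pdivrMr ?invr_gt0 ?invrK; last by rewrite ltr_pwDl// sqr_ge0.
by rewrite mulrDr mulr1 lerD// mulrC.
Qed.

Lemma halfline_data (u : R -> R[i]) : schwartz_halfline u ->
  [/\ cmeas hl u, forall y : R, 0 < y -> ccont_at y u,
      exists M : R, forall y : R, 0 < y -> normc (u y) <= M &
      exists C : R, forall y : R, 0 < y -> normc (u y) <= C * (1 + y ^+ 2)^-1].
Proof.
move=> [[_ us] ub]; have [ud _] := us 0%N.
have uc (y : R) : 0 < y -> ccont_at y u by move=> y0; exact/cderivable_ccont/ud.
have [M0 h0] := ub 0%N 0%N; have [M2 h2] := ub 2%N 0%N.
have b0 (y : R) : 0 < y -> normc (u y) <= M0.
  by move=> y0; have := h0 y y0; rewrite expr0 mul1r.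
split => //.
- by apply: cmeas_cont => [|y /hl_gt0]; [exact: interval_open|exact: uc].
- by exists M0.
- exists (M0 + M2) => y y0; apply: decay_bound; [exact: b0|exact: h2].
Qed.

(** The bound reaches down to t = 0 because g is continuous on the closed half-line, hence bounded
    on [0, T]. *)
Lemma smooth_data (g : R -> R[i]) : smooth_halfline g ->
  (forall t : R, 0 < t -> ccont_at t g) /\
  forall T : R, exists M : R, forall t : R, 0 < t <= T -> normc (g t) <= M.
Proof.
move=> [gc gs]; have [gd _] := gs 0%N; split.
  by move=> t t0; exact/cderivable_ccont/gd.
move=> T; have [T0|T0] := leP T 0.
  by exists 0 => t /andP[h1 h2]; have := lt_le_trans h1 (le_trans h2 T0); rewrite ltxx.
have B P : part P -> exists M : R, forall t : R, 0 < t <= T -> `|P (g t)| <= M.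
  move=> pP; have c1 := part_cont pP gc.
  have c2 : {within `[0, T], continuous (fun t => `|P (g t)|)}.
    have c3 : {within `[0, T], continuous (fun t => P (g t))}.
      by apply: continuous_subspaceW c1 => t /=; rewrite !in_itv /= => /andP[-> _].
    by move=> t; apply: cvg_norm; exact: c3.
  have [c _ hc] := EVT_max (ltW T0) c2.
  by exists (`|P (g c)|) => t /andP[h1 h2]; apply: hc; rewrite in_itv /= (ltW h1).
have [M1 h1] := B re (or_introl erefl); have [M2 h2] := B im (or_intror erefl).
exists (2 * (`|M1| + `|M2|)) => t ht; apply: normc_le.
  by apply: le_trans (h1 t ht) _; apply: le_trans (ler_norm _) _; rewrite lerDl.
by apply: le_trans (h2 t ht) _; apply: le_trans (ler_norm _) _; rewrite lerDr.
Qed.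

Lemma edge_cvg (A : set (R * R)) (h : R * R -> R) (t : R) : {within A, continuous h} ->
  A (0, t) -> (forall x : R, 0 < x -> A (x, t)) -> h (x, t) @[x --> 0^'+] --> h (0, t).
Proof.
move=> hc A0 Ax; apply: (within_cvg hc A0); first by apply: pair_cvg_l; exact: cvg_within.
by near=> x; apply: Ax; near: x; exact: nbhs_right_gt.
Unshelve. all: by end_near. Qed.

Lemma slice_cvg (A : set (R * R)) (h : R * R -> R) (x t : R) : {within A, continuous h} ->
  0 < x -> (forall x : R, 0 < x -> A (x, t)) -> {for x, continuous (fun x => h (x, t))}.
Proof.
move=> hc x0 Ax; apply: (within_cvg hc (Ax x x0)); first by apply: pair_cvg_l; exact: cvg_id.
by near=> y; apply: Ax; near: y; exact: lt_nbhsr.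
Unshelve. all: by end_near. Qed.
End extraction.

(** * Verification of the hypotheses of the real theory *)

Section hypotheses.
Context {R : realType}.
Notation hl := (`]0, +oo[%classic : set R).
Implicit Types (P : R[i] -> R).

Definition partial_x P (h : R -> R -> R[i]) (n : nat) (x t : R) : R :=
  P (partial (nseq n true) h x t).

Lemma partial_x_derive P (h : R -> R -> R[i]) n x t : part P ->
  cderivable (fun y => partial (nseq n true) h y t) x ->
  is_derive x 1 (partial_x P h n ^~ t) (partial_x P h n.+1 x t).
Proof. by move=> pP hd; exact: part_derive pP hd. Qed.

Lemma quadrant_data (f : R -> R -> R[i]) : schwartz_quadrant f ->
  [/\ forall t : R, 0 < t -> cmeas hl (f ^~ t),
      forall x t : R, 0 < x -> 0 < t -> ccont_at t (f x) &
      exists C : R, forall x t : R, 0 < x -> 0 < t -> normc (f x t) <= C * (1 + x ^+ 2)^-1].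
Proof.
move=> [fs fb]; have [_ fd _] := fs 1%N; have {}fd := fd [::] isT.
split.
- move=> t t0; apply: cmeas_cont; first exact: interval_open.
  by move=> x /hl_gt0 x0; have [h _] := fd x t x0 t0; exact: cderivable_ccont h.
- by move=> x t x0 t0; have [_ h] := fd x t x0 t0; exact: cderivable_ccont h.
- have [M0 h0] := fb 0%N 0%N [::]; have [M2 h2] := fb 2%N 0%N [::].
  exists (M0 + M2) => x t x0 t0; apply: decay_bound.
    by have := h0 x t x0 t0; rewrite !expr0 !mul1r.
  by have := h2 x t x0 t0; rewrite expr0 mulr1.
Qed.

Lemma quadrant_source P (f : R -> R -> R[i]) : part P -> schwartz_quadrant f ->
  exists (f0 fx0 : R -> R) (M : R),
    [/\ [/\ forall x t : R, 0 < x -> 0 < t ->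
              is_derive x 1 (partial_x P f 0 ^~ t) (partial_x P f 1 x t),
            forall x t : R, 0 < x -> 0 < t ->
              is_derive x 1 (partial_x P f 1 ^~ t) (partial_x P f 2 x t) &
            forall x t : R, 0 < x -> 0 < t -> {for x, continuous (partial_x P f 2 ^~ t)}],
        forall t : R, 0 < t -> partial_x P f 0 x t @[x --> 0^'+] --> f0 t,
        forall t : R, 0 < t -> partial_x P f 1 x t @[x --> 0^'+] --> fx0 t,
        forall x t : R, 0 < x -> 0 < t -> {for t, continuous (partial_x P f 0 x)} &
        forall x t : R, 0 < x -> 0 < t ->
          [/\ `|partial_x P f 0 x t| <= M, `|partial_x P f 1 x t| <= M & `|partial_x P f 2 x t| <= M]].
Proof.
(* Order 3 makes the second x-derivative differentiable, hence continuous in x. *)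
move=> pP [fs fb]; have [_ fd fG] := fs 3%N.
have dx n (x t : R) : (n < 3)%N -> 0 < x -> 0 < t ->
    cderivable (fun y => partial (nseq n true) f y t) x.
  by move=> n3 x0 t0; have [] := fd (nseq n true) (ltac:(by rewrite size_nseq)) x t x0 t0.
have fb0 n : exists M : R, forall x t : R, 0 < x -> 0 < t -> `|partial_x P f n x t| <= M.
  have [M h] := fb 0%N 0%N (nseq n true); exists M => x t x0 t0.
  by apply: le_trans (part_norm _ pP) _; have := h x t x0 t0; rewrite !expr0 !mul1r.
have edge n : (n < 3)%N -> exists f0 : R -> R,
    forall t : R, 0 < t -> partial_x P f n x t @[x --> 0^'+] --> f0 t.
  move=> n3; have [G [Gc GE]] := fG (nseq n true) (ltac:(by rewrite size_nseq ltnW)).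
  exists (fun t => P (G (0, t))) => t t0.
  have h : P (G (x, t)) @[x --> 0^'+] --> P (G (0, t)).
    apply: (edge_cvg (h := fun p => P (G p)) (part_cont pP Gc)); first by split => //=; exact: ltW.
    by move=> x x0; split => /=; exact: ltW.
  apply: cvg_trans h; apply: near_eq_cvg; near=> x; rewrite /partial_x GE//.
have [f0 h0] := edge 0%N isT; have [fx0 h1] := edge 1%N isT.
have [M0 b0] := fb0 0%N; have [M1 b1] := fb0 1%N; have [M2 b2] := fb0 2%N.
exists f0, fx0, (`|M0| + `|M1| + `|M2|); split => //.
- split.
  + by move=> x t x0 t0; apply: partial_x_derive => //; exact: (dx 0%N).
  + by move=> x t x0 t0; apply: partial_x_derive => //; exact: (dx 1%N).
  + move=> x t x0 t0; apply: (part_ccont pP (h := fun y => partial (nseq 2 true) f y t)).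
    exact/cderivable_ccont/(dx 2%N).
- move=> x t x0 t0; apply: (part_ccont pP (h := f x)); apply: cderivable_ccont.
  exact: (fd [::] isT x t x0 t0).2.
- move=> x t x0 t0; have := b0 x t x0 t0; have := b1 x t x0 t0; have := b2 x t x0 t0.
  have := ler_norm M0; have := ler_norm M1; have := ler_norm M2.
  have := normr_ge0 M0; have := normr_ge0 M1; have := normr_ge0 M2.
  move: `|_| `|_| `|_| => a0 a1 a2; move: `|_| `|_| `|_| => c0 c1 c2 *.
  by split; lra.
Unshelve. all: by end_near. Qed.

Lemma part_meas P D (u : R -> R[i]) : part P -> cmeas D u -> measurable_fun D (fun y => P (u y)).
Proof. by move=> [->|->] []. Qed.

Lemma fokas_part P (u0 g0 : R -> R[i]) (f : R -> R -> R[i]) : part P ->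
  schwartz_halfline u0 -> smooth_halfline g0 -> schwartz_quadrant f ->
  forall x t : R, 0 < x -> 0 < t ->
  P (fokas_solution u0 g0 f x t) =
  heat_formula (fun y => P (u0 y)) (fun t => P (g0 t)) (fun y t => P (f y t)) x t.
Proof.
move=> pP hu hg hf x t x0 t0.
have [um _ _ [Cu uC]] := halfline_data hu.
have [gc gb] := smooth_data hg; have [M gM] := gb t.
have [fm fc [Cf fC]] := quadrant_data hf.
have iw (C : R) : intble hl (fun y => C * (1 + y ^+ 2)^-1) by apply: intbleZ => //; exact: intble_oneDsqr.
have gM' tau : 0 < tau < t -> normc (g0 tau) <= M.
  by move=> /andP[h1 h2]; apply: gM; rewrite h1 ltW.
have -> := fokas_solution_kernel x0 t0 um uC (iw Cu) gc gM' fm fc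
  (fun y tau y0 tau0 => fC y tau y0 tau0) (iw Cf).
by case: pP => ->.
Qed.

Lemma fokas_solves (u0 g0 : R -> R[i]) (f : R -> R -> R[i]) :
  schwartz_halfline u0 -> smooth_halfline g0 -> schwartz_quadrant f ->
  solves_heat u0 g0 f (fokas_solution u0 g0 f).
Proof.
move=> hu hg hf; set U := fokas_solution u0 g0 f.
have K P : part P ->
    [/\ forall x t : R, 0 < x -> 0 < t -> exists (w1 : R -> R) (w2 : R),
          [/\ forall y : R, 0 < y -> is_derive y 1 (fun y => P (U y t)) (w1 y),
              is_derive x 1 w1 w2 & is_derive t 1 (fun t => P (U x t)) (P (f x t) + w2)],
        forall x : R, 0 < x -> P (U x t) @[t --> 0^'+] --> P (u0 x) &
        forall t : R, 0 < t -> P (U x t) @[x --> 0^'+] --> P (g0 t)].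
  move=> pP; have [um uc [Mu uM] _] := halfline_data hu.
  have [gc gb] := smooth_data hg.
  have [f0 [fx0 [M [[f1 f2 f3] f4 f5 f6 f7]]]] := quadrant_source pP hf.
  apply: (@heat_formula_solves R _ _ _ _ _ _ f1 f2 f3 f4 f5 f6 f7 (fun y => P (u0 y)) (fun t => P (g0 t))
    Mu _ _ _ _ _ (fun x t => P (U x t))).
  - exact: part_meas um.
  - by move=> y y0; apply: le_trans (uM y y0); exact: part_norm.
  - by move=> y y0; exact: part_ccont (uc y y0).
  - by move=> t t0; exact: part_ccont (gc t t0).
  - move=> T; have [B hB] := gb T; exists B => t ht; apply: le_trans (hB t ht); exact: part_norm.
  - by move=> x t x0 t0; exact: fokas_part.
clearbody U; have [r1 r2 r3] := K re (or_introl erefl); have [i1 i2 i3] := K im (or_intror erefl).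
split.
- move=> x t x0 t0.
  have [w1 [w2 [a1 a2 a3]]] := r1 x t x0 t0; have [v1 [v2 [b1 b2 b3]]] := i1 x t x0 t0.
  (* The identity holds at all y > 0, hence near x, so it may be differentiated once more. *)
  have E y : 0 < y -> derive_x U y t = w1 y +i* v1 y.
    move=> y0; rewrite /derive_x /cderive !derive1E.
    by congr Complex; [have := a1 y y0|have := b1 y y0] => -[_ <-].
  have c1 : is_derive x 1 (fun y => re (derive_x U y t)) w2.
    apply: (@near_is_derive _ w1) => //; near=> y; rewrite E//; near: y; exact: lt_nbhsr.
  have c2 : is_derive x 1 (fun y => im (derive_x U y t)) v2.
    apply: (@near_is_derive _ v1) => //; near=> y; rewrite E//; near: y; exact: lt_nbhsr.
  have [d1 _] := a1 x x0; have [d2 _] := b1 x x0.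
  have [d3 e3] := a3; have [d4 e4] := b3; have [d5 e5] := c1; have [d6 e6] := c2.
  split; [exact: (conj d3 d4)|exact: (conj d1 d2)|exact: (conj d5 d6)|].
  rewrite /derive_t /derive_x -/(derive_x U) /cderive !derive1E.
  apply: complex_eq; rewrite ?reD ?imD ?reN ?imN /=.
    by rewrite e3 e5 addrK.
  by rewrite e4 e6 addrK.
- by move=> x x0; split; [exact: r2|exact: i2].
- by move=> t t0; split; [exact: r3|exact: i3].
Unshelve. all: by end_near. Qed.

Lemma joint_continuity (A : set (R * R)) (h : R * R -> R) (x t eta : R) : {within A, continuous h} ->
  0 < x -> 0 < t -> (forall x t : R, 0 <= x -> 0 < t -> A (x, t)) -> 0 < eta ->
  exists2 d : R, 0 < d & forall x' t' : R, `|x' - x| < d -> `|t' - t| < d ->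
    `|h (x', t') - h (x, t)| <= eta.
Proof.
move=> /subspace_continuousP hc x0 t0 Aq eta0.
have /cvgr_dist_le /(_ _ eta0) := hc (x, t) (Aq x t (ltW x0) t0).
rewrite near_withinE => /nbhs_ballP[e /= e0 he].
(* The distances to the axes are included in the minimum so that the nearby point stays in the open
   quadrant. *)
exists (Num.min e (Num.min x t)); first by rewrite !lt_min e0 x0 t0.
move=> x' t'; rewrite !lt_min => /and3P[h1 h2 h3] /and3P[k1 k2 k3].
have x'0 : 0 < x'.
  by move: h2; rewrite ltr_norml => /andP[h2 _]; lra.
have t'0 : 0 < t'.
  by move: k3; rewrite ltr_norml => /andP[k3 _]; lra.
rewrite distrC; apply: he; last by apply: Aq => //; exact: ltW.
by split; rewrite /= /ball /= distrC.
Qed.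

(** From a <= 1 + a^2. The additive constant is harmless because it is only integrated against
    exponentially decaying kernels. *)
Lemma sqr_bound_le (a B : R) : 0 <= a -> a ^+ 2 <= B -> a <= 1 + B.
Proof. by move=> a0 h; apply: le_trans (_ : 1 + a ^+ 2 <= _); [nra|rewrite lerD2l]. Qed.

Lemma fokas_unique (u0 g0 : R -> R[i]) (f V : R -> R -> R[i]) :
  schwartz_halfline u0 -> smooth_halfline g0 -> schwartz_quadrant f ->
  Ck_upto 2 (@closed_quadrant R `\ (0, 0)) V ->
  solves_heat u0 g0 f V ->
  (forall t : R, 0 < t ->
    ccvg +oo (fun x : R => V x t) 0 /\
    exists M : R, forall x : R, 1 <= x -> normc (derive_x V x t) <= M) ->
  (forall T : R, 0 < T ->
    exists B : R -> R,
      [/\ forall x : R, 0 < x -> 0 < B x, intble hl B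
        & forall x t : R, 0 < x -> 0 < t <= T ->
            normc (V x t) ^+ 2 <= B x /\ normc (derive_t V x t) ^+ 2 <= B x]) ->
  forall x t : R, 0 < x -> 0 < t -> V x t = fokas_solution u0 g0 f x t.
Proof.
move=> hu hg hf hV [Vheat Vinit Vbd] Voo Vdom.
have [Vc Vd VG] := hV.
have Aq (x t : R) : 0 <= x -> 0 < t -> (@closed_quadrant R `\ (0, 0)) (x, t).
  move=> x0 t0; split; first by split => //=; exact: ltW.
  by move=> [_ h]; move: t0; rewrite h ltxx.
suff K P : part P -> forall x t : R, 0 < x -> 0 < t ->
    P (V x t) = heat_formula (fun y => P (u0 y)) (fun t => P (g0 t)) (fun y t => P (f y t)) x t.
  move=> x t x0 t0; apply: complex_eq.
    by rewrite (fokas_part (or_introl erefl) hu hg hf x0 t0) K//; left.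
  by rewrite (fokas_part (or_intror erefl) hu hg hf x0 t0) K//; right.
move=> pP; have [gc gb] := smooth_data hg.
have [f0 [fx0 [M [[f1 f2 f3] f4 f5 f6 f7]]]] := quadrant_source pP hf.
(* [V] is only of class C^2, so continuity of its second x-derivative is read off the continuous
   extension [G2], and the boundary trace of its first derivative off [G1]. *)
have [G1 [G1c G1E]] := VG [:: true] isT; have [G2 [G2c G2E]] := VG [:: true; true] isT.
have Pad (a b : R[i]) : P (a - b) = P a - P b.
  by case: pP => ->; rewrite ?reD ?reN ?imD ?imN.
have P0 : P 0 = 0 by case: pP => ->.
suff H : forall x t : R, 0 < x -> 0 < t -> P (V x t) =
    heatA (fun y => P (u0 y)) x t + heatB (fun t => P (g0 t)) x t + heatD (partial_x P f 0) x t.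
  by move=> x t x0 t0; rewrite H.
have vx1 (x t : R) : 0 < x -> 0 < t -> is_derive x 1 (fun x => P (V x t)) (partial_x P V 1 x t).
  move=> x0 t0; apply: (partial_x_derive (n := 0) pP).
  exact: (Vd [::] isT x t x0 t0).1.
have vx2 (x t : R) : 0 < x -> 0 < t -> is_derive x 1 (partial_x P V 1 ^~ t) (partial_x P V 2 x t).
  move=> x0 t0; apply: (partial_x_derive (n := 1) pP).
  exact: (Vd [:: true] isT x t x0 t0).1.
have vt1 (x t : R) : 0 < x -> 0 < t -> is_derive t 1 (fun t => P (V x t)) (P (derive_t V x t)).
  by move=> x0 t0; apply: (part_derive pP); exact: (Vd [::] isT x t x0 t0).2.
have vx2c (x t : R) : 0 < x -> 0 < t -> {for x, continuous (partial_x P V 2 ^~ t)}.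
  move=> x0 t0; apply: (@near_continuous _ (fun y => P (G2 (y, t)))).
    near=> y; rewrite /partial_x G2E//; near: y; exact: lt_nbhsr.
  apply: (slice_cvg (h := fun p => P (G2 p)) (part_cont pP G2c)) => // y y0.
  by apply: Aq => //; exact: ltW.
have vheat (x t : R) : 0 < x -> 0 < t -> P (derive_t V x t) - partial_x P V 2 x t = partial_x P f 0 x t.
  by move=> x0 t0; have [_ _ _ h] := Vheat x t x0 t0; rewrite /partial_x /= -h Pad.
have vx0 (t : R) : 0 < t -> partial_x P V 1 x t @[x --> 0^'+] --> P (G1 (0, t)).
  move=> t0.
  have h : P (G1 (x, t)) @[x --> 0^'+] --> P (G1 (0, t)).
    apply: (edge_cvg (h := fun p => P (G1 p)) (part_cont pP G1c)); first exact: Aq.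
    by move=> x x0; apply: Aq => //; exact: ltW.
  by apply: cvg_trans h; apply: near_eq_cvg; near=> x; rewrite /partial_x G1E.
have voo (t : R) : 0 < t -> exists N : R,
    \forall x \near +oo, `|P (V x t)| <= N /\ `|partial_x P V 1 x t| <= N.
  move=> t0; have [V0 [N hN]] := Voo t t0; exists (1 + `|N|).
  have h := part_cvg pP V0; rewrite P0 in h.
  near=> x.
  have x1 : 1 <= x by near: x; apply: nbhs_pinfty_ge; exact: num_real.
  split.
    apply: (@le_trans _ _ 1); last by rewrite lerDl.
    rewrite -normrN -[- _]sub0r; near: x; move/cvgr_dist_le: h; apply; exact: ltr01.
  apply: le_trans (part_norm _ pP) _; apply: le_trans (hN x x1) _.
  by apply: le_trans (ler_norm N) _; rewrite lerDr.
have vdom (T : R) : exists B : R -> R,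
    [/\ forall x : R, 0 < x -> 0 <= B x, intble hl B &
      forall x t : R, 0 < x -> 0 < t <= T ->
        `|P (V x t)| <= 1 + B x /\ `|P (derive_t V x t)| <= 1 + B x].
  (* The real theory asks for a weight for every real T, the hypothesis gives one for positive times
     only. *)
  have T1 : 0 < `|T| + 1 by rewrite ltr_wpDl.
  have [B [B0 iB hB]] := Vdom _ T1; exists B; split => //.
    by move=> x x0; exact/ltW/B0.
  move=> x t x0 /andP[t0 tT].
  have tT' : 0 < t <= `|T| + 1.
    by rewrite t0; apply: le_trans tT _; apply: le_trans (ler_norm T) _; rewrite lerDl.
  have [h1 h2] := hB x t x0 tT'.
  split; (apply: le_trans (part_norm _ pP) _; apply: sqr_bound_le; first exact: normc_ge0).
    exact: h1.
  exact: h2.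
have gc' (t : R) : 0 < t -> {for t, continuous (fun t => P (g0 t))}.
  by move=> t0; exact: part_ccont (gc t t0).
have gb' (T : R) : exists M0 : R, forall t : R, 0 < t <= T -> `|P (g0 t)| <= M0.
  have [B hB] := gb T; exists B => t ht; apply: le_trans (hB t ht); exact: part_norm.
have vcont (x t eta : R) : 0 < x -> 0 < t -> 0 < eta -> exists2 d : R, 0 < d &
    forall x' t' : R, `|x' - x| < d -> `|t' - t| < d -> `|P (V x' t') - P (V x t)| <= eta.
  move=> x0 t0 eta0.
  have [d d0 hd] := joint_continuity (part_cont pP Vc) x0 t0 Aq eta0.
  by exists d.
exact: (heat_unique f1 f2 f3 f4 f5 f6 f7 gc' gb' vx1 vx2 vt1 vx2c vheat
  (fun x x0 => part_cvg pP (Vinit x x0)) (fun t t0 => part_cvg pP (Vbd t t0)) vx0 vcont voo vdom).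
Unshelve. all: by end_near. Qed.
End hypotheses.

Theorem theorem2 (R : realType) (u0 g0 : R -> R[i]) (f : R -> R -> R[i])
    (hu0 : schwartz_halfline u0) (hg0 : smooth_halfline g0)
    (hf : schwartz_quadrant f) :
  solves_heat u0 g0 f (fokas_solution u0 g0 f) /\
  (u0 0 = g0 0 ->
   boundary_deriven 2 u0 + f 0 0 = boundary_deriven 1 g0 ->
   forall V : R -> R -> R[i],
     Ck_upto 2 (@closed_quadrant R `\ (0, 0)) V ->
     solves_heat u0 g0 f V ->
     (forall t : R, 0 < t ->
        ccvg +oo (fun x : R => V x t) 0 /\
        exists M : R, forall x : R, 1 <= x -> normc (derive_x V x t) <= M) ->
     (forall T : R, 0 < T ->
        exists B : R -> R,
          [/\ forall x : R, 0 < x -> 0 < B x,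
              lebesgue_measure.-integrable `]0, +oo[ (EFin \o B)
            & forall x t : R, 0 < x -> 0 < t <= T ->
                normc (V x t) ^+ 2 <= B x /\
                normc (derive_t V x t) ^+ 2 <= B x]) ->
     forall x t : R, 0 < x -> 0 < t -> V x t = fokas_solution u0 g0 f x t).
Proof.
split; first exact: fokas_solves.
by move=> _ _ V hV hs ho hd; exact: fokas_unique hu0 hg0 hf hV hs ho hd.
Qed.
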